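(* Let $\ell\ge1$ be an integer, let $\frac{\omega}{\ell}\le h<\frac{\omega}{\ell-\frac12}$ and let $\Phi=(\varphi_1,\dots,\varphi_{2\ell})$ with $\varphi_j\in B_\omega$, $j=1,\dots,2\ell$. Suppose that there exist positive constants $\delta,\gamma,\sigma,\eta$ such that $\delta\le\sum_{j=1}^{2\ell}|\widehat{\varphi_j}|^2\le\gamma$ a.e. in $(-\omega,\omega)$, $[J_{\Phi,t_o}]_{2\ell-1}\ge\sigma$ a.e. in $I_-\cup I_+$, and $|\det J_{\Phi,t_o}|\ge\eta$ a.e. in $I$ (i.e. that $E_{\Phi,t_o}$ is a frame for $B_\omega$). Then the Fourier transform of the vector of dual generators $\Phi^*=(\varphi_1^*,\dots,\varphi_{2\ell}^* )$ is $$\widehat{\Phi^*}=\begin{cases}E\ \displaystyle\mathop{\times}_{j=-\ell-k+1}^{\ell-k-1}\tau_{jh}\overline{\widehat\Phi}\ \big\langle\overline{\widehat\Phi}\leftarrow\tau_{-kh}W\big\rangle & \text{in } I_-+kh,\ \ -(\ell-1)\le k\le\ell-1,\\[3mm] (-1)^{\ell+k}\,D\ \displaystyle\mathop{\times}_{\substack{j=-\ell-k\\ j\ne0}}^{\ell-k-1}\tau_{jh}\overline{\widehat\Phi} & \text{in } I+kh,\ \ -\ell\le k\le\ell-1,\\[3mm] E\ \displaystyle\mathop{\times}_{j=-\ell-k}^{\ell-k-2}\tau_{jh}\overline{\widehat\Phi}\ \big\langle\overline{\widehat\Phi}\leftarrow\tau_{-kh}W_o\big\rangle & \text{in } I_++kh,\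 \ -\ell\le k\le\ell-2,\end{cases}$$ where $W=\mathop{\times}_{j=-\ell+1}^{\ell-1}\tau_{jh}\widehat\Phi$, $W_o=\mathop{\times}_{j=-\ell}^{\ell-2}\tau_{jh}\widehat\Phi$, $E=h^{2\ell-2}(\det\mathbb J_{\Phi,t_o}\mathbb J_{\Phi,t_o}^* )^{-1}$ and $D=h^{\ell-1}(\det J_{\Phi,t_o}^* )^{-1}$.
   Context: Conventions: $\hat f(\xi)=\frac{1}{\sqrt{2\pi}}\int f(t)e^{-it\xi}\,dt$ (extended to $L^2(\mathbb R)$); $\tau_a f(x)=f(x+a)$, applied componentwise to vectors; bar denotes complex conjugation. Fix $\omega>0$ and $B_\omega=\{f\in L^2(\mathbb R):\operatorname{supp}\hat f\subset[-\omega,\omega]\}$; $t_o>0$ and $h=2\pi/t_o$. $N=2\ell$ and $\widehat\Phi=(\widehat{\varphi_1},\dots,\widehat{\varphi_N})$. Cross product: for an ordered $(N-1)$-tuple $U_1,\dots,U_{N-1}\in\mathbb C^N$, $\mathop{\times}_{j=1}^{N-1}U_j=U_1\times\cdots\times U_{N-1}\in\mathbb C^N$ is the formal determinant of the $N\times N$ matrix with first row $(\mathbf e_1,\dots,\mathbf e_N)$ (canonical basis) and following rows $U_1,\dots,U_{N-1}$ (no conjugation); for $N=2$ it is $U=(u_1,u_2)\mapsto(u_2,-u_1)$. For indexed families the factors are taken in increasing order of $j$. $\mathop{\times}_jU_j\langle U_k\leftarrow V\rangle$ denotes the cross product of the tuple obtained by replacing $U_k$ by $V$ in its place; in the formula $\langle\overline{\widehat\Phi}\leftarrow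 V\rangle$ means that the factor with $j=0$ is replaced by $V$. $E_{\Phi,t_o}=\{\tau_{nt_o}\varphi_j:n\in\mathbb Z,\ 1\le j\le N\}$ is a frame for $B_\omega$ if there are $0<A\le B$ with $A\|f\|^2\le\sum_j\sum_n|\langle f,\tau_{nt_o}\varphi_j\rangle|^2\le B\|f\|^2$ for all $f\in B_\omega$. In that case the frame operator $Sf=\sum_j\sum_n\langle f,\tau_{nt_o}\varphi_j\rangle\tau_{nt_o}\varphi_j$ is invertible on $B_\omega$, and the dual generators are $\varphi_j^*=S^{-1}\varphi_j$. Intervals: $I_-=(0,-\omega+\ell h)$, $I=(-\omega+\ell h,\omega-(\ell-1)h)$, $I_+=(\omega-(\ell-1)h,h)$; $I+kh=\{x+kh:x\in I\}$, etc. The pre-Gramian $J_{\Phi,t_o}$ is the $h$-periodic $N\times N$ matrix-valued function given on $[0,h]$ by the rows $\sqrt h\,\tau_{jh}\widehat\Phi$, $j=-\ell,\dots,\ell-1$, in increasing order of $j$ (the first row vanishes on $I_-$, the last on $I_+$). On $I_-\cup I_+$ (and translates by multiples of $h$), $\mathbb J_{\Phi,t_o}$ is the $(N-1)\times N$ matrix obtained by deleting the zero row. $^*$ on a matrix denotes conjugate transpose. Thus $D$ (on $I$ and translates) and $E$ (on $I_-\cup I_+$ and translates) are $h$-periodic functions. $[J]_n$ denotes the sum of the squares of the absolute values of the minors of order $n$ of $J$. Equalities hold almost everywhere.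
   Formalization: In the cases I_-+kh and I_++kh the factor E is replaced by −E: the printed sign is wrong (for ℓ=1, k=0 on I_- it gives −Φ̂/(h|Φ̂|²), whereas the dual is +Φ̂/(h|Φ̂|²)). *)

(* Defs.v *)
From HB Require Import structures.
From mathcomp Require Import all_boot all_order all_algebra finmap.
From mathcomp Require Import all_classical all_reals all_analysis.

Set Implicit Arguments.
Unset Strict Implicit.
Unset Printing Implicit Defensive.

Import Order.TTheory GRing.Theory Num.Theory.
Import numFieldNormedType.Exports.
From mathcomp Require Import complex.

Local Open Scope classical_set_scope.
Local Open Scope ring_scope.
Local Open Scope complex_scope.
Local Open Scope sesquilinear_scope.

Definition leb {R : realType} := @lebesgue_measure R.

(** ** Complex-valued functions on the line

    They are plain functions [R -> R[i]]; everything is invariant under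
    modification on a null set. *)

Definition sqmod {R : realType} (z : R[i]) : R := Re z ^+ 2 + Im z ^+ 2.

Definition cmeasurable {R : realType} (f : R -> R[i]) : Prop :=
  measurable_fun [set: R] (fun x => Re (f x)) /\
  measurable_fun [set: R] (fun x => Im (f x)).

Definition cintegral {R : realType} (f : R -> R[i]) : R[i] :=
  (\int[leb]_x Re (f x)) +i* (\int[leb]_x Im (f x)).

Definition inL1 {R : realType} (f : R -> R[i]) : Prop :=
  leb.-integrable [set: R] (fun x => (Re (f x))%:E) /\
  leb.-integrable [set: R] (fun x => (Im (f x))%:E).

Definition L2normsq {R : realType} (f : R -> R[i]) : \bar R :=
  (\int[leb]_x (sqmod (f x))%:E)%E.

Definition inL2 {R : realType} (f : R -> R[i]) : Prop :=
  cmeasurable f /\ (L2normsq f < +oo)%E.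

Definition inner {R : realType} (f g : R -> R[i]) : R[i] :=
  cintegral (fun x => f x * Num.conj (g x)).

Definition tau {R : realType} {T : Type} (a : R) (f : R -> T) : R -> T :=
  fun x => f (x + a).

(** ** Fourier transform *)

Definition fourierL1 {R : realType} (f : R -> R[i]) : R -> R[i] :=
  fun xi => ((Num.sqrt (2 * pi))^-1)%:C *
            cintegral (fun t => f t * (cos (t * xi) -i* sin (t * xi))).

(** [g] is the Fourier transform of [f] in the [L2] sense: the graph of the
    transform is the [L2]-closure of its restriction to [L1] and [L2]. *)
Definition is_fourier {R : realType} (f g : R -> R[i]) : Prop :=
  [/\ inL2 f, inL2 g &
    exists u : nat -> R -> R[i],
      [/\ forall n, inL1 (u n) /\ inL2 (u n),
          L2normsq (fun x => u n x - f x) @[n --> \oo] --> 0%E &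
          L2normsq (fun x => fourierL1 (u n) x - g x) @[n --> \oo] --> 0%E]].

(** A representative of the (a.e. unique) Fourier transform of [f]. *)
Definition fourier {R : realType} (f : R -> R[i]) : R -> R[i] :=
  xget (cst 0) [set g | is_fourier f g].

Definition fourierv {R : realType} {N : nat} (phi : 'I_N -> R -> R[i]) :
    R -> 'rV[R[i]]_N :=
  fun x => \row_j fourier (phi j) x.

Definition bandlimited {R : realType} (w : R) (f : R -> R[i]) : Prop :=
  exists2 g, is_fourier f g &
    {ae leb, forall x : R, x \notin `[- w, w] -> g x = 0}.

(** ** Frames of translates *)

Definition is_frame {R : realType} (w t0 : R) {N : nat}
    (phi : 'I_N -> R -> R[i]) : Prop :=
  exists A B : R, [/\ 0 < A, A <= B & forall f, bandlimited w f ->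
    let s := (\sum_(j < N) \esum_(n in [set: int])
                (sqmod (inner f (tau (n%:~R * t0) (phi j))))%:E)%E in
    (A%:E * L2normsq f <= s)%E /\ (s <= B%:E * L2normsq f)%E].

(** [g = S f], [S] being the frame operator; the series is summed
    unconditionally in [L2] over the index set of the family. *)
Definition is_frame_op {R : realType} (t0 : R) {N : nat}
    (phi : 'I_N -> R -> R[i]) (f g : R -> R[i]) : Prop :=
  forall e : R, 0 < e -> exists F0 : {fset 'I_N * int},
    forall F : {fset 'I_N * int}, (F0 `<=` F)%fset ->
    (L2normsq (fun x => g x - \sum_(p <- F)
       inner f (tau (p.2%:~R * t0) (phi p.1)) * tau (p.2%:~R * t0) (phi p.1) x)%R
     <= e%:E)%E.

(** [phis j = S^-1 (phi j)] in the space of band-limited functions. *)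
Definition dual_generators {R : realType} (w t0 : R) {N : nat}
    (phi phis : 'I_N -> R -> R[i]) : Prop :=
  forall j, bandlimited w (phis j) /\ is_frame_op t0 phi (phis j) (phi j).

(** ** Cross product *)

(** The factors are the entries of [s], which is meant to have size [N.-1]. The
    formal determinant with first row [(e_1, ..., e_N)] is expanded
    coordinatewise: its [j]-th coordinate is the determinant with first row the
    [j]-th canonical basis vector. *)
Definition cross {R : realType} {N : nat} (s : seq 'rV[R[i]]_N) : 'rV[R[i]]_N :=
  \row_(j < N) \det (\matrix_(i < N) nth 0 (delta_mx 0 j :: s) i).

(** The integers [a, a + 1, ..., b] in increasing order. *)
Definition zrange (a b : int) : seq int :=
  if a <= b then [seq a + i%:Z | i <- iota 0 `|b - a|.+1] else [::].

(** ** Pre-Gramian *)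

Definition Iminus {R : realType} (l : nat) (w h : R) : interval R :=
  `]0, (- w + l%:R * h)[.
Definition Icenter {R : realType} (l : nat) (w h : R) : interval R :=
  `](- w + l%:R * h), (w - (l%:R - 1) * h)[.
Definition Iplus {R : realType} (l : nat) (w h : R) : interval R :=
  `](w - (l%:R - 1) * h), h[.

(** The representative of [x] modulo [h] in [[0, h)]. *)
Definition modh {R : realType} (h x : R) : R :=
  x - (Num.floor (x / h))%:~R * h.

(** Row [i] (counted from 0) corresponds to the shift [j = i - l]. *)
Definition preGram {R : realType} (l : nat) (h : R)
    (Phi : R -> 'rV[R[i]]_(2 * l)) (x : R) : 'M[R[i]]_(2 * l) :=
  \matrix_(i < 2 * l)
    ((Num.sqrt h)%:C *: tau ((i%:Z - l%:Z)%:~R * h) Phi (modh h x)).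

Lemma ord_tail_subproof (n : nat) (i : 'I_n.-1) : (i.+1 < n)%N.
Proof. by rewrite -ltn_predRL. Qed.
Definition ord_tail (n : nat) (i : 'I_n.-1) : 'I_n :=
  Ordinal (ord_tail_subproof i).

(** The pre-Gramian without its first row on the translates of [Iminus], and
    without its last row on the translates of [Iplus] (the value elsewhere is
    irrelevant). *)
Definition preGramR {R : realType} (l : nat) (w h : R)
    (Phi : R -> 'rV[R[i]]_(2 * l)) (x : R) : 'M[R[i]]_((2 * l).-1, 2 * l) :=
  if modh h x \in Iminus l w h then rowsub (@ord_tail _) (preGram h Phi x)
  else rowsub (widen_ord (leq_pred _)) (preGram h Phi x).

Definition increasing (n m : nat) (f : 'I_n -> 'I_m) : bool :=
  [forall i : 'I_n, forall j : 'I_n, (i < j)%N ==> (f i < f j)%N].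

(** The sum of the squared moduli of the minors of order [n]: the rows and the
    columns of a minor are selected by increasing maps. *)
Definition sqminors {R : realType} (n p q : nat) (A : 'M[R[i]]_(p, q)) : R :=
  \sum_(f : {ffun 'I_n -> 'I_p} | increasing f)
  \sum_(g : {ffun 'I_n -> 'I_q} | increasing g)
    sqmod (\det (mxsub f g A)).

Definition Dfun {R : realType} (l : nat) (h : R)
    (Phi : R -> 'rV[R[i]]_(2 * l)) (x : R) : R[i] :=
  (h ^+ (l - 1))%:C * (\det ((preGram h Phi x) ^t*))^-1.

Definition Efun {R : realType} (l : nat) (w h : R)
    (Phi : R -> 'rV[R[i]]_(2 * l)) (x : R) : R[i] :=
  (h ^+ (2 * l - 2))%:C *
  (\det (preGramR w h Phi x *m (preGramR w h Phi x) ^t*))^-1.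

(** ** Right-hand sides of the dual generator formula

    On [Iminus] and [Iplus] the row [k] of the dual pre-Gramian is proportional
    to the cross product [C] of the conjugates of the rows [U_m] with [W] in
    place of [U_k], where [W] is the cross product of the [U_m]. Exchanging two
    rows of a determinant gives [<C, U_k> = - |W|^2], whence the minus sign in
    front of [Efun] below; for [l = 1] this is the fact that
    [cross [:: cross [:: U]] = - U]. *)

Definition Wminus {R : realType} (l : nat) (h : R)
    (Phi : R -> 'rV[R[i]]_(2 * l)) (x : R) : 'rV[R[i]]_(2 * l) :=
  cross [seq tau (j%:~R * h) Phi x | j <- zrange (- l%:Z + 1) (l%:Z - 1)].

Definition Wplus {R : realType} (l : nat) (h : R)
    (Phi : R -> 'rV[R[i]]_(2 * l)) (x : R) : 'rV[R[i]]_(2 * l) :=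
  cross [seq tau (j%:~R * h) Phi x | j <- zrange (- l%:Z) (l%:Z - 2)].

Definition dual_minus {R : realType} (l : nat) (w h : R)
    (Phi : R -> 'rV[R[i]]_(2 * l)) (k : int) (x : R) : 'rV[R[i]]_(2 * l) :=
  (- Efun w h Phi x) *:
  cross [seq (if j == 0 then tau (- (k%:~R * h)) (Wminus h Phi) x
              else map_mx Num.conj (tau (j%:~R * h) Phi x))
        | j <- zrange (- l%:Z - k + 1) (l%:Z - k - 1)].

Definition dual_center {R : realType} (l : nat) (h : R)
    (Phi : R -> 'rV[R[i]]_(2 * l)) (k : int) (x : R) : 'rV[R[i]]_(2 * l) :=
  ((-1) ^ (l%:Z + k) * Dfun h Phi x) *:
  cross [seq map_mx Num.conj (tau (j%:~R * h) Phi x)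
        | j <- zrange (- l%:Z - k) (l%:Z - k - 1) & j != 0].

Definition dual_plus {R : realType} (l : nat) (w h : R)
    (Phi : R -> 'rV[R[i]]_(2 * l)) (k : int) (x : R) : 'rV[R[i]]_(2 * l) :=
  (- Efun w h Phi x) *:
  cross [seq (if j == 0 then tau (- (k%:~R * h)) (Wplus h Phi) x
              else map_mx Num.conj (tau (j%:~R * h) Phi x))
        | j <- zrange (- l%:Z - k) (l%:Z - k - 2)].

(* Main.v *)
(** On the Fourier side the translate of [phi_i] by [n t0] is an exponential of
    frequency [n t0] times [phi_i^], so the frame coefficients of [f] are, for
    each [i], the Fourier coefficients on [[0, h)] of the [h]-periodization of
    [f^ conj(phi_i^)]. By Parseval, everything happens fibrewise at almost every
    [x] in [[0, h)]: with [v = (f^(x + j h))_j] and [J] the pre-Gramian, the frame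
    sum is the integral of [|v conj(J)|^2], and the frame operator acts as
    [J J^t*], so that the dual generators are given by the solution [Q] of
    [J J^t* Q = J], where [Q] vanishes on the rows on which [J] does.

    When row [i0] of [J] is zero, [K = J J^t* + e e^t*], with [e] the basis vector
    of index [i0], has as its determinant the sum of the squared moduli of the
    maximal minors of the other rows; the hypotheses thus bound [det K] from
    below, which gives the frame inequalities and [Q = K^-1 J]. When [J] is
    invertible, [Q] is the inverse of [J^t*]; its rows consist of cofactors, hence
    are cross products.
    Otherwise, a row of [Q] is characterized by being biorthogonal to the nonzero
    rows of [J] and orthogonal to the conjugate of their cross product [W], and
    these relations also determine the cross product in the formula.

    The [L2] theory of the Fourier transform is deduced from Parseval's identity
    for Fourier series: if [u] has support in an interval of length [T], the
    samples of [u^] along a progression of step [2 pi / T] are Fourier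
    coefficients of a modulation of [u]. *)
Require Import Defs.
From HB Require Import structures.
From mathcomp Require Import all_boot all_order all_algebra finmap.
From mathcomp Require Import all_classical all_reals all_analysis.
From mathcomp Require Import perm measurable_realfun ring lra zify.
Import Order.TTheory GRing.Theory Num.Theory.
Import numFieldNormedType.Exports.
From mathcomp Require Import complex.
Set Implicit Arguments.
Unset Strict Implicit.
Unset Printing Implicit Defensive.
Local Open Scope classical_set_scope.
Local Open Scope ring_scope.
Local Open Scope complex_scope.

(** * Complex-valued functions *)

(** Hypotheses hold only almost everywhere and [fourier] picks an arbitrary representative, so the
    transforms are first cut down to functions [G] that are bounded and vanish outside the open band
    at every point; products and integrals on the fibres then need no exceptional set. Since the
    dual generators are constructed on the Fourier side, an isometry is not enough: each constructed
    function must be shown to be a transform. Surjectivity is therefore proved, on integrable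
    functions, which suffices because the constructed transforms have bounded support. The powers of
    [h] reconcile [J = sqrt(h) U] with the unscaled rows [U]. With [n = 2l - 1], a cofactor of [J]
    is [h^(n/2)] times one of [U], while [Q] carries [sqrt(h)]; what remains is [h^(l-1)], the
    factor of [D]. On the side intervals [det K = h^n |W|^2], so that [E = 1 / (h |W|^2)], the
    normalization under which a row of [Q] is biorthogonal to the rows of [J]. The upper bound on
    [h] makes [Iminus] end before [Iplus] begins, so that at most one row vanishes on a fibre. *)

Section ComplexBasics.
Context {R : realType}.
Implicit Types (z : R[i]) (f g : R -> R[i]).

Lemma conjE (a b : R) : Num.conj (a +i* b) = a -i* b. Proof. by []. Qed.
Lemma Re_conj z : Re (Num.conj z) = Re z. Proof. by case: z. Qed.
Lemma Im_conj z : Im (Num.conj z) = - Im z. Proof. by case: z. Qed.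
Lemma ReM z z' : Re (z * z') = Re z * Re z' - Im z * Im z'.
Proof. by case: z => a b; case: z'. Qed.
Lemma ImM z z' : Im (z * z') = Re z * Im z' + Im z * Re z'.
Proof. by case: z => a b; case: z'. Qed.
Lemma ReD z z' : Re (z + z') = Re z + Re z'.
Proof. by case: z => a b; case: z'. Qed.
Lemma ImD z z' : Im (z + z') = Im z + Im z'.
Proof. by case: z => a b; case: z'. Qed.
Lemma ReN z : Re (- z) = - Re z. Proof. by case: z. Qed.
Lemma ImN z : Im (- z) = - Im z. Proof. by case: z. Qed.
Lemma Re_sum (I : Type) (s : seq I) (P : pred I) (F : I -> R[i]) :
  Re (\sum_(i <- s | P i) F i) = \sum_(i <- s | P i) Re (F i).
Proof. by elim/big_ind2: _ => //= a b c d <- <-; rewrite ReD. Qed.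
Lemma complexP z z' : Re z = Re z' -> Im z = Im z' -> z = z'.
Proof. by case: z => a b; case: z' => c d /= -> ->. Qed.

Lemma sqmod_ge0 z : 0 <= sqmod z.
Proof. by rewrite addr_ge0 ?sqr_ge0. Qed.
Lemma sqmod0 : sqmod (0 : R[i]) = 0.
Proof. by rewrite /sqmod /= expr0n /= addr0. Qed.
Lemma sqmod1 : sqmod (1 : R[i]) = 1.
Proof. by rewrite /sqmod /= expr0n /= expr1n addr0. Qed.
Lemma sqmod_eq0 z : sqmod z = 0 -> z = 0.
Proof.
move=> /eqP; rewrite paddr_eq0 ?sqr_ge0// !sqrf_eq0 => /andP[/eqP h1 /eqP h2].
exact: complexP.
Qed.
Lemma sqmodM z z' : sqmod (z * z') = sqmod z * sqmod z'.
Proof. by rewrite /sqmod ReM ImM; ring. Qed.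
Lemma sqmodN z : sqmod (- z) = sqmod z.
Proof. by rewrite /sqmod ReN ImN !sqrrN. Qed.
Lemma sqmodBC z z' : sqmod (z - z') = sqmod (z' - z).
Proof. by rewrite -sqmodN opprB. Qed.
Lemma sqmod_conj z : sqmod (Num.conj z) = sqmod z.
Proof. by rewrite /sqmod Re_conj Im_conj sqrrN. Qed.
Lemma sqmodR (x : R) : sqmod (x%:C) = x ^+ 2.
Proof. by rewrite /sqmod /= expr0n addr0. Qed.
Lemma mul_conj z : z * Num.conj z = (sqmod z)%:C.
Proof.
by apply: complexP; rewrite ?ReM ?ImM Re_conj Im_conj /sqmod /=; ring.
Qed.
Lemma sqmodV z : sqmod z^-1 = (sqmod z)^-1.
Proof.
have [->|z0] := eqVneq z 0; first by rewrite invr0 sqmod0 invr0.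
have h : sqmod z * sqmod z^-1 = 1 by rewrite -sqmodM mulfV// sqmod1.
have n0 : sqmod z != 0 by apply: contra_neq z0 => /sqmod_eq0.
by apply: (mulfI n0); rewrite h mulfV.
Qed.
(** The difference of the two sides is [t |z - z'/t|^2]. The weight [t] is kept free because limits
    of norms are later compared by letting it tend to 0. *)
Lemma sqmod_young (t : R) z z' : 0 < t ->
  sqmod (z + z') <= (1 + t) * sqmod z + (1 + t^-1) * sqmod z'.
Proof.
move=> t0; rewrite /sqmod ReD ImD.
have key (a b : R) : (a + b) ^+ 2 <= (1 + t) * a ^+ 2 + (1 + t^-1) * b ^+ 2.
  have -> : (1 + t) * a ^+ 2 + (1 + t^-1) * b ^+ 2 =
     (a + b) ^+ 2 + t * (a - t^-1 * b) ^+ 2.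
    by field; exact: lt0r_neq0.
  by rewrite lerDl mulr_ge0 ?sqr_ge0// ltW.
apply: (le_trans (lerD (key _ _) (key _ _))).
by rewrite le_eqVlt; apply/orP; left; apply/eqP; ring.
Qed.
Lemma sqmodD_le z z' : sqmod (z + z') <= 2 * sqmod z + 2 * sqmod z'.
Proof. by have := sqmod_young z z' ltr01; rewrite invr1. Qed.
Lemma sqmod_sum_le (n : nat) (F : 'I_n -> R[i]) :
  sqmod (\sum_(i < n) F i) <= n%:R * \sum_(i < n) sqmod (F i).
Proof.
elim: n F => [|n IH] F; first by rewrite !big_ord0 sqmod0 mulr0.
rewrite big_ord_recl [X in _ * X]big_ord_recl; case: n IH F => [|n] IH F.
  by rewrite !big_ord0 !addr0 mul1r.
(* With [t] the number of remaining terms, both coefficients become the total number of terms, since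
   [(1 + t^-1) t = 1 + t]. *)
apply: (le_trans (@sqmod_young n.+1%:R _ _ _)) => //.
have e : n.+2%:R = 1 + n.+1%:R :> R by rewrite -[in LHS]natr1 addrC.
rewrite [X in _ <= X]mulrDr; apply: lerD; first by rewrite e.
apply: (le_trans (ler_wpM2l _ (IH _))); first by rewrite addr_ge0 ?invr_ge0.
rewrite mulrA ler_wpM2r ?sumr_ge0// => [i _|]; first exact: sqmod_ge0.
by rewrite mulrDl mul1r mulVf// natr1.
Qed.
Lemma sqr_Re_le z : Re z ^+ 2 <= sqmod z.
Proof. by rewrite lerDl sqr_ge0. Qed.
Lemma sqr_Im_le z : Im z ^+ 2 <= sqmod z.
Proof. by rewrite lerDr sqr_ge0. Qed.
Lemma normRe_mul z z' : `|Re (z * z')| <= sqmod z + sqmod z'.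
Proof.
rewrite ReM /sqmod ler_norml; apply/andP.
have [h1 h2] := (sqr_ge0 (Re z + Re z'), sqr_ge0 (Re z - Re z')).
have [h3 h4] := (sqr_ge0 (Im z + Im z'), sqr_ge0 (Im z - Im z')).
have [[[h5 h6] h7] h8] := (sqr_ge0 (Re z), sqr_ge0 (Re z'), sqr_ge0 (Im z), sqr_ge0 (Im z')).
by split; nra.
Qed.
Lemma normIm_mul z z' : `|Im (z * z')| <= sqmod z + sqmod z'.
Proof.
rewrite ImM /sqmod ler_norml; apply/andP.
have [h1 h2] := (sqr_ge0 (Re z + Im z'), sqr_ge0 (Re z - Im z')).
have [h3 h4] := (sqr_ge0 (Im z + Re z'), sqr_ge0 (Im z - Re z')).
have [[[h5 h6] h7] h8] := (sqr_ge0 (Re z), sqr_ge0 (Re z'), sqr_ge0 (Im z), sqr_ge0 (Im z')).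
by split; nra.
Qed.

Lemma cmeas_cst z : cmeasurable (fun _ : R => z).
Proof. by split; exact: measurable_cst. Qed.
Lemma cmeasD f g : cmeasurable f -> cmeasurable g ->
  cmeasurable (fun x => f x + g x).
Proof.
move=> [f1 f2] [g1 g2]; split.
  by under eq_fun do rewrite ReD; exact: measurable_funD.
by under eq_fun do rewrite ImD; exact: measurable_funD.
Qed.
Lemma cmeasN f : cmeasurable f -> cmeasurable (fun x => - f x).
Proof.
move=> [f1 f2]; split.
  by under eq_fun do rewrite ReN; exact: measurable_funN.
by under eq_fun do rewrite ImN; exact: measurable_funN.
Qed.
Lemma cmeasB f g : cmeasurable f -> cmeasurable g ->
  cmeasurable (fun x => f x - g x).
Proof. by move=> mf mg; apply: cmeasD => //; exact: cmeasN. Qed.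
Lemma cmeasM f g : cmeasurable f -> cmeasurable g ->
  cmeasurable (fun x => f x * g x).
Proof.
move=> [f1 f2] [g1 g2]; split.
  under eq_fun do rewrite ReM.
  by apply: measurable_funB; exact: measurable_funM.
under eq_fun do rewrite ImM.
by apply: measurable_funD; exact: measurable_funM.
Qed.
Lemma cmeas_conj f : cmeasurable f -> cmeasurable (fun x => Num.conj (f x)).
Proof.
move=> [f1 f2]; split.
  by under eq_fun do rewrite Re_conj.
by under eq_fun do rewrite Im_conj; exact: measurable_funN.
Qed.
Lemma cmeas_RtoC (f : R -> R) : measurable_fun [set: R] f ->
  cmeasurable (fun x => (f x)%:C).
Proof. by move=> mf; split => //=; exact: measurable_cst. Qed.
Lemma cmeas_sum (I : Type) (s : seq I) (P : pred I) (F : I -> R -> R[i]) :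
  (forall i, cmeasurable (F i)) -> cmeasurable (fun x => \sum_(i <- s | P i) F i x).
Proof.
move=> mF; elim: s => [|i s IH].
  by under eq_fun do rewrite big_nil; exact: cmeas_cst.
case h: (P i); under eq_fun do rewrite big_cons h; last exact: IH.
exact: cmeasD.
Qed.
Lemma cmeas_prod (I : Type) (s : seq I) (P : pred I) (F : I -> R -> R[i]) :
  (forall i, cmeasurable (F i)) -> cmeasurable (fun x => \prod_(i <- s | P i) F i x).
Proof.
move=> mF; elim: s => [|i s IH].
  by under eq_fun do rewrite big_nil; exact: cmeas_cst.
case h: (P i); under eq_fun do rewrite big_cons h; last exact: IH.
exact: cmeasM.
Qed.
Lemma measurable_sqmod f : cmeasurable f ->
  measurable_fun [set: R] (fun x => sqmod (f x)).
Proof.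
by move=> [f1 f2]; apply: measurable_funD; exact: measurable_funX.
Qed.
Lemma measurable_esqmod f : cmeasurable f ->
  measurable_fun [set: R] (fun x => (sqmod (f x))%:E).
Proof. by move=> mf; apply/measurable_EFinP; exact: measurable_sqmod. Qed.
(** The inverse is the conjugate divided by the squared modulus; at a zero of [f] both expressions
    are 0 because [0^-1 = 0]. *)
Lemma cmeas_inv f : cmeasurable f -> cmeasurable (fun x => (f x)^-1).
Proof.
move=> mf.
have -> : (fun x => (f x)^-1) =
    (fun x => Num.conj (f x) * (powR (sqmod (f x)) (-1))%:C).
  apply/funext => x; rewrite powR_inv1 ?sqmod_ge0//.
  have [->|n0] := eqVneq (f x) 0.
    by rewrite sqmod0 !invr0 mulr0.
  have s0 : sqmod (f x) != 0 by apply: contra_neq n0 => /sqmod_eq0.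
  apply: (mulfI n0); rewrite mulfV// mulrA mul_conj -rmorphM mulfV//.
apply: cmeasM; first exact: cmeas_conj.
apply: cmeas_RtoC; apply: (measurableT_comp (measurable_powR (-1))).
exact: measurable_sqmod.
Qed.
Lemma cmeas_indic (A : set R) : measurable A ->
  cmeasurable (fun x => (\1_A x)%:C : R[i]).
Proof. by move=> mA; apply: cmeas_RtoC; exact: measurable_indic. Qed.
Lemma measurable_shift (a : R) : measurable_fun [set: R] (fun x : R => x + a).
Proof. by apply: measurable_funD => //; exact: measurable_cst. Qed.
Lemma cmeas_tau a f : cmeasurable f -> cmeasurable (tau a f).
Proof.
by move=> [f1 f2]; split; [apply: (measurableT_comp f1)|apply: (measurableT_comp f2)];
  exact: measurable_shift.
Qed.

End ComplexBasics.

(** * Translation invariance and almost everywhere statements *)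

Section Translation.
Context {R : realType}.

Let shift (a : R) (x : measurableTypeR R) : measurableTypeR R := x + a.

(** Lebesgue measure is determined by its values on half-open intervals, and the image measure has
    the same ones. *)
Lemma leb_shift (a : R) (A : set R) : measurable A ->
  pushforward (@leb R) (fun x : measurableTypeR R => (x + a : measurableTypeR R)) A = leb A.
Proof.
move=> mA; apply/esym.
have mphi : measurable_fun [set: measurableTypeR R]
  (fun x : measurableTypeR R => (x + a : measurableTypeR R)).
  exact: measurable_shift.
apply: (@lebesgue_measure_unique R (measure_function_pushforward__canonical__measure_function_Measure _ mphi)) => //.
move=> _ [[c d]] _ <- /=.
rewrite /pushforward.
have -> : (fun x : measurableTypeR R => x + a) @^-1` `]c, d] = `]c - a, d - a]%classic.
  by apply/seteqP; split => x /=; rewrite !in_itv/= ltrBlDr lerBrDr.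
rewrite /leb !lebesgue_measure_itv/= !lte_fin ltrBlDr subrK.
by case: ifP => // _; rewrite -!EFinB opprB addrA subrK.
Qed.

Lemma aeS (P Q : R -> Prop) : (forall x, P x -> Q x) ->
  {ae leb, forall x, P x} -> {ae leb, forall x, Q x}.
Proof.
by move=> PQ [A [mA A0 sA]]; exists A; split=> // x /= nQ; apply: sA => /= /PQ.
Qed.

Lemma aeI (P Q : R -> Prop) : {ae leb, forall x, P x} ->
  {ae leb, forall x, Q x} -> {ae leb, forall x, P x /\ Q x}.
Proof.
move=> hP hQ; apply: (negligibleS _ (negligibleU hP hQ)) => x /=.
by move=> /not_andP[nP|nQ]; [left|right].
Qed.

Lemma aeT (P : R -> Prop) : (forall x, P x) -> {ae leb, forall x, P x}.
Proof. by move=> h; exists set0; split => // x /=. Qed.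

Lemma ae_ffun (I : finType) (P : I -> R -> Prop) :
  (forall i, {ae leb, forall x, P i x}) -> {ae leb, forall x, forall i, P i x}.
Proof.
move=> h.
have key (s : seq I) : {ae leb, forall x, forall i, i \in s -> P i x}.
  elim: s => [|i s IH]; first exact: aeT.
  apply: (aeS _ (aeI (h i) IH)) => x [h1 h2] j.
  by rewrite inE => /predU1P[->//|]; exact: h2.
by apply: (aeS _ (key (enum I))) => x hx i; apply: hx; rewrite mem_enum.
Qed.

Lemma ge0_integral_shift (a : R) (f : R -> \bar R) :
  measurable_fun [set: R] f -> (forall x, (0 <= f x)%E) ->
  (\int[leb]_x f (x + a)%R = \int[leb]_x f x)%E.
Proof.
move=> mf f0.
have := @ge0_integral_pushforward _ _ _ _ R (shift a) (measurable_shift a) leb setT f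
  measurableT mf (fun x _ => f0 x).
rewrite preimage_setT => <-.
apply: eq_measure_integral => [|m A mA _]; first exact: measurable_shift.
exact: leb_shift.
Qed.

Lemma integrable_shift (a : R) (f : R -> \bar R) :
  leb.-integrable [set: R] f -> leb.-integrable [set: R] (fun x => f (x + a)).
Proof.
move=> /integrableP[mf fi]; apply/integrableP; split.
  by apply: (measurableT_comp mf); exact: measurable_shift.
rewrite (@ge0_integral_shift a (fun x => `|f x|%E))//.
exact: measurableT_comp.
Qed.

Lemma integral_shift (a : R) (f : R -> \bar R) :
  leb.-integrable [set: R] f -> (\int[leb]_x f (x + a)%R = \int[leb]_x f x)%E.
Proof.
move=> fi; have [mf _] := integrableP _ _ _ fi.
have := @integral_pushforward _ _ _ _ R (shift a) (measurable_shift a) leb setT f mf.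
rewrite preimage_setT => /(_ (integrable_shift a fi) measurableT) <-.
apply: eq_measure_integral => [|m A mA _]; first exact: measurable_shift.
exact: leb_shift.
Qed.

Lemma ae_shift (a : R) (P : R -> Prop) :
  {ae leb, forall x, P x} -> {ae leb, forall x, P (x + a)}.
Proof.
move=> [A [mA A0 sA]]; exists ((fun x => x + a) @^-1` A); split.
- by rewrite -[X in measurable X]setTI; apply: measurable_shift.
- by have := leb_shift a mA; rewrite A0.
- by move=> x /= h; apply: sA.
Qed.
End Translation.

(** * Integrable complex-valued functions *)

Section L1L2.
Context {R : realType}.
Implicit Types (f g b : R -> R[i]) (z c : R[i]).

Lemma le_inL1 f (g : R -> R) : cmeasurable f ->
  leb.-integrable [set: R] (fun x => (g x)%:E) ->
  (forall x, `|Re (f x)| <= g x) -> (forall x, `|Im (f x)| <= g x) -> inL1 f.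
Proof.
move=> [m1 m2] ig h1 h2; split.
  apply: (le_integrable _ _ _ ig) => //; first exact/measurable_EFinP.
  by move=> x _ /=; rewrite lee_fin (le_trans (h1 x))// ler_norm.
apply: (le_integrable _ _ _ ig) => //; first exact/measurable_EFinP.
by move=> x _ /=; rewrite lee_fin (le_trans (h2 x))// ler_norm.
Qed.

Lemma inL1_meas f : inL1 f -> cmeasurable f.
Proof.
by move=> [/integrableP[m1 _] /integrableP[m2 _]]; split; exact/measurable_EFinP.
Qed.

Lemma inL1D f g : inL1 f -> inL1 g -> inL1 (fun x => f x + g x).
Proof.
move=> [f1 f2] [g1 g2]; split.
  under eq_fun do rewrite ReD EFinD.
  exact: integrableD.
under eq_fun do rewrite ImD EFinD.
exact: integrableD.
Qed.

Lemma inL1Z c f : inL1 f -> inL1 (fun x => c * f x).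
Proof.
move=> [f1 f2]; split.
  under eq_fun do rewrite ReM EFinB EFinM EFinM.
  by apply: integrableB => //; exact: integrableZl.
under eq_fun do rewrite ImM EFinD EFinM EFinM.
by apply: integrableD => //; exact: integrableZl.
Qed.

Lemma inL1N f : inL1 f -> inL1 (fun x => - f x).
Proof. by move=> /(inL1Z (-1)); under eq_fun do rewrite mulN1r. Qed.

Lemma inL1B f g : inL1 f -> inL1 g -> inL1 (fun x => f x - g x).
Proof. by move=> f1 g1; apply: inL1D => //; exact: inL1N. Qed.

Lemma inL1_conj f : inL1 f -> inL1 (fun x => Num.conj (f x)).
Proof.
move=> [f1 f2]; split; first by under eq_fun do rewrite Re_conj.
by under eq_fun do rewrite Im_conj EFinN; exact: integrableN.
Qed.

Lemma inL1_0 : inL1 (fun=> 0 : R[i]).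
Proof. by split; exact: integrable0. Qed.

Lemma inL1_sum (I : Type) (s : seq I) (P : pred I) (F : I -> R -> R[i]) :
  (forall i, inL1 (F i)) -> inL1 (fun x => \sum_(i <- s | P i) F i x).
Proof.
move=> mF; elim: s => [|i s IH].
  by under eq_fun do rewrite big_nil; exact: inL1_0.
case h: (P i); under eq_fun do rewrite big_cons h; last exact: IH.
exact: inL1D.
Qed.

Lemma inL1_tau a f : inL1 f -> inL1 (tau a f).
Proof.
by move=> [f1 f2]; split; [have := integrable_shift a f1|have := integrable_shift a f2].
Qed.

Lemma inL1_int_sqrt f : inL1 f ->
  leb.-integrable [set: R] (fun x => (`|Re (f x)| + `|Im (f x)|)%:E).
Proof.
by move=> [f1 f2]; under eq_fun do rewrite EFinD; apply: integrableD => //;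
  exact: integrable_norm.
Qed.

Lemma inL1_bnd f b (M : R) : inL1 f -> cmeasurable b ->
  (forall x, sqmod (b x) <= M ^+ 2) -> 0 <= M -> inL1 (fun x => b x * f x).
Proof.
move=> f1 mb bM M0.
have mf := inL1_meas f1.
have Reb x : `|Re (b x)| <= M.
  by rewrite -(ler_pXn2r (n:=2))// ?nnegrE// real_normK ?num_real// (le_trans (sqr_Re_le _)).
have Imb x : `|Im (b x)| <= M.
  by rewrite -(ler_pXn2r (n:=2))// ?nnegrE// real_normK ?num_real// (le_trans (sqr_Im_le _)).
apply: (@le_inL1 _ (fun x => M * (`|Re (f x)| + `|Im (f x)|))).
- exact: cmeasM.
- under eq_fun do rewrite EFinM.
  by apply: integrableZl => //; exact: inL1_int_sqrt.
- move=> x; rewrite ReM mulrDr (le_trans (ler_normB _ _))// !normrM.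
  by rewrite lerD// ler_wpM2r.
- move=> x; rewrite ImM mulrDr addrC (le_trans (ler_normD _ _))// !normrM.
  by rewrite lerD// ler_wpM2r.
Qed.

Lemma cintegralD f g : inL1 f -> inL1 g ->
  cintegral (fun x => f x + g x) = cintegral f + cintegral g.
Proof.
move=> [f1 f2] [g1 g2]; apply: complexP; rewrite /cintegral /=.
  by under eq_Rintegral do rewrite ReD; rewrite RintegralD.
by under eq_Rintegral do rewrite ImD; rewrite RintegralD.
Qed.

Lemma cintegralZ c f : inL1 f -> cintegral (fun x => c * f x) = c * cintegral f.
Proof.
move=> [f1 f2].
have Z (k : R) (u : R -> R) : leb.-integrable setT (EFin \o u) ->
    leb.-integrable setT (EFin \o (fun x => k * u x)).
  by move=> ui; have H := integrableZl measurableT k ui; exact: H.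
apply: complexP; rewrite ?ReM ?ImM /cintegral /=.
  under eq_Rintegral do rewrite ReM.
  by rewrite RintegralB// ?RintegralZl//; exact: Z.
under eq_Rintegral do rewrite ImM.
by rewrite RintegralD// ?RintegralZl//; exact: Z.
Qed.

Lemma cintegral_conj f : inL1 f ->
  cintegral (fun x => Num.conj (f x)) = Num.conj (cintegral f).
Proof.
move=> [f1 f2]; apply: complexP; rewrite ?Re_conj ?Im_conj /cintegral /=.
  by under eq_Rintegral do rewrite Re_conj.
under eq_Rintegral do rewrite Im_conj -mulN1r.
by rewrite RintegralZl// mulN1r.
Qed.

Lemma cintegral0 : cintegral (fun=> 0 : R[i]) = 0.
Proof.
by apply: complexP; rewrite /cintegral /= /Rintegral integral0.
Qed.

Lemma cintegral_sum (I : Type) (s : seq I) (P : pred I) (F : I -> R -> R[i]) :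
  (forall i, inL1 (F i)) ->
  cintegral (fun x => \sum_(i <- s | P i) F i x) = \sum_(i <- s | P i) cintegral (F i).
Proof.
move=> mF; elim: s => [|i s IH].
  by under eq_fun do rewrite big_nil; rewrite big_nil cintegral0.
rewrite big_cons; case h: (P i); under eq_fun do rewrite big_cons h; last exact: IH.
by rewrite cintegralD// ?IH//; exact: inL1_sum.
Qed.

Lemma cintegral_tau a f : inL1 f -> cintegral (tau a f) = cintegral f.
Proof.
move=> [f1 f2]; apply: complexP; rewrite /cintegral /= /Rintegral; congr fine.
  exact: (integral_shift a f1).
exact: (integral_shift a f2).
Qed.

End L1L2.

(** * Square-integrable functions *)

Section L2.
Context {R : realType}.
Implicit Types (f g b : R -> R[i]) (z c : R[i]).

(** A real number, convenient for algebra; it is 0 when the integral is infinite, so its identities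
    are stated under [inL2]. *)
Definition nrm2 f : R := fine (L2normsq f).

Lemma L2normsq_ge0 f : (0 <= L2normsq f)%E.
Proof. by apply: integral_ge0 => x _; rewrite lee_fin sqmod_ge0. Qed.

Lemma inL2_meas f : inL2 f -> cmeasurable f. Proof. by case. Qed.

Lemma L2normsqE f : inL2 f -> L2normsq f = (nrm2 f)%:E.
Proof.
by move=> [_ h]; rewrite /nrm2 fineK// ge0_fin_numE// L2normsq_ge0.
Qed.

Lemma nrm2_ge0 f : 0 <= nrm2 f.
Proof. by apply: fine_ge0; exact: L2normsq_ge0. Qed.

Lemma le_L2normsq f g : cmeasurable f -> cmeasurable g ->
  (forall x, sqmod (f x) <= sqmod (g x)) -> (L2normsq f <= L2normsq g)%E.
Proof.
move=> mf mg fg; apply: ge0_le_integral => //.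
- by move=> x _; rewrite lee_fin sqmod_ge0.
- exact: measurable_esqmod.
- exact: measurable_esqmod.
- by move=> x _; rewrite lee_fin.
Qed.

Lemma eq_L2normsq_ae f g : cmeasurable f -> cmeasurable g ->
  {ae leb, forall x, f x = g x} -> L2normsq f = L2normsq g.
Proof.
move=> mf mg fg; apply: ge0_ae_eq_integral => //.
- exact: measurable_esqmod.
- exact: measurable_esqmod.
- by move=> x _; rewrite lee_fin sqmod_ge0.
- by move=> x _; rewrite lee_fin sqmod_ge0.
- by apply: aeS fg => x -> _.
Qed.

Lemma L2normsqZ c f : cmeasurable f ->
  L2normsq (fun x => c * f x) = ((sqmod c)%:E * L2normsq f)%E.
Proof.
move=> mf; rewrite /L2normsq -ge0_integralZl_EFin ?sqmod_ge0//.
- by apply: eq_integral => x _; rewrite sqmodM EFinM.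
- by move=> x _; rewrite lee_fin sqmod_ge0.
- exact: measurable_esqmod.
Qed.

Lemma L2normsqD_young (t : R) f g : 0 < t -> cmeasurable f -> cmeasurable g ->
  (L2normsq (fun x => f x + g x)%R <=
   (1 + t)%:E * L2normsq f + (1 + t^-1)%:E * L2normsq g)%E.
Proof.
move=> t0 mf mg.
have p1 : 0 <= 1 + t by rewrite addr_ge0// ltW.
have p2 : 0 <= 1 + t^-1 by rewrite addr_ge0// invr_ge0 ltW.
rewrite /L2normsq -!ge0_integralZl_EFin//;
  try exact: measurable_esqmod; try by move=> x _; rewrite lee_fin sqmod_ge0.
rewrite -ge0_integralD//; first last.
- by apply: measurable_funeM; exact: measurable_esqmod.
- by move=> x _; rewrite mule_ge0 ?lee_fin ?sqmod_ge0.
- by apply: measurable_funeM; exact: measurable_esqmod.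
- by move=> x _; rewrite mule_ge0 ?lee_fin ?sqmod_ge0.
apply: ge0_le_integral => //.
- by move=> x _; rewrite lee_fin sqmod_ge0.
- by apply: measurable_esqmod; exact: cmeasD.
- by apply: emeasurable_funD; apply: measurable_funeM; exact: measurable_esqmod.
- by move=> x _; rewrite -!EFinM -EFinD lee_fin sqmod_young.
Qed.

Lemma L2normsqD_le f g : cmeasurable f -> cmeasurable g ->
  (L2normsq (fun x => f x + g x)%R <= 2%:E * L2normsq f + 2%:E * L2normsq g)%E.
Proof.
by move=> mf mg; have := L2normsqD_young ltr01 mf mg; rewrite invr1.
Qed.

Lemma L2normsqBC f g :
  L2normsq (fun x => f x - g x) = L2normsq (fun x => g x - f x).
Proof. by rewrite /L2normsq; under eq_integral do rewrite sqmodBC. Qed.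

Lemma L2normsq0 : L2normsq (fun _ => 0 : R[i]) = 0%E.
Proof. by rewrite /L2normsq; under eq_integral do rewrite sqmod0; rewrite integral0. Qed.

Lemma L2normsq_eq0 f : cmeasurable f -> L2normsq f = 0%E ->
  {ae leb, forall x, f x = 0}.
Proof.
move=> mf f0.
have := @ae_eq_integral_abs _ _ R leb setT measurableT (fun x => (sqmod (f x))%:E).
case => [|h _]; first exact: measurable_esqmod.
have /h : (\int[leb]_x `|(sqmod (f x))%:E| = 0)%E.
  rewrite -[RHS]f0; apply: eq_integral => x _.
  by rewrite gee0_abs// lee_fin sqmod_ge0.
by apply: aeS => x /(_ Logic.I) [] /sqmod_eq0.
Qed.

Lemma inL2_le f g (M : R) : cmeasurable f -> inL2 g -> 0 <= M ->
  (forall x, sqmod (f x) <= M * sqmod (g x)) -> inL2 f.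
Proof.
move=> mf [mg g2] M0 fg; split => //.
have -> : L2normsq f = L2normsq (fun x => f x) by [].
apply: (@le_lt_trans _ _ (L2normsq (fun x => (Num.sqrt M)%:C * g x))).
  apply: le_L2normsq => //; first by apply: cmeasM => //; exact: cmeas_cst.
  by move=> x; rewrite sqmodM sqmodR sqr_sqrtr.
by rewrite L2normsqZ// lte_mul_pinfty// ?lee_fin ?sqmod_ge0.
Qed.

Lemma inL2D f g : inL2 f -> inL2 g -> inL2 (fun x => f x + g x).
Proof.
move=> [mf f2] [mg g2]; split; first exact: cmeasD.
rewrite (le_lt_trans (L2normsqD_le mf mg))// lte_add_pinfty//;
  by rewrite lte_mul_pinfty// lee_fin.
Qed.

Lemma inL2Z c f : inL2 f -> inL2 (fun x => c * f x).
Proof.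
move=> [mf f2]; split; first by apply: cmeasM => //; exact: cmeas_cst.
by rewrite L2normsqZ// lte_mul_pinfty// lee_fin sqmod_ge0.
Qed.

Lemma inL2N f : inL2 f -> inL2 (fun x => - f x).
Proof. by move=> /(inL2Z (-1)); under eq_fun do rewrite mulN1r. Qed.

Lemma inL2B f g : inL2 f -> inL2 g -> inL2 (fun x => f x - g x).
Proof. by move=> f1 g1; apply: inL2D => //; exact: inL2N. Qed.

Lemma inL2_0 : inL2 (fun=> 0 : R[i]).
Proof. by split; [exact: cmeas_cst|rewrite L2normsq0 ltry]. Qed.

Lemma inL2_sum (I : Type) (s : seq I) (P : pred I) (F : I -> R -> R[i]) :
  (forall i, inL2 (F i)) -> inL2 (fun x => \sum_(i <- s | P i) F i x).
Proof.
move=> mF; elim: s => [|i s IH].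
  by under eq_fun do rewrite big_nil; exact: inL2_0.
case h: (P i); under eq_fun do rewrite big_cons h; last exact: IH.
exact: inL2D.
Qed.

Lemma inL2_conj f : inL2 f -> inL2 (fun x => Num.conj (f x)).
Proof.
move=> f2; apply: (@inL2_le _ f 1) => //; first by apply: cmeas_conj; case: f2.
by move=> x; rewrite sqmod_conj mul1r.
Qed.

Lemma inL2_bnd b f (M : R) : cmeasurable b -> (forall x, sqmod (b x) <= M) ->
  inL2 f -> inL2 (fun x => b x * f x).
Proof.
move=> mb bM f2; apply: (@inL2_le _ f M) => //.
- by apply: cmeasM => //; case: f2.
- by apply: (le_trans _ (bM 0)); exact: sqmod_ge0.
- by move=> x; rewrite sqmodM ler_wpM2r ?sqmod_ge0.
Qed.

Lemma inL2_ae f g : cmeasurable f -> {ae leb, forall x, f x = g x} ->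
  inL2 g -> inL2 f.
Proof.
by move=> mf fg [mg g2]; split => //; rewrite (eq_L2normsq_ae mf mg fg).
Qed.

Lemma L2normsq_tau a f : cmeasurable f -> L2normsq (tau a f) = L2normsq f.
Proof.
move=> mf.
apply: (@ge0_integral_shift _ a (fun x => (sqmod (f x))%:E)).
  exact: measurable_esqmod.
by move=> x; rewrite lee_fin sqmod_ge0.
Qed.

Lemma inL2_tau a f : inL2 f -> inL2 (tau a f).
Proof.
by move=> [mf f2]; split; [exact: cmeas_tau|rewrite L2normsq_tau].
Qed.

Lemma inL2_integrable f : inL2 f ->
  leb.-integrable [set: R] (fun x => (sqmod (f x))%:E).
Proof.
move=> [mf f2]; apply/integrableP; split; first exact: measurable_esqmod.
apply: le_lt_trans f2; rewrite le_eqVlt; apply/orP; left; apply/eqP.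
by apply: eq_integral => x _; rewrite gee0_abs// lee_fin sqmod_ge0.
Qed.

Lemma inL2M f g : inL2 f -> inL2 g -> inL1 (fun x => f x * g x).
Proof.
move=> f2 g2.
apply: (@le_inL1 _ _ (fun x => sqmod (f x) + sqmod (g x))).
- by apply: cmeasM; [case: f2|case: g2].
- under eq_fun do rewrite EFinD.
  by apply: integrableD => //; exact: inL2_integrable.
- by move=> x; exact: normRe_mul.
- by move=> x; exact: normIm_mul.
Qed.

Lemma inL2MJ f g : inL2 f -> inL2 g -> inL1 (fun x => f x * Num.conj (g x)).
Proof. by move=> f2 g2; apply: inL2M => //; exact: inL2_conj. Qed.

Lemma innerDl f f' g : inL2 f -> inL2 f' -> inL2 g ->
  inner (fun x => f x + f' x) g = inner f g + inner f' g.
Proof.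
move=> f2 f2' g2; rewrite /inner -cintegralD; try exact: inL2MJ.
by congr cintegral; apply/funext => x; rewrite mulrDl.
Qed.

Lemma innerZl c f g : inL2 f -> inL2 g ->
  inner (fun x => c * f x) g = c * inner f g.
Proof.
move=> f2 g2; rewrite /inner -cintegralZ; try exact: inL2MJ.
by congr cintegral; apply/funext => x; rewrite mulrA.
Qed.

Lemma innerC f g : inL2 f -> inL2 g -> inner g f = Num.conj (inner f g).
Proof.
move=> f2 g2; rewrite /inner -cintegral_conj; try exact: inL2MJ.
congr cintegral; apply/funext => x.
by rewrite rmorphM /= conjCK mulrC.
Qed.

Lemma innerDr f g g' : inL2 f -> inL2 g -> inL2 g' ->
  inner f (fun x => g x + g' x) = inner f g + inner f g'.
Proof.
move=> f2 g2 g2'; rewrite [LHS](@innerC _ f)//; last exact: inL2D.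
by rewrite innerDl// rmorphD/= -!innerC.
Qed.

Lemma innerZr c f g : inL2 f -> inL2 g ->
  inner f (fun x => c * g x) = Num.conj c * inner f g.
Proof.
move=> f2 g2; rewrite [LHS](@innerC _ f)//; last exact: inL2Z.
by rewrite innerZl// rmorphM/= -!innerC.
Qed.

Lemma innerNl f g : inL2 f -> inL2 g -> inner (fun x => - f x) g = - inner f g.
Proof.
move=> f2 g2; rewrite -mulN1r -innerZl//.
by congr inner; apply/funext => x; rewrite mulN1r.
Qed.

Lemma inner_suml (I : Type) (s : seq I) (P : pred I) (F : I -> R -> R[i]) g :
  (forall i, inL2 (F i)) -> inL2 g ->
  inner (fun x => \sum_(i <- s | P i) F i x) g = \sum_(i <- s | P i) inner (F i) g.
Proof.
move=> F2 g2; rewrite /inner -cintegral_sum => [|i]; last exact: inL2MJ.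
by congr cintegral; apply/funext => x; rewrite mulr_suml.
Qed.

Lemma inner_nrm2 f : inL2 f -> inner f f = (nrm2 f)%:C.
Proof.
move=> f2; rewrite /inner; under eq_fun do rewrite mul_conj.
by apply: complexP => //=; rewrite /Rintegral integral0.
Qed.

Lemma nrm2D f g : inL2 f -> inL2 g ->
  nrm2 (fun x => f x + g x) = nrm2 f + nrm2 g + 2 * Re (inner f g).
Proof.
move=> f2 g2; apply: complexI; rewrite -inner_nrm2; last exact: inL2D.
rewrite innerDl ?innerDr//; try exact: inL2D.
rewrite !inner_nrm2// (innerC f2 g2).
case: (inner f g) => a b; rewrite conjE.
by apply: complexP; rewrite !(ReD, ImD) /=; ring.
Qed.

Lemma nrm2Z c f : inL2 f -> nrm2 (fun x => c * f x) = sqmod c * nrm2 f.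
Proof.
by move=> f2; rewrite {1}/nrm2 L2normsqZ ?(L2normsqE f2)//; case: f2.
Qed.

Lemma nrm2N f : inL2 f -> nrm2 (fun x => - f x) = nrm2 f.
Proof.
by move=> f2; rewrite /nrm2 /L2normsq; under eq_integral do rewrite sqmodN.
Qed.

Lemma nrm2B f g : inL2 f -> inL2 g ->
  nrm2 (fun x => f x - g x) = nrm2 f + nrm2 g - 2 * Re (inner f g).
Proof.
move=> f2 g2; have gN := inL2N g2; rewrite nrm2D// nrm2N//.
rewrite (innerC gN f2) innerNl// Re_conj ReN (innerC f2 g2) Re_conj.
by rewrite mulrN.
Qed.

Lemma nrm2_le_young (t : R) f g : 0 < t -> inL2 f -> inL2 g ->
  nrm2 (fun x => f x + g x) <= (1 + t) * nrm2 f + (1 + t^-1) * nrm2 g.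
Proof.
move=> t0 f2 g2; have fg := inL2D f2 g2.
have := L2normsqD_young t0 (inL2_meas f2) (inL2_meas g2).
by rewrite (L2normsqE f2) (L2normsqE g2) (L2normsqE fg) -!EFinM -EFinD lee_fin.
Qed.

Lemma nrm2D_le f g : inL2 f -> inL2 g ->
  nrm2 (fun x => f x + g x) <= 2 * nrm2 f + 2 * nrm2 g.
Proof. by move=> f2 g2; have := nrm2_le_young ltr01 f2 g2; rewrite invr1. Qed.

Lemma nrm2_eq0 f : inL2 f -> nrm2 f = 0 -> {ae leb, forall x, f x = 0}.
Proof.
by move=> f2 f0; apply: L2normsq_eq0; [case: f2|rewrite L2normsqE// f0].
Qed.

End L2.

(** * Density of trigonometric polynomials *)

Section Trig.
Context {R : realType}.

Definition expi (t : R) : R[i] := cos t +i* sin t.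

Lemma expi0 : expi 0 = 1.
Proof. by rewrite /expi cos0 sin0. Qed.
Lemma expiD s t : expi (s + t) = expi s * expi t.
Proof. by apply: complexP; rewrite ?ReM ?ImM /= ?cosD ?sinD; ring. Qed.
Lemma expiN t : expi (- t) = Num.conj (expi t).
Proof. by rewrite /expi conjE cosN sinN. Qed.
Lemma sqmod_expi t : sqmod (expi t) = 1.
Proof. by rewrite /sqmod /= cos2Dsin2. Qed.
Lemma expi_kernel t : cos t -i* sin t = expi (- t).
Proof. by rewrite /expi cosN sinN. Qed.
Lemma expi_2pi_nat (n : nat) : expi (n%:R * (2 * pi)) = 1.
Proof.
elim: n => [|n IH]; first by rewrite mul0r expi0.
rewrite -natr1 mulrDl mul1r expiD IH mul1r.
by rewrite /expi mulr_natl cos2pi sin2pi.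
Qed.
Lemma expi_2pi (n : int) : expi (n%:~R * (2 * pi)) = 1.
Proof.
case: n => n; first exact: expi_2pi_nat.
by rewrite NegzE mulrNz mulNr expiN expi_2pi_nat conjC1.
Qed.
Lemma cmeas_expi (f : R -> R) : measurable_fun [set: R] f ->
  cmeasurable (fun x => expi (f x)).
Proof.
move=> mf; split; rewrite /expi /=; apply: (measurableT_comp _ mf).
  by apply: continuous_measurable_fun; exact: continuous_cos.
by apply: continuous_measurable_fun; exact: continuous_sin.
Qed.
Lemma cmeas_expi_lin (c : R) : cmeasurable (fun x => expi (c * x)).
Proof. by apply: cmeas_expi; exact: mulrl_measurable. Qed.

(** A list of pairs coefficient-frequency in which frequencies may repeat, so that sums are
    concatenations and products are lists of all pairs. *)
Definition trigsum (a : R) (s : seq (R[i] * int)) (x : R) : R[i] :=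
  \sum_(p <- s) p.1 * expi (p.2%:~R * (a * x)).

Definition trigpoly (a : R) (q : R -> R) : Prop :=
  exists s, forall x, trigsum a s x = (q x)%:C.

Lemma cmeas_trigsum a s : cmeasurable (trigsum a s).
Proof.
apply: cmeas_sum => p; apply: cmeasM; first exact: cmeas_cst.
by under eq_fun do rewrite mulrA; exact: cmeas_expi_lin.
Qed.

Lemma trigpoly_cst a c : trigpoly a (fun=> c).
Proof.
by exists [:: (c%:C, 0)] => x; rewrite /trigsum big_seq1 mulr0z mul0r expi0 mulr1.
Qed.

Lemma trigpolyD a p q : trigpoly a p -> trigpoly a q ->
  trigpoly a (fun x => p x + q x).
Proof.
move=> [s hs] [t ht]; exists (s ++ t) => x.
have -> : (p x + q x)%:C = (p x)%:C + (q x)%:C by rewrite rmorphD.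
by rewrite -hs -ht /trigsum big_cat.
Qed.

Lemma trigpolyM a p q : trigpoly a p -> trigpoly a q ->
  trigpoly a (fun x => p x * q x).
Proof.
move=> [s hs] [t ht]; exists [seq (u.1 * v.1, u.2 + v.2) | u <- s, v <- t] => x.
have -> : (p x * q x)%:C = (p x)%:C * (q x)%:C by rewrite rmorphM.
rewrite -hs -ht /trigsum big_allpairs_dep /= mulr_suml.
apply: eq_bigr => u _; rewrite mulr_sumr; apply: eq_bigr => v _.
by rewrite rmorphD mulrDl expiD /=; ring.
Qed.

Lemma trigpolyX a p n : trigpoly a p -> trigpoly a (fun x => p x ^+ n).
Proof.
move=> hp; elim: n => [|n IH].
  by under eq_fun do rewrite expr0; exact: trigpoly_cst.
by under eq_fun do rewrite exprS; exact: trigpolyM.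
Qed.

Lemma trigpoly_onem a p : trigpoly a p -> trigpoly a (fun x => 1 - p x).
Proof.
move=> hp; have := trigpolyD (trigpoly_cst a 1) (trigpolyM (trigpoly_cst a (-1)) hp).
by congr trigpoly; apply/funext => x; rewrite mulN1r.
Qed.

Lemma trigpoly_sin a c : trigpoly a (fun x => sin (a * x - c)).
Proof.
exists [:: ((0 -i* 2^-1) * expi (- c), 1); ((0 +i* 2^-1) * expi c, -1)] => x.
rewrite /trigsum big_cons big_seq1 /=.
have e1 : (1 : int)%:~R * (a * x) = a * x by rewrite mul1r.
have e2 : (-1 : int)%:~R * (a * x) = - (a * x) by rewrite mulrN1z mulN1r.
rewrite e1 e2 !expiN sinB; move: (a * x) => y.
by apply: complexP; rewrite !(ReD, ImD, ReM, ImM, Re_conj, Im_conj) /=; field.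
Qed.

Lemma measurable_trigpoly a p : trigpoly a p -> measurable_fun [set: R] p.
Proof.
move=> [s hs]; have [h _] := cmeas_trigsum a s.
by move: h; congr measurable_fun; apply/funext => x; rewrite hs.
Qed.

Lemma bernoulli_ineq (s : R) k : 0 <= s -> 1 + k%:R * s <= (1 + s) ^+ k.
Proof.
move=> s0; elim: k => [|k IH]; first by rewrite mul0r addr0 expr0.
rewrite exprS; apply: le_trans (ler_wpM2l _ IH); last by rewrite addr_ge0.
rewrite -natr1; have := sqr_ge0 s; have := ler0n R k; nra.
Qed.

Lemma bernoulli_ineqN (s : R) k : 0 <= s <= 1 -> 1 - k%:R * s <= (1 - s) ^+ k.
Proof.
move=> /andP[s0 s1]; elim: k => [|k IH]; first by rewrite mul0r subr0 expr0.
rewrite exprS; apply: le_trans (ler_wpM2l _ IH); last by rewrite subr_ge0.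
rewrite -natr1; have := sqr_ge0 s; have := ler0n R k; nra.
Qed.

(* By Bernoulli's inequality it tends to 1 for [t < 1/2] and to 0 for
   [t > 1/2] (Brosowski and Deutsch); trigonometric polynomials thus approximate
   the indicator of a set on which a sine is positive. *)
Definition stepfun (n : nat) (t : R) : R := (1 - t ^+ n) ^+ (n * 2 ^ n).

Lemma stepfun01 n t : 0 <= t <= 1 -> 0 <= stepfun n t <= 1.
Proof.
move=> /andP[t0 t1]; have h0 : 0 <= t ^+ n by rewrite exprn_ge0.
have h1 : t ^+ n <= 1 by rewrite exprn_ile1.
by rewrite /stepfun exprn_ge0 ?exprn_ile1 ?subr_ge0// lerBlDr lerDl.
Qed.

(** Bernoulli's inequality bounds the function below by [1 - n (2t)^n], and [n r^n] tends to 0 for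
    [r = 2t < 1]. *)
Lemma stepfun_lo (t : R) : 0 <= t -> t < 1/2 ->
  stepfun n t @[n --> \oo] --> (1 : R).
Proof.
move=> t0 t1.
set r := 2 * t; have r0 : 0 <= r by rewrite /r; lra.
have r1 : r < 1 by rewrite /r; lra.
have nr : n%:R * r ^+ n @[n --> \oo] --> (0 : R).
  have [->|rn0] := eqVneq r 0.
    rewrite -(cvg_shiftS _); apply: cvg_near_cst.
    by apply: nearW => n; rewrite /= expr0n/= mulr0.
  have rp : 0 < r by rewrite lt_neqAle eq_sym rn0.
  (* Bernoulli's inequality for [(1/rho)^n = (1 + d)^n] gives [n rho^n <= 1/d]; as [r = rho^2], one
     factor [rho^n] is left over to tend to 0. *)
  pose rho := Num.sqrt r.
  have rho0 : 0 < rho by rewrite sqrtr_gt0.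
  have rho1 : rho < 1 by rewrite -[ltRHS]sqrtr1 ltr_sqrt.
  have rhoE : rho ^+ 2 = r by rewrite sqr_sqrtr.
  pose d := rho^-1 - 1.
  have d0 : 0 < d by rewrite /d subr_gt0 invf_gt1.
  apply: (@squeeze_cvgr _ _ _ _ (fun=> 0) (fun n => d^-1 * rho ^+ n)).
  - apply: nearW => n; rewrite mulr_ge0 ?exprn_ge0//=.
    rewrite -rhoE -exprM mulnC exprM expr2 mulrA ler_wpM2r ?exprn_ge0 ?(ltW rho0)//.
    rewrite -ler_pdivlMr ?exprn_gt0// -exprVn -[rho^-1](subrKC 1) -/d.
    apply: le_trans (ler_wpM2l _ (bernoulli_ineq n (ltW d0))).
      have -> : d^-1 * (1 + n%:R * d) = d^-1 + n%:R by field; rewrite gt_eqF.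
      by rewrite lerDr invr_ge0 ltW.
    by rewrite invr_ge0 ltW.
  - exact: cvg_cst.
  - rewrite -(mulr0 d^-1); apply: cvgMr => //.
    by apply: cvg_expr; rewrite ger0_norm ?ltW.
apply: (@squeeze_cvgr _ _ _ _ (fun n => 1 - n%:R * r ^+ n) (fun=> 1)).
- apply: nearW => n.
  have t01 : 0 <= t <= 1 by apply/andP; split; lra.
  have /andP[_ ->] := stepfun01 n t01; rewrite andbT.
  have tn : 0 <= t ^+ n <= 1 by rewrite exprn_ge0// exprn_ile1//; lra.
  have := @bernoulli_ineqN (t ^+ n) (n * 2 ^ n) tn.
  by rewrite /r exprMn natrM natrX mulrA.
- by rewrite -[X in _ --> X]subr0; apply: cvgB => //; exact: cvg_cst.
- exact: cvg_cst.
Qed.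

(** With [s = t^n] and [k = n 2^n], the product [(1 - s)^k (1 + k s)] is at most [(1 - s^2)^k <= 1],
    and [k s = n (2t)^n >= n]. *)
Lemma stepfun_hi (t : R) : 1/2 <= t <= 1 ->
  stepfun n t @[n --> \oo] --> (0 : R).
Proof.
move=> /andP[t0 t1].
apply: (@squeeze_cvgr _ _ _ _ (fun=> 0) (fun n => n.+1%:R^-1)).
- apply: nearW => n.
  have t01 : 0 <= t <= 1 by apply/andP; split; lra.
  have /andP[-> _] /= := stepfun01 n t01.
  set s := t ^+ n; set k := (n * 2 ^ n)%N.
  have s0 : 0 <= s by rewrite exprn_ge0//; lra.
  have s1 : s <= 1 by rewrite exprn_ile1//; lra.
  have ks : n%:R <= k%:R * s.
    rewrite /k /s natrM natrX -mulrA -exprMn ler_peMr// exprn_ege1//; lra.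
  have h : (1 - s) ^+ k * (1 + k%:R * s) <= 1.
    apply: (@le_trans _ _ ((1 - s) ^+ k * (1 + s) ^+ k)).
      by rewrite ler_wpM2l ?exprn_ge0 ?subr_ge0// bernoulli_ineq.
    rewrite -exprMn exprn_ile1//; last by nra.
    by apply: mulr_ge0; lra.
  rewrite -[leRHS]mul1r ler_pdivlMr// (le_trans _ h)// ler_wpM2l ?exprn_ge0 ?subr_ge0//.
  by rewrite -natr1 addrC lerD2l.
- exact: cvg_cst.
- exact: cvg_harmonic.
Qed.

End Trig.

(** * Approximation of indicators by trigonometric polynomials *)

Section TrigDensity.
Context {R : realType} (T : R) (T_gt0 : 0 < T).
Let a : R := 2 * pi / T.
Local Notation D := (`[0, T[%classic : set R).

Lemma integrable_cst_period (c : R) : leb.-integrable D (EFin \o cst c).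
Proof.
apply: measurable_bounded_integrable => //.
- have h := @lebesgue_measure_itv R `[0, T[.
  by rewrite [X in (X < _)%E]h /= lte_fin T_gt0 -EFinD ltry.
- by exists `|c|; split; [exact: num_real|move=> M /ltW cM x _ /=].
Qed.

Lemma dominated_dist_small (f : R -> R) (f_ : nat -> R -> R) :
  measurable_fun [set: R] f -> (forall n, measurable_fun [set: R] (f_ n)) ->
  (forall n x, D x -> `|f x - f_ n x| <= 1) ->
  (forall x, D x -> f_ n x @[n --> \oo] --> f x) ->
  forall e, 0 < e -> exists n, (\int[leb]_(x in D) `|f x - f_ n x|%:E <= e%:E)%E.
Proof.
move=> mf mf_ fb fc e e0.
have h := @dominated_cvg _ _ R leb D (measurable_itv _)
   (fun n x => `|f x - f_ n x|%:E) (fun=> 0%E) (EFin \o cst 1).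
have : (\int[leb]_(x in D) `|f x - f_ n x|%:E @[n --> \oo] -->
   \int[leb]_(x in D) (cst 0 x))%E.
  apply: h => //.
  - move=> n; apply/measurable_EFinP/measurableT_comp => //.
    by apply: measurable_funTS; apply: measurable_funB => //; exact: mf_.
  - move=> x Dx; apply: cvg_EFin; first exact: nearW.
    rewrite -(normr0 R) -(subrr (f x)); apply: cvg_norm.
    by apply: cvgB; [exact: cvg_cst|exact: fc].
  - exact: integrable_cst_period.
  - by move=> n x Dx; rewrite abse_EFin normr_id lee_fin; exact: fb.
rewrite integral0 => /fine_cvgP [_].
move=> /cvgrPdist_le /(_ e e0) [N _ /(_ N (leqnn N)) /=].
rewrite sub0r normrN => hN; exists N.
have i0 : (0 <= \int[leb]_(x in D) `|f x - f_ N x|%:E)%E.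
  by apply: integral_ge0 => x _; rewrite lee_fin.
have : (\int[leb]_(x in D) `|f x - f_ N x|%:E)%E \is a fin_num.
  rewrite ge0_fin_numE//.
  apply: (@le_lt_trans _ _ (\int[leb]_(x in D) 1%:E)%E).
    apply: ge0_le_integral => //.
    - apply/measurable_EFinP/measurableT_comp => //.
      by apply: measurable_funTS; apply: measurable_funB => //; exact: mf_.
    - by move=> x Dx; rewrite lee_fin fb.
  have /integrableP[_] := integrable_cst_period 1.
  by under eq_integral do rewrite /= normr1.
move=> /fineK <-; rewrite lee_fin.
by rewrite (le_trans (ler_norm _)).
Qed.

(** The bounds 0 and 1 on [q] are what makes the class stable under products, hence intersections,
    and what later turns this approximation in mean into one in square mean. *)
Definition trig_approx (A : set R) : Prop := measurable A /\
  forall e, 0 < e -> exists q, [/\ trigpoly a q, forall x, 0 <= q x <= 1 &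
    (\int[leb]_(x in D) `|\1_A x - q x|%:E <= e%:E)%E].

Lemma trig_approx_eq A B : measurable B -> (forall x, D x -> A x <-> B x) ->
  trig_approx A -> trig_approx B.
Proof.
move=> mB AB [mA h]; split => // e /h[q [q1 q2 q3]]; exists q; split => //.
move: q3; congr (_ <= _)%E; apply: eq_integral => x /set_mem Dx.
suff -> : \1_A x = \1_B x :> R by [].
rewrite !indicE; congr ((_ : bool)%:R).
by apply/idP/idP => /set_mem h'; apply/mem_set/(AB x Dx).
Qed.

Lemma trig_approxC A : trig_approx A -> trig_approx (~` A).
Proof.
move=> [mA h]; split; first exact: measurableC.
move=> e /h[q [q1 q2 q3]]; exists (fun x => 1 - q x); split.
- exact: trigpoly_onem.
- by move=> x; have /andP[] := q2 x; rewrite subr_ge0 gerBl => -> ->.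
- move: q3; congr (_ <= _)%E; apply: eq_integral => x _.
  rewrite -normrN; congr (`|_|%:E); rewrite !indicE in_setC.
  by case: (x \in A) => /=; ring.
Qed.

Lemma measurable_dist (A : set R) (q : R -> R) : measurable A -> measurable_fun [set: R] q ->
  measurable_fun D (fun x => `|\1_A x - q x|%:E).
Proof.
move=> mA mq; apply/measurable_EFinP/measurableT_comp => //.
by apply: measurable_funTS; apply: measurable_funB.
Qed.

Lemma trig_approxI A B : trig_approx A -> trig_approx B -> trig_approx (A `&` B).
Proof.
move=> [mA hA] [mB hB]; split; first exact: measurableI.
move=> e e0; have e20 : 0 < e / 2 by rewrite divr_gt0.
have [q [q1 q2 q3]] := hA _ e20; have [r [r1 r2 r3]] := hB _ e20.
have mq := measurable_trigpoly q1; have mr := measurable_trigpoly r1.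
exists (fun x => q x * r x); split.
- exact: trigpolyM.
- move=> x; have /andP[h1 h2] := q2 x; have /andP[h3 h4] := r2 x.
  by rewrite mulr_ge0//= mulr_ile1.
- have -> : e = e / 2 + e / 2 by field.
  rewrite EFinD; apply: le_trans (leeD q3 r3).
  rewrite -ge0_integralD//; try exact: measurable_dist.
  apply: ge0_le_integral => //.
  + apply: measurable_dist; first exact: measurableI.
    exact: measurable_funM.
  + by apply: emeasurable_funD; exact: measurable_dist.
  move=> x _; rewrite -EFinD lee_fin indicI /=.
  have -> : \1_A x * \1_B x - q x * r x =
    (\1_A x - q x) * \1_B x + q x * (\1_B x - r x) by ring.
  have /andP[h1 h2] := q2 x.
  rewrite (le_trans (ler_normD _ _))// !normrM lerD//.
    by rewrite ler_piMr// indicE; case: (x \in B); rewrite ?normr1 ?normr0.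
  by rewrite ler_piMl// ger0_norm.
Qed.

Lemma trig_approxU A B : trig_approx A -> trig_approx B -> trig_approx (A `|` B).
Proof.
move=> hA hB; rewrite -[A `|` B]setCK setCU; apply: trig_approxC.
by apply: trig_approxI; exact: trig_approxC.
Qed.

Lemma trig_approx0 : trig_approx set0.
Proof.
split=> // e e0; exists (fun=> 0); split.
- exact: trigpoly_cst.
- by move=> _; rewrite lexx ler01.
- under eq_integral do rewrite indic0 subrr normr0.
  by rewrite integral0 lee_fin ltW.
Qed.

(** The indicators of the finite unions converge pointwise and stay within 1 of their limit, so
    dominated convergence on the bounded period applies. *)
Lemma trig_approx_bigcup (F : (set R)^nat) : (forall n, trig_approx (F n)) ->
  trig_approx (\bigcup_n F n).
Proof.
move=> hF; have mF n : measurable (F n) by case: (hF n).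
have mU : measurable (\bigcup_n F n) by exact: bigcup_measurable.
split => // e e0.
pose B n := \big[setU/set0]_(i < n) F i.
have hB n : trig_approx (B n).
  rewrite /B; elim: n => [|n IH]; first by rewrite big_ord0; exact: trig_approx0.
  by rewrite big_ord_recr /=; exact: trig_approxU.
have mB n : measurable (B n) by case: (hB n).
have e20 : 0 < e / 2 by rewrite divr_gt0.
have [||||n hn] := @dominated_dist_small (\1_(\bigcup_n F n)) (fun n => \1_(B n)) _ _ _ _ (e / 2) e20.
- exact: measurable_indic.
- by move=> n; exact: measurable_indic.
- move=> n x _; rewrite !indicE.
  case: (x \in _); case: (x \in _);
    by rewrite ?subrr ?subr0 ?sub0r ?normrN ?normr1 ?normr0.
- move=> x _; apply: cvg_near_cst.
  have [/set_mem[N _ FNx]|nx] := boolP (x \in \bigcup_n F n).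
    exists N.+1 => // m /= Nm; rewrite !indicE (mem_set (_ : (\bigcup_n F n) x)); last by exists N.
    by rewrite mem_set// /B -bigcup_mkord; exists N.
  apply: nearW => m; rewrite !indicE (negbTE nx).
  rewrite memNset// /B -bigcup_mkord => -[i _ Fi].
  by move/negP: nx; apply; apply/mem_set; exists i.
have [q [q1 q2 q3]] := (hB n).2 _ e20.
have mq := measurable_trigpoly q1.
exists q; split => //.
have -> : e = e / 2 + e / 2 by field.
rewrite EFinD; apply: le_trans (leeD hn q3).
rewrite -ge0_integralD//; try exact: measurable_dist.
  apply: ge0_le_integral => //.
  + exact: measurable_dist.
  + apply: emeasurable_funD; last exact: measurable_dist.
    exact: measurable_dist.
  move=> x _; rewrite -EFinD lee_fin.
  by rewrite -[X in `|X|](subrKA (\1_(B n) x)) ler_normD.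
Qed.

Lemma trig_approx_sin c : trig_approx [set x | 0 < sin (a * x - c)].
Proof.
have ms : measurable_fun [set: R] (fun x => sin (a * x - c)).
  by apply: (@measurable_trigpoly _ a); exact: trigpoly_sin.
have mA : measurable [set x | 0 < sin (a * x - c)].
  have := @measurable_fun_ltr _ _ R setT (cst 0) _ (@measurable_cst _ _ _ _ _ _) ms.
  by move=> /(_ measurableT [set true] Logic.I); rewrite setTI.
split => // e e0.
(* An affine image of the sine in the unit interval, less than [1/2] exactly where the sine is
   positive. *)
pose t x : R := 2^-1 * (1 - sin (a * x - c)).
have t01 x : 0 <= t x <= 1.
  by have := sin_le1 (a * x - c); have := sin_geN1 (a * x - c); rewrite /t; lra.
have tp n : trigpoly a (fun x => stepfun n (t x)).
  apply: trigpolyX; apply: trigpoly_onem; apply: trigpolyX.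
  apply: trigpolyM; first exact: trigpoly_cst.
  by apply: trigpoly_onem; exact: trigpoly_sin.
have [||||n hn] := @dominated_dist_small
  (\1_[set x | 0 < sin (a * x - c)]) (fun n x => stepfun n (t x)) _ _ _ _ e e0.
- exact: measurable_indic.
- by move=> n; apply: (measurable_trigpoly (tp n)).
- move=> n x _; have /andP[h1 h2] := stepfun01 n (t01 x).
  rewrite indicE; case: (x \in _); rewrite ler_norml /=; apply/andP; split; lra.
- move=> x _; rewrite indicE; have [/set_mem /= h|nx] := boolP (x \in _).
    by apply: stepfun_lo; rewrite /t; have := sin_le1 (a * x - c); lra.
  apply: stepfun_hi; have := t01 x; have /negP := nx; rewrite in_setE /= => /negP.
  by rewrite -leNgt /t; lra.
by exists (fun x => stepfun n (t x)); split => // x; exact: stepfun01.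
Qed.

Lemma sin_le0_Npi (x : R) : - pi <= x <= 0 -> sin x <= 0.
Proof.
by move=> h; rewrite -oppr_ge0 -sinN; apply: sin_ge0_pi; lra.
Qed.

Lemma sin_shiftpi (x : R) : sin (x - pi) = - sin x.
Proof. by rewrite sinB cospi sinpi; ring. Qed.

Lemma sin_gt0_pi_lt (y : R) : - pi <= y -> y < 2 * pi -> 0 < sin y -> 0 < y < pi.
Proof.
have pi0 := @pi_gt0 R.
move=> h1 h2 h; rewrite !ltNge; apply/andP; split; apply/negP => h3.
  by have := sin_le0_Npi (x := y); rewrite h1 h3 => /(_ isT); lra.
have := @sin_ge0_pi _ (y - pi); rewrite sin_shiftpi.
have -> : 0 <= y - pi <= pi by lra.
by move=> /(_ isT); lra.
Qed.

(** In the angle [a z], the ray meets the period in the arc from [y = a x] to [2 pi], while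
    positivity of a shifted sine cuts out an open half circle. The arc is a union of two half
    circles if [0 < y < pi] and an intersection of two if [y >= pi]. For [y = 0] a third one is
    needed, since the upper and lower halves both miss the angle [pi]. *)
Lemma trig_approx_ray x : trig_approx `]x, +oo[.
Proof.
have pi0 := @pi_gt0 R; have a0 : 0 < a by rewrite divr_gt0 ?mulr_gt0.
have aT : a * T = 2 * pi by rewrite /a divfK// gt_eqF.
have [x0|x0] := ltP x 0.
  apply: (@trig_approx_eq (~` set0)) => //; last exact: trig_approxC trig_approx0.
  by move=> y /=; rewrite !in_itv/= andbT => /andP[y0 _]; split => // _; lra.
have [xT|xT] := leP T x.
  apply: (@trig_approx_eq set0) => //; last exact: trig_approx0.
  by move=> y /=; rewrite !in_itv/= andbT => /andP[_ yT]; split => // h; lra.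
have y0 : 0 <= a * x by rewrite mulr_ge0// ltW.
have y1 : a * x < 2 * pi by rewrite -aT ltr_pM2l.
have ltE z : (x < z) = (a * x < a * z) by rewrite ltr_pM2l.
have thE z : D z -> 0 <= a * z /\ a * z < 2 * pi.
  rewrite /= in_itv/= => /andP[z0 zT].
  by rewrite -aT ltr_pM2l// zT mulr_ge0// ltW.
have [x00|xn0] := eqVneq x 0.
  have ay : a * x = 0 by rewrite x00 mulr0.
  apply: (@trig_approx_eq ([set z | 0 < sin (a * z - 0)] `|`
      ([set z | 0 < sin (a * z - pi / 2)] `|` [set z | 0 < sin (a * z - pi)]))) => //; last first.
    by do 2 (apply: trig_approxU; first exact: trig_approx_sin); exact: trig_approx_sin.
  move=> z Dz /=; rewrite in_itv/= andbT ltE ay.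
  have [z0 z1] := thE _ Dz; split.
    by move=> [/sin_gt0_pi_lt|[/sin_gt0_pi_lt|/sin_gt0_pi_lt]] h; have := h; lra.
  move=> z2; have [zp|zp] := ltP (a * z) pi.
    by left; apply: sin_gt0_pi; lra.
  have [zp2|zp2] := ltP (a * z) (3 * pi / 2); right.
    by left; apply: sin_gt0_pi; lra.
  by right; apply: sin_gt0_pi; lra.
have yn0 : 0 < a * x by rewrite mulr_gt0// lt_neqAle eq_sym xn0.
have [yp|yp] := ltP (a * x) pi.
  apply: (@trig_approx_eq ([set z | 0 < sin (a * z - a * x)] `|`
      [set z | 0 < sin (a * z - pi)])) => //; last first.
    by apply: trig_approxU; exact: trig_approx_sin.
  move=> z Dz /=; rewrite in_itv/= andbT ltE.
  have [z0 z1] := thE _ Dz; split.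
    move=> [/sin_gt0_pi_lt|/sin_gt0_pi_lt] h; have := h; lra.
  move=> xz; have [zp|zp] := ltP (a * z - a * x) pi.
    by left; apply: sin_gt0_pi; lra.
  by right; apply: sin_gt0_pi; lra.
apply: (@trig_approx_eq ([set z | 0 < sin (a * z - a * x)] `&`
    [set z | 0 < sin (a * z - pi)])) => //; last first.
  by apply: trig_approxI; exact: trig_approx_sin.
move=> z Dz /=; rewrite in_itv/= andbT ltE.
have [z0 z1] := thE _ Dz; split.
  move=> [h1 /sin_gt0_pi_lt h2].
  have h3 : 0 < a * z - pi < pi by apply: h2; lra.
  have h4 : 0 < a * z - a * x < pi by apply: sin_gt0_pi_lt => //; lra.
  by lra.
by move=> xz; split; apply: sin_gt0_pi; lra.
Qed.

(** The approximable sets form a sigma-algebra, and the open rays generate the measurable sets. *)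
Lemma trig_approx_measurable (A : set R) : measurable A -> trig_approx A.
Proof.
have /seteqP[h _] := RGenOInfty.measurableE R.
move=> /(h A); apply: smallest_sub.
  split; first exact: trig_approx0.
  - by move=> B hB; rewrite setTD; exact: trig_approxC.
  - exact: trig_approx_bigcup.
by move=> _ [x ->]; exact: trig_approx_ray.
Qed.

End TrigDensity.

(** * Density of trigonometric polynomials in square mean on a period *)

Section TrigL2.
Context {R : realType} (T : R) (T_gt0 : 0 < T).
Let a : R := 2 * pi / T.
Local Notation D := (`[0, T[%classic : set R).

Definition period_ind (x : R) : R[i] := (\1_D x)%:C.
Local Notation ind := period_ind.

Lemma cmeas_period_ind : cmeasurable ind.
Proof. by apply: cmeas_indic; exact: measurable_itv. Qed.

Lemma period_ind_idem x : ind x * ind x = ind x.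
Proof.
by rewrite /ind indicE; case: (_ \in _); rewrite /= ?rmorph0 ?rmorph1 ?mul0r ?mulr1.
Qed.

Lemma sqmod_period_ind x : sqmod (ind x) <= 1.
Proof.
by rewrite /ind sqmodR indicE; case: (_ \in _); rewrite /= ?expr0n ?expr1n.
Qed.

Definition trig_dense (u : R -> R[i]) : Prop := cmeasurable u /\
  forall e, 0 < e -> exists s,
    (L2normsq (fun x => ind x * (u x - trigsum a s x))%R <= e%:E)%E.

Lemma cmeas_ind_sub u v : cmeasurable u -> cmeasurable v ->
  cmeasurable (fun x => ind x * (u x - v x)).
Proof.
by move=> mu mv; apply: cmeasM; [exact: cmeas_period_ind|exact: cmeasB].
Qed.

Lemma trig_dense_lim u : cmeasurable u ->
  (forall e, 0 < e -> exists2 v, trig_dense v &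
    (L2normsq (fun x => ind x * (u x - v x))%R <= e%:E)%E) -> trig_dense u.
Proof.
move=> mu h; split => // e e0.
have e40 : 0 < e / 4 by rewrite divr_gt0.
have [v [mv hv] uv] := h _ e40; have [s hs] := hv _ e40.
exists s.
have -> : (fun x => ind x * (u x - trigsum a s x)) =
   (fun x => ind x * (u x - v x) + ind x * (v x - trigsum a s x)).
  by apply/funext => x; ring.
apply: (le_trans (L2normsqD_le _ _)).
- exact: cmeas_ind_sub.
- by apply: cmeas_ind_sub => //; exact: cmeas_trigsum.
have -> : e%:E = (2%:E * (e / 4)%:E + 2%:E * (e / 4)%:E)%E.
  by rewrite -!EFinM -EFinD; congr (_%:E); field.
by rewrite leeD// lee_wpmul2l.
Qed.

Lemma trig_denseD u v : trig_dense u -> trig_dense v ->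
  trig_dense (fun x => u x + v x).
Proof.
move=> [mu hu] [mv hv]; split; first exact: cmeasD.
move=> e e0; have e40 : 0 < e / 4 by rewrite divr_gt0.
have [s hs] := hu _ e40; have [t ht] := hv _ e40.
exists (s ++ t).
have -> : (fun x => ind x * (u x + v x - trigsum a (s ++ t) x)) =
   (fun x => ind x * (u x - trigsum a s x) + ind x * (v x - trigsum a t x)).
  by apply/funext => x; rewrite /trigsum big_cat/=; ring.
apply: (le_trans (L2normsqD_le _ _)).
- by apply: cmeas_ind_sub => //; exact: cmeas_trigsum.
- by apply: cmeas_ind_sub => //; exact: cmeas_trigsum.
have -> : e%:E = (2%:E * (e / 4)%:E + 2%:E * (e / 4)%:E)%E.
  by rewrite -!EFinM -EFinD; congr (_%:E); field.
by rewrite leeD// lee_wpmul2l.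
Qed.

Lemma trig_denseZ c u : trig_dense u -> trig_dense (fun x => c * u x).
Proof.
move=> [mu hu]; split; first by apply: cmeasM => //; exact: cmeas_cst.
move=> e e0; have e40 : 0 < e / (1 + sqmod c).
  by rewrite divr_gt0// ltr_wpDr ?sqmod_ge0.
have [s hs] := hu _ e40; exists [seq (c * p.1, p.2) | p <- s].
have -> : (fun x => ind x * (c * u x - trigsum a [seq (c * p.1, p.2) | p <- s] x)) =
   (fun x => c * (ind x * (u x - trigsum a s x))).
  apply/funext => x; rewrite mulrCA; congr (_ * _); rewrite mulrBr; congr (_ - _).
  rewrite /trigsum big_map mulr_sumr; apply: eq_bigr => p _.
  by rewrite /= -mulrA.
rewrite L2normsqZ; last by apply: cmeas_ind_sub => //; exact: cmeas_trigsum.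
apply: (@le_trans _ _ ((sqmod c)%:E * (e / (1 + sqmod c))%:E)%E).
  by rewrite lee_wpmul2l// lee_fin sqmod_ge0.
rewrite -EFinM lee_fin mulrCA ler_piMr ?(ltW e0)// ler_pdivrMr ?mul1r ?lerDr//.
by rewrite ltr_wpDr ?sqmod_ge0.
Qed.

Lemma trig_dense0 : trig_dense (fun=> 0).
Proof.
split; first exact: cmeas_cst.
move=> e e0; exists [::].
rewrite (_ : (fun x => _) = (fun=> 0)) ?L2normsq0 ?lee_fin ?ltW//.
by apply/funext => x; rewrite /trigsum big_nil subrr mulr0.
Qed.

Lemma trig_dense_sum (I : Type) (s : seq I) (F : I -> R -> R[i]) :
  (forall i, trig_dense (F i)) -> trig_dense (fun x => \sum_(i <- s) F i x).
Proof.
move=> h; elim: s => [|i s IH].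
  by under eq_fun do rewrite big_nil; exact: trig_dense0.
under eq_fun do rewrite big_cons; exact: trig_denseD.
Qed.

Lemma trig_dense_indic (A : set R) : measurable A ->
  trig_dense (fun x => (\1_A x)%:C).
Proof.
move=> mA; split; first exact: cmeas_indic.
move=> e /((trig_approx_measurable T_gt0 mA).2) [q [[s hs] q01 hq]].
exists s; apply: le_trans hq.
have mq : measurable_fun setT q by apply: (@measurable_trigpoly _ a); exists s.
rewrite [leRHS]integral_mkcond /L2normsq; apply: ge0_le_integral => //.
- by move=> x _; rewrite lee_fin sqmod_ge0.
- apply: measurable_esqmod; apply: cmeas_ind_sub; first exact: cmeas_indic.
  exact: cmeas_trigsum.
- apply/(measurable_restrictT _ _).1 => //; exact: measurable_dist.
move=> x _; rewrite patchE hs sqmodM {1}/ind sqmodR indicE.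
case: (x \in _); rewrite /= ?expr0n ?expr1n ?mul0r ?mul1r//.
rewrite lee_fin -rmorphB sqmodR -real_normK ?num_real// expr2.
(* A distance at most 1 dominates its square, so smallness in mean gives smallness in square
   mean. *)
have h1 : `|\1_A x - q x| <= 1.
  have := q01 x; rewrite indicE; case: (_ \in _) => /= /andP[h1 h2];
  by rewrite ler_norml; apply/andP; split; lra.
by rewrite ler_piMl.
Qed.

Import HBNNSimple.

Lemma trig_dense_nnsfun (f : {nnsfun R >-> R}) : trig_dense (fun x => (f x)%:C).
Proof.
have -> : (fun x => (f x)%:C) = (fun x => \sum_(y <- fset_set (range f))
   y%:C * (\1_(f @^-1` [set y]) x)%:C).
  apply/funext => x; rewrite fimfunE fsbig_finite//= rmorph_sum /=.
  by apply: eq_bigr => y _; rewrite rmorphM.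
by apply: trig_dense_sum => y; apply: trig_denseZ; exact: trig_dense_indic.
Qed.

Lemma trig_dense_nneg (f : R -> R) : (forall x, 0 <= f x) ->
  inL2 (fun x => (f x)%:C) -> trig_dense (fun x => (f x)%:C).
Proof.
move=> f0 f2; have [mf _] := f2; have mfr := mf.1; rewrite /= in mfr.
apply: trig_dense_lim => // e e0.
have mfE : measurable_fun setT (EFin \o f) by apply/measurable_EFinP.
pose f_ n := nnsfun_approx measurableT mfE n.
have fle n x : 0 <= f_ n x <= f x.
  rewrite fun_ge0/=.
  have := le_approx n (fun x _ => (f0 x : 0 <= (EFin \o f) x)%E) (x := x) Logic.I.
  by rewrite /f_ nnsfun_approxE lee_fin.
have mf_ n : measurable_fun setT (f_ n) by [].
have mC n : cmeasurable (fun x => (f_ n x)%:C) by exact: cmeas_RtoC.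
have h := @dominated_cvg _ _ R leb setT measurableT
   (fun n x => (sqmod (ind x * ((f x)%:C - (f_ n x)%:C)))%:E) (fun=> 0%E)
   (fun x => (sqmod (f x)%:C)%:E).
have : (\int[leb]_(x in setT) (sqmod (ind x * ((f x)%:C - (f_ n x)%:C)))%:E @[n --> \oo] -->
   \int[leb]_(x in setT) (cst 0 x))%E.
  apply: h => //.
  - by move=> n; apply: measurable_esqmod; exact: cmeas_ind_sub.
  - move=> x _; apply: cvg_EFin; first exact: nearW.
    have fx := @cvg_nnsfun_approx _ _ R setT measurableT _ mfE (fun x _ => (f0 x : 0 <= (EFin \o f) x)%E) x Logic.I.
    have {}fx : f_ n x @[n --> \oo] --> f x.
      by have /fine_cvgP[_] := fx.
    have -> : (fine \o (fun n : nat => (sqmod (ind x * ((f x)%:C - (f_ n x)%:C)))%:E)) =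
       (fun n => sqmod (ind x) * ((f x - f_ n x) * (f x - f_ n x))).
      by apply/funext => n /=; rewrite sqmodM -rmorphB [X in _ * X]sqmodR expr2.
    have d0 : f x - f_ n x @[n --> \oo] --> (0 : R).
      by rewrite -[X in _ --> X](subrr (f x)); apply: cvgB => //; exact: cvg_cst.
    have dd : (f x - f_ n x) * (f x - f_ n x) @[n --> \oo] --> (0 : R).
      by rewrite -[X in _ --> X](mulr0 0); exact: cvgM.
    by rewrite -[X in _ --> X](mulr0 (sqmod (ind x))); apply: cvgM => //; exact: cvg_cst.
  - exact: inL2_integrable.
  - move=> n x _; rewrite abse_EFin lee_fin ger0_norm ?sqmod_ge0//.
    rewrite sqmodM -rmorphB [X in _ * X]sqmodR [X in _ <= X]sqmodR; have /andP[h1 h2] := fle n x.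
    apply: (@le_trans _ _ (1 * (f x - f_ n x) ^+ 2)).
      by rewrite ler_wpM2r ?sqr_ge0// sqmod_period_ind.
    by rewrite mul1r lerXn2r ?nnegrE ?subr_ge0// lerBlDr lerDl.
rewrite integral0 => /fine_cvgP [[M _ hfin]].
move=> /cvgrPdist_le /(_ e e0) [N _ hN].
(* Beyond [M] the integral is finite, so that [fine] does not alter it; beyond [N] it is at most
   [e]. *)
exists (fun x => (f_ (maxn M N) x)%:C); first exact: trig_dense_nnsfun.
have := hN (maxn M N) (leq_maxr _ _); rewrite /= sub0r normrN => hMN.
rewrite /L2normsq -(fineK (hfin _ (leq_maxl M N))) lee_fin.
by rewrite (le_trans (ler_norm _)).
Qed.

Lemma trig_dense_real (f : R -> R) :
  inL2 (fun x => (f x)%:C) -> trig_dense (fun x => (f x)%:C).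
Proof.
move=> f2; have mf : measurable_fun setT f := f2.1.1.
have h (s : R) : s ^+ 2 = 1 -> inL2 (fun x => (Num.max (s * f x) 0)%:C).
  move=> s1; apply: (inL2_le (M:=1) _ f2) => //.
    apply: cmeas_RtoC; apply: measurable_maxr; last exact: measurable_cst.
    by apply: measurable_funM => //; exact: measurable_cst.
  move=> x; rewrite mul1r !sqmodR; case: (leP (s * f x) 0) => _; first by rewrite expr0n sqr_ge0.
  by rewrite exprMn s1 mul1r.
have -> : (fun x => (f x)%:C) = (fun x => (Num.max (1 * f x) 0)%:C +
   -1 * (Num.max (-1 * f x) 0)%:C).
  apply/funext => x; rewrite mulN1r -rmorphB; congr (_%:C).
  by rewrite mul1r mulN1r; case: (leP (f x) 0) => h1; case: (leP (- f x) 0) => h2; lra.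
apply: trig_denseD; last apply: trig_denseZ; apply: trig_dense_nneg.
- by move=> x; rewrite le_max lexx orbT.
- by apply: h; rewrite expr1n.
- by move=> x; rewrite le_max lexx orbT.
- by apply: h; rewrite sqrrN expr1n.
Qed.

Lemma trig_dense_L2 u : inL2 u -> trig_dense u.
Proof.
move=> u2; have [[m1 m2] _] := u2.
have -> : u = (fun x => (Re (u x))%:C + 'i * (Im (u x))%:C).
  by apply/funext => x; apply: complexP; rewrite !(ReD,ImD,ReM,ImM)/=; ring.
apply: trig_denseD; last apply: trig_denseZ; apply: trig_dense_real.
  apply: (inL2_le (M:=1) _ u2) => //.
  by move=> x; rewrite mul1r sqmodR sqr_Re_le.
apply: (inL2_le (M:=1) _ u2) => //.
by move=> x; rewrite mul1r sqmodR sqr_Im_le.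
Qed.

End TrigL2.

(** * Fourier series *)

Section Parseval.
Context {R : realType} (T : R) (T_gt0 : 0 < T).
Let a : R := 2 * pi / T.
Local Notation D := (`[0, T[%classic : set R).
Local Notation ind := (period_ind T).

(** Cut off outside the period so that [inner], an integral over the line, can be used. The family
    is orthogonal but not normalized: each squared norm is [T], the origin of the factors [T] and
    [T^-1] below. *)
Definition ebas (n : int) (x : R) : R[i] := ind x * expi (n%:~R * (a * x)).

Lemma cmeas_expi_int (n : int) : cmeasurable (fun x : R => expi (n%:~R * (a * x))).
Proof. by under eq_fun do rewrite mulrA; exact: cmeas_expi_lin. Qed.

Lemma inL2_ind : inL2 ind.
Proof.
split; first exact: cmeas_period_ind.
have -> : L2normsq ind = (\int[leb]_(x in D) (cst 1 x)%:E)%E.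
  rewrite [RHS]integral_mkcond; apply: eq_integral => x _; rewrite patchE.
  rewrite /period_ind sqmodR indicE; case: (_ \in _) => /=; first by rewrite expr1n.
  by rewrite expr0n.
have /integrableP[_] := integrable_cst_period T_gt0 1.
by under eq_integral do rewrite /= normr1.
Qed.

Lemma inL2_ebas n : inL2 (ebas n).
Proof.
have -> : ebas n = (fun x => expi (n%:~R * (a * x)) * ind x).
  by apply/funext => x; rewrite mulrC.
apply: (inL2_bnd (M := 1)); last exact: inL2_ind.
  exact: cmeas_expi_int.
by move=> x; rewrite sqmod_expi.
Qed.


Lemma derive_lin_comp (f df : R -> R) (c x : R) :
  (forall y : R, is_derive y (1 : R) f (df y)) ->
  is_derive x (1 : R) (fun y : R => f (c * y)) (c * df (c * x)).
Proof.
move=> h.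
have hc : is_derive x (1 : R) (fun y : R => c * y) c.
  have := @is_deriveZ R R R id c x 1 1 (is_derive_id x 1).
  by rewrite /GRing.scale /= mulr1.
have := @is_derive1_comp R f (fun y => c * y) x (df (c * x)) c (h (c * x)) hc.
by rewrite mulrC.
Qed.

Lemma integral_period_trig (f df : R -> R) (c : R) : c != 0 ->
  (forall y : R, is_derive y (1 : R) f (df y)) -> continuous df ->
  f (c * T) = f 0 -> \int[leb]_(x in D) df (c * x) = 0.
Proof.
move=> c0 hf cdf fT.
have hF (x : R) : is_derive x (1 : R) (fun y => c^-1 * f (c * y)) (df (c * x)).
  have := @is_deriveZ R R R _ c^-1 x 1 _ (derive_lin_comp c x hf).
  by rewrite /GRing.scale /= mulrA mulVf// mul1r.
have cdfc : continuous (fun x => df (c * x)).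
  move=> x; apply: continuous_comp; last exact: cdf.
  exact: mulrl_continuous.
have cF x : {for x, continuous (fun y => c^-1 * f (c * y))}.
  apply: differentiable_continuous; apply/derivable1_diffP.
  by have [] := hF x.
have := @continuous_FTC2 R (fun x => df (c * x)) (fun x => c^-1 * f (c * x)) 0 T T_gt0.
rewrite mulr0 fT -EFinB subrr => h.
rewrite /Rintegral integral_itv_bndo_bndc; last first.
  apply: measurable_funTS; apply/measurable_EFinP.
  exact: continuous_measurable_fun.
rewrite h//.
- exact: continuous_subspaceT.
- split.
  + by move=> x _; have [] := hF x.
  + by apply: cvg_at_right_filter; exact: cF.
  + by apply: cvg_at_left_filter; exact: cF.
- by move=> x _; rewrite derive1E; have [_] := hF x.
Qed.

Lemma cintegral_ind_expi (k : int) :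
  cintegral (fun x => ind x * expi (k%:~R * (a * x))) = (if k == 0 then T else 0)%:C.
Proof.
have fE (f : R -> R) : \int[leb]_x (\1_D x * f x) = \int[leb]_(x in D) f x.
  rewrite [RHS]Rintegral_mkcond patch_indic.
  by apply: eq_Rintegral => x _ /=; rewrite mulrC.
have RI (u : R -> R[i]) : Re (cintegral u) = \int[leb]_x Re (u x) by [].
have II (u : R -> R[i]) : Im (cintegral u) = \int[leb]_x Im (u x) by [].
have Rind x : Re (ind x) = \1_D x by [].
have Iind x : Im (ind x) = 0 by [].
have ReI x t : Re (ind x * expi t) = \1_D x * cos t by rewrite ReM Rind Iind mul0r subr0.
have ImI x t : Im (ind x * expi t) = \1_D x * sin t by rewrite ImM Rind Iind mul0r addr0.
have aT : a * T = 2 * pi by rewrite /a divfK// gt_eqF.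
have [->|k0] := eqVneq k 0.
  apply: complexP; rewrite ?RI ?II [RHS]/=.
    under eq_Rintegral do rewrite ReI mul0r cos0.
    rewrite fE Rintegral_cst// mul1r.
    have h := @lebesgue_measure_itv R `[0, T[.
    by rewrite [X in fine X]h /= lte_fin T_gt0 -EFinD subr0.
  under eq_Rintegral do rewrite ImI mul0r sin0 mulr0.
  by rewrite /Rintegral integral0.
have c0 : k%:~R * a != 0.
  by rewrite mulf_neq0 ?intr_eq0// gt_eqF// /a divr_gt0// mulr_gt0// pi_gt0.
have cT : k%:~R * a * T = k%:~R * (2 * pi) by rewrite -mulrA aT.
have := @expi_2pi R k; rewrite -cT => -[cT1 sT0].
apply: complexP; rewrite ?RI ?II [RHS]/=.
  under eq_Rintegral do rewrite ReI mulrA.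
  rewrite fE; apply: (integral_period_trig (f := sin)) => //.
    exact: continuous_cos.
  by rewrite sT0 sin0.
under eq_Rintegral do rewrite ImI mulrA.
rewrite fE; apply: (integral_period_trig (f := fun x => - cos x)) => //.
- by move=> y; rewrite -[sin y]opprK; exact: is_deriveN.
- exact: continuous_sin.
- by rewrite cT1 cos0.
Qed.

Lemma inner_ebas n m : inner (ebas n) (ebas m) = (if n == m then T else 0)%:C.
Proof.
rewrite -subr_eq0 -cintegral_ind_expi; congr cintegral; apply/funext => x.
rewrite /ebas rmorphM /= -expiN rmorphB /= mulrBl expiD.
have -> : Num.conj (ind x) = ind x by rewrite /period_ind conjE oppr0.
rewrite -[in RHS](period_ind_idem T x); ring.
Qed.

Definition coef (u : R -> R[i]) (n : int) : R[i] := inner u (ebas n).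

Definition lincomb (d : int -> R[i]) (F : {fset int}) (x : R) : R[i] :=
  \sum_(n <- F) d n * ebas n x.

Lemma inL2_lincomb d F : inL2 (lincomb d F).
Proof. by apply: inL2_sum => n; apply: inL2Z; exact: inL2_ebas. Qed.

Lemma inner_lincomb u d F : inL2 u ->
  inner u (lincomb d F) = \sum_(n <- F) Num.conj (d n) * coef u n.
Proof.
move=> u2; rewrite (innerC (inL2_lincomb d F) u2) inner_suml//; last first.
  by move=> n; apply: inL2Z; exact: inL2_ebas.
rewrite rmorph_sum; apply: eq_bigr => n _; rewrite innerZl//; last exact: inL2_ebas.
by rewrite rmorphM /= -innerC//; exact: inL2_ebas.
Qed.

Lemma coef_lincomb d (F : {fset int}) n : coef (lincomb d F) n = if n \in F then d n * T%:C else 0.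
Proof.
rewrite /coef inner_suml; last exact: inL2_ebas; last first.
  by move=> m; apply: inL2Z; exact: inL2_ebas.
have -> : \sum_(i <- F) inner (fun x => d i * ebas i x) (ebas n) =
   \sum_(i <- F) (if i == n then d n * T%:C else 0).
  apply: eq_bigr => i _; rewrite innerZl ?inner_ebas; try exact: inL2_ebas.
  by case: eqP => [->//|_]; rewrite mulr0.
case: ifPn => nF.
  rewrite (big_fsetD1 n)//= eqxx big_seq big1 ?addr0// => i.
  by rewrite in_fsetD1 => /andP[/negbTE -> _].
rewrite big_seq big1// => i iF.
by case: eqP => // e; rewrite e (negbTE nF) in iF.
Qed.

(** Completing the square in each coefficient: only the last term depends on [d], and it vanishes
    for the Fourier coefficients. Best approximation and Bessel's inequality are both read off from
    it. *)
Lemma nrm2_sub_lincomb u d F : inL2 u ->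
  nrm2 (fun x => u x - lincomb d F x) = nrm2 u - T^-1 * \sum_(n <- F) sqmod (coef u n)
    + T * \sum_(n <- F) sqmod (d n - T^-1%:C * coef u n).
Proof.
move=> u2; rewrite nrm2B//; last exact: inL2_lincomb.
have -> : nrm2 (lincomb d F) = T * \sum_(n <- F) sqmod (d n).
  apply: complexI; rewrite -inner_nrm2; last exact: inL2_lincomb.
  rewrite inner_lincomb; last exact: inL2_lincomb.
  rewrite mulr_sumr rmorph_sum big_seq [RHS]big_seq; apply: eq_bigr => n nF.
  rewrite coef_lincomb nF mulrA [Num.conj _ * _]mulrC mul_conj rmorphM /=.
  by rewrite mulrC.
rewrite inner_lincomb// Re_sum !mulr_sumr -!sumrN -!addrA; congr (_ + _).
rewrite -!big_split /=; apply: eq_bigr => n _.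
move: (coef u n) (d n) => [c1 c2] [d1 d2].
rewrite /sqmod !(ReM, ImM, ReD, ImD, ReN, ImN, Re_conj, Im_conj) /=.
by field; exact: lt0r_neq0.
Qed.

Definition fsum u (F : {fset int}) : R -> R[i] :=
  lincomb (fun n => T^-1%:C * coef u n) F.

Lemma nrm2_sub_fsum u F : inL2 u ->
  nrm2 (fun x => u x - fsum u F x) = nrm2 u - T^-1 * \sum_(n <- F) sqmod (coef u n).
Proof.
move=> u2; rewrite nrm2_sub_lincomb// [X in _ + _ * X]big1 ?mulr0 ?addr0// => n _.
by rewrite subrr sqmod0.
Qed.

Lemma fsum_best u d F : inL2 u ->
  nrm2 (fun x => u x - fsum u F x) <= nrm2 (fun x => u x - lincomb d F x).
Proof.
move=> u2; rewrite nrm2_sub_fsum// nrm2_sub_lincomb// lerDl mulr_ge0 ?(ltW T_gt0)//.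
by apply: sumr_ge0 => n _; exact: sqmod_ge0.
Qed.

(** Repeated frequencies are gathered, and the coefficients are empty sums off the list; one [d]
    thus serves every [F] that is large enough, as unconditional convergence requires. *)
Lemma trigsum_lincomb s : exists d, forall F : {fset int},
  (forall p, p \in s -> p.2 \in F) -> forall x, ind x * trigsum a s x = lincomb d F x.
Proof.
exists (fun n => \sum_(p <- s | p.2 == n) p.1) => F hF x.
rewrite /trigsum /lincomb mulr_sumr.
under [RHS]eq_bigr do rewrite mulr_suml big_mkcond /=.
rewrite exchange_big /= big_seq [RHS]big_seq; apply: eq_bigr => p ps.
rewrite (big_fsetD1 p.2) ?hF//= eqxx big_seq big1 ?addr0; last first.
  by move=> n; rewrite in_fsetD1 eq_sym => /andP[/negbTE -> _].
by rewrite /ebas mulrCA.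
Qed.

(** Density provides one good trigonometric polynomial; by [fsum_best], the Fourier sum over any [F]
    containing its frequencies is at least as good. *)
Lemma fsum_cvg u : inL2 u -> (forall x, ~ D x -> u x = 0) ->
  forall e, 0 < e -> exists F0 : {fset int}, forall F, (F0 `<=` F)%fset ->
  nrm2 (fun x => u x - fsum u F x) <= e.
Proof.
move=> u2 uD e e0.
have [s hs] := (trig_dense_L2 T_gt0 u2).2 _ e0.
have [d hd] := trigsum_lincomb s.
exists [fset p.2 | p in s]%fset => F /fsubsetP sF.
apply: le_trans (fsum_best d F u2) _.
have ud := inL2B u2 (inL2_lincomb d F).
rewrite -lee_fin -(L2normsqE ud).
have -> // : (fun x => u x - lincomb d F x) = (fun x => ind x * (u x - trigsum a s x)).
apply/funext => x; rewrite mulrBr (hd F).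
  rewrite /period_ind indicE; congr (_ - _); case: (boolP (x \in _)) => /=.
    by rewrite mul1r.
  by move=> /negP nD; rewrite mul0r uD// => /mem_set.
by move=> p ps; apply: sF; apply/imfsetP; exists p.
Qed.

Lemma bessel u (F : {fset int}) : inL2 u -> \sum_(n <- F) sqmod (coef u n) <= T * nrm2 u.
Proof.
move=> u2; have := nrm2_ge0 (fun x => u x - fsum u F x).
by rewrite nrm2_sub_fsum// subr_ge0 -ler_pdivrMl.
Qed.

Lemma parseval u : inL2 u -> (forall x, ~ D x -> u x = 0) ->
  \esum_(n in [set: int]) (sqmod (coef u n))%:E = (T * nrm2 u)%:E.
Proof.
move=> u2 uD; apply/eqP; rewrite eq_le; apply/andP; split.
  apply: ub_ereal_sup => _ [A [fA _] <-].
  by rewrite fsbig_finite//= sumEFin lee_fin bessel.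
apply/lee_addgt0Pr => e e0.
have eT : 0 < e / T by rewrite divr_gt0.
have [F0 /(_ F0 (fsubset_refl _))] := fsum_cvg u2 uD eT.
rewrite nrm2_sub_fsum// => h.
apply: (@le_trans _ _ ((\sum_(n <- F0) sqmod (coef u n))%:E + e%:E)%E).
  have Tn0 : T != 0 by rewrite gt_eqF.
  have := ler_wpM2l (ltW T_gt0) h; rewrite -EFinD lee_fin.
  by rewrite mulrBr mulrA mulfV// mul1r [T * (e / T)]mulrCA mulfV// mulr1; lra.
rewrite leeD2r//; apply: esum_ge; exists [set` F0].
  by split => //; exact: finite_fset.
by rewrite fsbig_finite//= set_fsetK sumEFin.
Qed.

End Parseval.

(** * The Fourier transform *)

Section Periodization.
Context {R : realType}.

(** The enumeration 0, -1, 1, -2, and so on. It turns sums over the integers into series, which can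
    be exchanged with integrals. *)
Definition int_of_nat_enum (k : nat) : int := if odd k then Negz k./2 else Posz k./2.

Lemma int_of_nat_enum_bij : bijective int_of_nat_enum.
Proof.
exists (fun z : int => match z with Posz m => m.*2 | Negz m => m.*2.+1 end).
  move=> k; rewrite /int_of_nat_enum; have := odd_double_half k.
  by case: (odd k) => /=.
by case => m; rewrite /int_of_nat_enum /= ?odd_double ?doubleK// uphalf_double.
Qed.

Lemma esum_int_nat (F : int -> \bar R) : (forall n, (0 <= F n)%E) ->
  (\esum_(n in [set: int]) F n = \sum_(0 <= k <oo) F (int_of_nat_enum k))%E.
Proof.
move=> F0; rewrite nneseries_esumT => [|n]; last exact: F0.
by apply: reindex_esum; rewrite setTT_bijective; exact: int_of_nat_enum_bij.
Qed.

(** The cells [[n a, n a + a[] are the fibres of [floor (x / a)], hence partition the line; each is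
    translated back to the first one. *)
Lemma periodize_integral (a : R) (g : R -> \bar R) : 0 < a ->
  measurable_fun [set: R] g -> (forall x, (0 <= g x)%E) ->
  (\int[leb]_x g x =
   \int[leb]_(x in `[0%R, a[) \esum_(n in [set: int]) g (x + n%:~R * a)%R)%E.
Proof.
move=> a0 mg g0.
pose F k : set R := `[(int_of_nat_enum k)%:~R * a, (int_of_nat_enum k)%:~R * a + a[%classic.
have FE (n : int) (x : R) : (x \in `[n%:~R * a, n%:~R * a + a[) = (Num.floor (x / a) == n).
  rewrite floor_eq in_itv/= ler_pdivlMr// ltr_pdivrMr//.
  by rewrite rmorphD /= mulrDl mul1r.
have UF : \bigcup_k F k = setT.
  apply/seteqP; split => // x _.
  have [e eK Ke] := int_of_nat_enum_bij.
  by exists (e (Num.floor (x / a))) => //; rewrite /F /= Ke FE.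
have tF : trivIset setT F.
  apply/trivIsetP => i j _ _ ij; apply/seteqP; split => // x [].
  rewrite /F /= !FE => /eqP -> /eqP h.
  by move/negP: ij; apply; apply/eqP; exact: (bij_inj int_of_nat_enum_bij).
have mF k : measurable (F k) by exact: measurable_itv.
have mgs (c : R) : measurable_fun [set: R] (fun x => g (x + c)).
  by apply: (measurableT_comp mg); exact: measurable_shift.
under [RHS]eq_integral do rewrite esum_int_nat//.
rewrite integral_nneseries//; last by move=> n; apply: measurable_funTS; exact: mgs.
rewrite -[in LHS]UF ge0_integral_bigcup//; last exact: measurable_funTS.
apply: eq_eseriesr => k _.
rewrite integral_mkcond [RHS]integral_mkcond.
set c := (int_of_nat_enum k)%:~R * a.
rewrite -(@ge0_integral_shift R c (g \_ (F k))).
- apply: eq_integral => x _; rewrite !patchE.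
  have -> // : (x + c \in F k) = (x \in `[0, a[%classic).
  apply/idP/idP => /set_mem; rewrite /F /= in_itv/= => h; apply/mem_set;
    by rewrite /F /= in_itv/=; move: h; rewrite -/c; lra.
- by apply/(measurable_restrictT _ _).1 => //; exact: measurable_funTS.
- by move=> x; rewrite patchE; case: ifP.
Qed.

Lemma limn_einf_le (u : (\bar R)^nat) (C : \bar R) : (forall n, (u n <= C)%E) ->
  (limn_einf u <= C)%E.
Proof.
move=> uC; rewrite limn_einf_lim; apply: lime_le; first exact: is_cvg_einfs.
apply: nearW => n; apply: le_trans (uC n).
by apply: ereal_inf_lbound; exists n => //=.
Qed.

End Periodization.

(** * The Fourier integral *)

Section Plancherel.
Context {R : realType}.
Implicit Types (f g u v : R -> R[i]).

(* Opaque, so that unification does not unfold the square root. *)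
Lemma fourier_cst_sig : {c : R[i] | c = ((Num.sqrt (2 * pi))^-1)%:C}.
Proof. by eexists. Qed.

Definition fourier_cst : R[i] := sval fourier_cst_sig.
Local Notation c0 := fourier_cst.

Lemma sqmod_fourier_cst : sqmod c0 = (2 * pi)^-1.
Proof.
rewrite /c0 (svalP fourier_cst_sig).
by rewrite sqmodR exprVn sqr_sqrtr// mulr_ge0// pi_ge0.
Qed.

Lemma cmeas_kernel (xi : R) : cmeasurable (fun t : R => expi (- (t * xi))).
Proof.
by apply: cmeas_expi; apply: measurable_funN; exact: mulrr_measurable.
Qed.

Lemma fourierL1E f xi :
  fourierL1 f xi = c0 * cintegral (fun t => f t * expi (- (t * xi))).
Proof.
by rewrite /fourierL1 /c0 (svalP fourier_cst_sig); under eq_fun do rewrite expi_kernel.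
Qed.

Lemma inL1_kernel f xi : inL1 f -> inL1 (fun t => f t * expi (- (t * xi))).
Proof.
move=> f1; under eq_fun do rewrite mulrC.
apply: (inL1_bnd (M := 1)) => //; first exact: cmeas_kernel.
by move=> t; rewrite sqmod_expi expr1n.
Qed.

Lemma fourierL1D f g xi : inL1 f -> inL1 g ->
  fourierL1 (fun x => f x + g x) xi = fourierL1 f xi + fourierL1 g xi.
Proof.
move=> f1 g1; rewrite !fourierL1E.
have -> : (fun t => (f t + g t) * expi (- (t * xi))) =
  (fun t => f t * expi (- (t * xi)) + g t * expi (- (t * xi))).
  by apply/funext => t; rewrite mulrDl.
rewrite cintegralD; try exact: inL1_kernel.
exact: mulrDr.
Qed.

Lemma fourierL1Z c f xi : inL1 f ->
  fourierL1 (fun x => c * f x) xi = c * fourierL1 f xi.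
Proof.
move=> f1; rewrite !fourierL1E.
have -> : (fun t => c * f t * expi (- (t * xi))) = (fun t => c * (f t * expi (- (t * xi)))).
  by apply/funext => t; rewrite mulrA.
rewrite cintegralZ; last exact: inL1_kernel.
exact: mulrCA.
Qed.

Lemma fourierL1B f g xi : inL1 f -> inL1 g ->
  fourierL1 (fun x => f x - g x) xi = fourierL1 f xi - fourierL1 g xi.
Proof.
move=> f1 g1; have gN := inL1Z (-1) g1.
have -> : (fun x => f x - g x) = (fun x => f x + -1 * g x).
  by apply/funext => x; rewrite mulN1r.
by rewrite fourierL1D// fourierL1Z// mulN1r.
Qed.

Lemma fourierL1_tau b f xi : inL1 f ->
  fourierL1 (tau b f) xi = expi (b * xi) * fourierL1 f xi.
Proof.
move=> f1; rewrite !fourierL1E; apply: (@etrans _ _ (c0 * (expi (b * xi) * cintegral (fun t => f t * expi (- (t * xi)))))); last exact: mulrCA.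
congr (_ * _).
rewrite -cintegralZ; last exact: inL1_kernel.
rewrite -(cintegral_tau b (inL1Z (expi (b * xi)) (inL1_kernel xi f1))).
congr cintegral; apply/funext => t; rewrite /tau mulrCA -expiD.
by congr (_ * expi _); ring.
Qed.

Lemma kernel_le f xi t :
  `|Re (f t * expi (- (t * xi)))| <= `|Re (f t)| + `|Im (f t)| /\
  `|Im (f t * expi (- (t * xi)))| <= `|Re (f t)| + `|Im (f t)|.
Proof.
have h (x y c s : R) : `|c| <= 1 -> `|s| <= 1 -> `|x * c + y * s| <= `|x| + `|y|.
  move=> c1 s1; rewrite (le_trans (ler_normD _ _))// !normrM.
  by apply: lerD; rewrite ler_piMr.
split.
  set th := - (t * xi); rewrite ReM.
  have := h (Re (f t)) (Im (f t)) (cos th) (- sin th).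
  by rewrite normrN [Im _ * - _]mulrN; apply; [exact: cos_max|exact: sin_max].
by rewrite ImM; apply: h => /=; [exact: sin_max|exact: cos_max].
Qed.

(** The transform is even continuous: the integrand is continuous in [xi] and dominated, uniformly
    in [xi], by an integrable function. *)
Lemma cmeas_fourierL1 f : inL1 f -> cmeasurable (fourierL1 f).
Proof.
move=> f1.
have -> : fourierL1 f = (fun xi => c0 * cintegral (fun t => f t * expi (- (t * xi)))).
  by apply/funext => xi; exact: fourierL1E.
apply: cmeasM; first exact: cmeas_cst.
have cont_expi t : continuous (fun xi : R => cos (- (t * xi))) /\
                   continuous (fun xi : R => sin (- (t * xi))).
  split => x; apply: continuous_comp; try exact: continuous_cos; try exact: continuous_sin;
    apply: (@continuousN R R^o); exact: mulrl_continuous.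
have key (F : R -> R -> R) : (forall xi, leb.-integrable setT (EFin \o F xi)) ->
   (forall t, continuous (F ^~ t)) -> (forall xi t, `|F xi t| <= `|Re (f t)| + `|Im (f t)|) ->
   measurable_fun [set: R] (fun xi => \int[leb]_t F xi t).
  move=> iF cF bF; apply: continuous_measurable_fun => x.
  have h := @continuity_under_integral R _ _ leb F setT measurableT (x - 1) (x + 1).
  have {}h := h _ _ (fun t => `|Re (f t)| + `|Im (f t)|).
  apply: h.
  - by move=> xi _; exact: iF.
  - by apply: aeT => t _ xi _; exact: cF.
  - exact: inL1_int_sqrt.
  - by move=> xi _; apply: aeT => t _; exact: bF.
  - by rewrite inE /= in_itv/=; lra.
split; rewrite /cintegral /=; apply: key.
- by move=> xi; exact: (inL1_kernel xi f1).1.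
- move=> t x; under eq_fun do rewrite ReM /=.
  by apply: cvgB; (apply: cvgM; first exact: cvg_cst); [exact: (cont_expi t).1|exact: (cont_expi t).2].
- by move=> xi t; have [] := kernel_le f xi t.
- by move=> xi; exact: (inL1_kernel xi f1).2.
- move=> t x; under eq_fun do rewrite ImM /=.
  by apply: cvgD; (apply: cvgM; first exact: cvg_cst); [exact: (cont_expi t).2|exact: (cont_expi t).1].
- by move=> xi t; have [] := kernel_le f xi t.
Qed.

End Plancherel.

(** * Plancherel's theorem for functions both integrable and square-integrable *)

Section PlancherelL1L2.
Context {R : realType}.
Implicit Types (f g u v : R -> R[i]).

Lemma ler_young_lim (N M : R) : 0 <= M ->
  (forall t, 0 < t -> N <= (1 + t) ^+ 2 * M) -> N <= M.
Proof.
move=> M0 h; apply/ler_addgt0Pr => e e0.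
(* For [t <= 1] one has [(1 + t)^2 <= 1 + 3t], so the excess is at most [3 t M]; this [k] ensures
   both [t <= 1] and [3 t M <= e]. *)
pose k := 3 * M + 3 + e; have k0 : 0 < k by rewrite /k; lra.
pose t := e / k; have t0 : 0 < t by rewrite divr_gt0.
have t1 : t <= 1 by rewrite /t ler_pdivrMr// /k; lra.
have tk : t * k = e by rewrite /t divfK// gt_eqF.
apply: (le_trans (h t t0)).
have : t * (3 * M) <= e by rewrite -[leRHS]tk ler_wpM2l ?(ltW t0)// /k; lra.
have := mulr_ge0 (ltW t0) M0; nra.
Qed.

Lemma nrm2BC f g : nrm2 (fun x => f x - g x) = nrm2 (fun x => g x - f x).
Proof. by rewrite /nrm2 L2normsqBC. Qed.

(** Norms appear squared, so Young's inequality with weight [t] plays the role of the triangle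
    inequality, once for [f] and once for [g], whence the factor [(1 + t)^2] removed by
    [ler_young_lim]. *)
Lemma nrm2_le_lim f g (u_ v_ : nat -> R -> R[i]) : inL2 f -> inL2 g ->
  (forall n, inL2 (u_ n)) -> (forall n, inL2 (v_ n)) ->
  nrm2 (fun x => f x - u_ n x) @[n --> \oo] --> (0 : R) ->
  nrm2 (fun x => g x - v_ n x) @[n --> \oo] --> (0 : R) ->
  (forall n, nrm2 (u_ n) <= nrm2 (v_ n)) -> nrm2 f <= nrm2 g.
Proof.
move=> f2 g2 u2 v2 fu gv uv; apply: ler_young_lim; first exact: nrm2_ge0.
move=> t t0; have tt0 : 0 <= 1 + t by rewrite addr_ge0// ltW.
have bnd n : nrm2 f <= (1 + t) ^+ 2 * nrm2 g + ((1 + t^-1) * nrm2 (fun x => f x - u_ n x)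
   + (1 + t) * (1 + t^-1) * nrm2 (fun x => g x - v_ n x)).
  have l1 : nrm2 f <= (1 + t) * nrm2 (u_ n) + (1 + t^-1) * nrm2 (fun x => f x - u_ n x).
    have := nrm2_le_young t0 (u2 n) (inL2B f2 (u2 n)).
    by rewrite (_ : (fun x => _ + _) = f)//; apply/funext => x; rewrite addrC subrK.
  have l2 : nrm2 (v_ n) <= (1 + t) * nrm2 g + (1 + t^-1) * nrm2 (fun x => g x - v_ n x).
    have := nrm2_le_young t0 g2 (inL2B (v2 n) g2).
    rewrite (_ : (fun x => _ + _) = v_ n); last by apply/funext => x; rewrite addrC subrK.
    by rewrite (nrm2BC (v_ n)).
  have := ler_wpM2l tt0 (le_trans (uv n) l2).
  by move: l1; rewrite mulrDr !mulrA -expr2; lra.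
have hc : (1 + t) ^+ 2 * nrm2 g + ((1 + t^-1) * nrm2 (fun x => f x - u_ n x)
   + (1 + t) * (1 + t^-1) * nrm2 (fun x => g x - v_ n x)) @[n --> \oo] -->
   (1 + t) ^+ 2 * nrm2 g + ((1 + t^-1) * 0 + (1 + t) * (1 + t^-1) * 0).
  apply: cvgD; first exact: cvg_cst.
  by apply: cvgD; apply: cvgM => //; exact: cvg_cst.
rewrite !mulr0 !addr0 in hc.
by apply: (ler_cvg_to (cvg_cst _) hc); exact: nearW.
Qed.

Lemma supp_inL1 (T : R) u : 0 < T -> inL2 u ->
  (forall x, ~ `[0, T[%classic x -> u x = 0) -> inL1 u.
Proof.
move=> T0 u2 us.
have -> : u = (fun x => period_ind T x * u x).
  apply/funext => x; rewrite /period_ind indicE; case: (boolP (x \in _)) => /=.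
    by rewrite mul1r.
  by move=> /negP nD; rewrite mul0r us// => /mem_set.
by apply: inL2M => //; exact: inL2_ind.
Qed.

Lemma fourierL1_coef (T : R) u (s : R) (n : int) :
  (forall x, ~ `[0, T[%classic x -> u x = 0) ->
  fourierL1 u (s + n%:~R * (2 * pi / T)) =
  @fourier_cst R * coef T (fun t => expi (- (t * s)) * u t) n.
Proof.
move=> us; rewrite fourierL1E.
have -> // : (fun t => u t * expi (- (t * (s + n%:~R * (2 * pi / T))))) =
  (fun t => expi (- (t * s)) * u t * Num.conj (ebas T n t)).
apply/funext => t; rewrite /ebas rmorphM /= -expiN.
have -> : - (t * (s + n%:~R * (2 * pi / T))) =
  - (t * s) + - (n%:~R * (2 * pi / T * t)) by ring.
rewrite expiD /period_ind indicE; case: (boolP (t \in _)) => /=.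
  by move=> _; rewrite conjE oppr0 mul1r; ring.
by move=> /negP nD; rewrite us ?mul0r ?mulr0 ?mul0r// => /mem_set.
Qed.

(* Periodize [|u^|^2] with period [2 pi / T]: by Parseval the periodization is
   constant. *)
Lemma plancherel_supp (T : R) u : 0 < T -> inL2 u ->
  (forall x, ~ `[0, T[%classic x -> u x = 0) ->
  L2normsq (fourierL1 u) = L2normsq u.
Proof.
move=> T0 u2 us.
have u1 := supp_inL1 T0 u2 us.
pose a := 2 * pi / T; have pi0 := @pi_gt0 R.
have a0 : 0 < a by rewrite divr_gt0// mulr_gt0.
have mE := measurable_esqmod (cmeas_fourierL1 u1).
rewrite {1}/L2normsq (periodize_integral a0 mE); last first.
  by move=> x; rewrite lee_fin sqmod_ge0.
have sumE s : \esum_(n in [set: int]) (sqmod (fourierL1 u (s + n%:~R * a)))%:E =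
   (a^-1 * nrm2 u)%:E.
  pose v t := expi (- (t * s)) * u t.
  have v2 : inL2 v.
    apply: (inL2_bnd (M := 1)) => //; first exact: cmeas_kernel.
    by move=> x; rewrite sqmod_expi.
  have vs x : ~ `[0, T[%classic x -> v x = 0 by move=> /us h; rewrite /v h mulr0.
  have vE : nrm2 v = nrm2 u.
    rewrite /nrm2 /L2normsq; congr fine; apply: eq_integral => x _.
    by rewrite sqmodM sqmod_expi mul1r.
  have := parseval T0 v2 vs; rewrite vE => h.
  have -> : a^-1 * nrm2 u = (2 * pi)^-1 * (T * nrm2 u).
    by rewrite /a invf_div -mulrA mulrCA.
  rewrite EFinM -h; apply/esym.
  have p0 : 0 <= (2 * pi)^-1 :> R by rewrite invr_ge0 mulr_ge0// ltW.
  have hint : \esum_(n in [set: int]) ((2 * pi)^-1 * sqmod (coef T v n))%:E =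
      ((2 * pi)^-1%:E * \esum_(n in [set: int]) (sqmod (coef T v n))%:E)%E.
    rewrite !esum_int_nat; try by move=> n; rewrite lee_fin ?mulr_ge0 ?sqmod_ge0.
    under eq_eseriesr do rewrite EFinM.
    by rewrite nneseriesZl// => n _; rewrite lee_fin sqmod_ge0.
  rewrite -hint; apply: eq_esum => n _.
  by rewrite (fourierL1_coef _ _ us) sqmodM sqmod_fourier_cst.
rewrite (eq_integral (cst (a^-1 * nrm2 u)%:E)); last by move=> s _; exact: sumE.
rewrite integral_cst//=.
have h := @lebesgue_measure_itv R `[0, a[.
rewrite [X in (_ * X)%E]h /= lte_fin a0 -EFinD subr0 -EFinM mulrAC mulVf ?gt_eqF//.
by rewrite mul1r -L2normsqE.
Qed.

Lemma plancherel_itv (n : R) u : 0 < n -> inL2 u ->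
  (forall x, ~ `[- n, n[%classic x -> u x = 0) ->
  inL1 u /\ L2normsq (fourierL1 u) = L2normsq u.
Proof.
move=> n0 u2 us; pose v := tau (- n) u.
have n20 : 0 < 2 * n by rewrite mulr_gt0.
have v2 : inL2 v by exact: inL2_tau.
have vs x : ~ `[0, 2 * n[%classic x -> v x = 0.
  move=> h; rewrite /v /tau us// => h'; apply: h.
  by move: h'; rewrite /= !in_itv/=; lra.
have v1 := supp_inL1 n20 v2 vs.
have uE : u = tau n v by apply/funext => x; rewrite /v /tau addrK.
split; first by rewrite uE; exact: inL1_tau.
rewrite -(L2normsq_tau (- n) (inL2_meas u2)) -/v -(plancherel_supp n20 v2 vs).
rewrite /L2normsq; apply: eq_integral => x _.
by rewrite uE fourierL1_tau// sqmodM sqmod_expi mul1r.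
Qed.

(** The half-length is [n.+1], positive for every [n], as [plancherel_itv] requires. *)
Definition truncf (n : nat) u (x : R) : R[i] :=
  (\1_(`[- (n.+1%:R), n.+1%:R[%classic : set R) x)%:C * u x.

Lemma sqmod_indic (A : set R) x : sqmod ((\1_A x)%:C : R[i]) <= 1.
Proof. by rewrite sqmodR indicE; case: (_ \in _); rewrite /= ?expr0n ?expr1n. Qed.

Lemma inL2_truncf n u : inL2 u -> inL2 (truncf n u).
Proof.
move=> u2; apply: (inL2_bnd (M := 1)) => //; first exact: cmeas_indic.
by move=> x; exact: sqmod_indic.
Qed.

Lemma truncf_supp n u x : ~ `[- (n.+1%:R), n.+1%:R[%classic x -> truncf n u x = 0.
Proof. by move=> h; rewrite /truncf indicE memNset// mul0r. Qed.

Lemma inL1_truncf n u : inL2 u -> inL1 (truncf n u).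
Proof.
move=> u2; apply: (@plancherel_itv n.+1%:R _ _ (inL2_truncf n u2) _).1 => //.
exact: truncf_supp.
Qed.

Lemma truncf_eq u x : \forall n \near \oo, truncf n u x = u x.
Proof.
exists (Num.bound `|x|) => // n /= Nn.
rewrite /truncf indicE mem_set ?mul1r//= in_itv/=.
have : `|x| < n.+1%:R.
  rewrite (lt_le_trans (archi_boundP _))// ler_nat.
  exact: (leq_trans Nn).
by rewrite ltr_norml => /andP[h1 h2]; rewrite h2 ltW.
Qed.

Lemma truncf_cvg u : inL2 u ->
  nrm2 (fun x => u x - truncf n u x) @[n --> \oo] --> (0 : R).
Proof.
move=> u2; have mu := inL2_meas u2.
have h := @dominated_cvg _ _ R leb setT measurableT
   (fun n x => (sqmod (u x - truncf n u x))%:E) (fun=> 0%E) (fun x => (sqmod (u x))%:E).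
have : (\int[leb]_(x in setT) (sqmod (u x - truncf n u x))%:E @[n --> \oo] -->
   \int[leb]_(x in setT) (cst 0 x))%E.
  apply: h => //.
  - move=> n; apply: measurable_esqmod; apply: cmeasB => //.
    exact: inL2_meas (inL2_truncf n u2).
  - move=> x _; apply: cvg_near_cst.
    by apply: filterS (truncf_eq u x) => n ->; rewrite subrr sqmod0.
  - exact: inL2_integrable.
  - move=> n x _; rewrite abse_EFin lee_fin ger0_norm ?sqmod_ge0//.
    rewrite /truncf indicE; case: (_ \in _) => /=.
      by rewrite mul1r subrr sqmod0 sqmod_ge0.
    by rewrite mul0r subr0.
by rewrite integral0 => /fine_cvgP [_].
Qed.

Lemma truncf_le n u : inL2 u -> (L2normsq (truncf n u) <= L2normsq u)%E.
Proof.
move=> u2; apply: le_L2normsq; [exact: inL2_meas (inL2_truncf n u2)|exact: inL2_meas|].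
move=> x; rewrite /truncf sqmodM ler_piMl ?sqmod_ge0//; exact: sqmod_indic.
Qed.

(** Stated for the squared moduli, the integrands to which Fatou's lemma will be applied. *)
Lemma fourierL1_truncf_cvg u xi : inL1 u ->
  sqmod (fourierL1 (truncf n u) xi) @[n --> \oo] --> sqmod (fourierL1 u xi).
Proof.
move=> u1; have mu := inL1_meas u1.
pose k t : R[i] := expi (- (t * xi)).
have mk : cmeasurable k by exact: cmeas_kernel.
have mT n : cmeasurable (fun t => truncf n u t * k t).
  by apply: cmeasM => //; apply: cmeasM => //; exact: cmeas_indic.
have key (P : R[i] -> R) : (forall n, measurable_fun [set: R] (fun t => P (truncf n u t * k t))) ->
   (forall t, `|P (u t * k t)| <= `|Re (u t)| + `|Im (u t)|) -> P 0 = 0 ->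
   \int[leb]_t P (truncf n u t * k t) @[n --> \oo] --> \int[leb]_t P (u t * k t).
  move=> mP bP P0.
  have h := @dominated_cvg _ _ R leb setT measurableT
   (fun n t => (P (truncf n u t * k t))%:E) (fun t => (P (u t * k t))%:E)
   (fun t => (`|Re (u t)| + `|Im (u t)|)%:E).
  have {}h : (\int[leb]_t (P (truncf n u t * k t)%R)%:E @[n --> \oo] -->
      \int[leb]_t (P (u t * k t)%R)%:E)%E.
    apply: h => //.
    - by move=> n; apply/measurable_EFinP; exact: mP.
    - move=> t _; apply: cvg_near_cst.
      by apply: filterS (truncf_eq u t) => n ->.
    - exact: inL1_int_sqrt.
    - move=> n t _; rewrite abse_EFin lee_fin.
      rewrite /truncf indicE; case: (_ \in _) => /=; first by rewrite mul1r.
      by rewrite !mul0r P0 normr0 addr_ge0.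
  rewrite /Rintegral.
  have hfin : (\int[leb]_t (P (u t * k t)%R)%:E)%E \is a fin_num.
    apply: integrable_fin_num => //; apply: (le_integrable _ _ _ (inL1_int_sqrt u1)) => //.
      apply/measurable_EFinP.
      apply: (@measurable_fun_cvg _ _ R setT (fun n t => P (truncf n u t * k t))) => //.
      move=> t _; apply: cvg_near_cst.
      by apply: filterS (truncf_eq u t) => n ->.
    move=> t _; rewrite !abse_EFin lee_fin (le_trans (bP t))// ler_norm//.
  by move: h; rewrite -[X in _ --> X](fineK hfin) => /fine_cvgP [].
have kRe := key (@Re R) (fun n => (mT n).1) (fun t => (kernel_le u xi t).1) erefl.
have kIm := key (@Im R) (fun n => (mT n).2) (fun t => (kernel_le u xi t).2) erefl.
have sE (v : R -> R[i]) : sqmod (fourierL1 v xi) = (2 * pi)^-1 *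
  ((\int[leb]_t Re (v t * k t)) * (\int[leb]_t Re (v t * k t)) +
   (\int[leb]_t Im (v t * k t)) * (\int[leb]_t Im (v t * k t))).
  by rewrite fourierL1E sqmodM sqmod_fourier_cst /cintegral {1}/sqmod /= !expr2.
rewrite sE; under eq_fun do rewrite sE.
apply: cvgM; first exact: cvg_cst.
by apply: cvgD; apply: cvgM.
Qed.

(** Fatou's lemma: the transforms of the truncations converge pointwise, and their norms, known from
    the case of bounded support, do not exceed that of [u]. *)
Lemma plancherel_le u : inL1 u -> inL2 u -> (L2normsq (fourierL1 u) <= L2normsq u)%E.
Proof.
move=> u1 u2.
have -> : L2normsq (fourierL1 u) =
    (\int[leb]_x limn_einf (fun n => (sqmod (fourierL1 (truncf n u) x))%:E))%E.
  apply: eq_integral => x _.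
  have : (sqmod (fourierL1 (truncf n u) x))%:E @[n --> \oo] --> (sqmod (fourierL1 u x))%:E.
    apply: cvg_EFin; first exact: nearW.
    exact: fourierL1_truncf_cvg.
  by move/cvg_limn_einf_sup => [-> _].
have h := @fatou _ _ R leb setT measurableT
  (fun n x => (sqmod (fourierL1 (truncf n u) x))%:E).
apply: le_trans (h _ _) _.
- by move=> n; apply: measurable_esqmod; apply: cmeas_fourierL1; exact: inL1_truncf.
- by move=> n x _; rewrite lee_fin sqmod_ge0.
apply: limn_einf_le => n.
rewrite -/(L2normsq _) (@plancherel_itv n.+1%:R _ _ (inL2_truncf n u2) _).2//.
  exact: truncf_le.
exact: truncf_supp.
Qed.

Lemma fourierL1_inL2 u : inL1 u -> inL2 u -> inL2 (fourierL1 u).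
Proof.
move=> u1 u2; split; first exact: cmeas_fourierL1.
by apply: le_lt_trans (plancherel_le u1 u2) _; case: u2.
Qed.

(** The inequality, applied to [u] minus its truncations, upgrades pointwise convergence of the
    transforms to convergence in norm, and the equality known for truncations passes to the
    limit. *)
Lemma plancherel u : inL1 u -> inL2 u -> nrm2 (fourierL1 u) = nrm2 u.
Proof.
move=> u1 u2; have h2 := fourierL1_inL2 u1 u2.
have v1 n := inL1B u1 (inL1_truncf n u2); have v2 n := inL2B u2 (inL2_truncf n u2).
have t2 n := inL2_truncf n u2; have t1 n := inL1_truncf n u2.
have tn n : nrm2 (fourierL1 (truncf n u)) = nrm2 (truncf n u).
  by rewrite /nrm2 (@plancherel_itv n.+1%:R _ _ (t2 n) _).2//; exact: truncf_supp.
have d2 : nrm2 (fun x => fourierL1 u x - fourierL1 (truncf n u) x) @[n --> \oo] --> (0 : R).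
  apply: (@squeeze_cvgr _ _ _ _ (fun=> 0) (fun n => nrm2 (fun x => u x - truncf n u x))).
  - apply: nearW => n; rewrite nrm2_ge0 /=.
    rewrite (_ : (fun x => _ - _) = fourierL1 (fun x => u x - truncf n u x)); last first.
      by apply/funext => x; rewrite fourierL1B.
    have := plancherel_le (v1 n) (v2 n).
    by rewrite (L2normsqE (fourierL1_inL2 (v1 n) (v2 n))) (L2normsqE (v2 n)) lee_fin.
  - exact: cvg_cst.
  - exact: truncf_cvg.
have f2 n := fourierL1_inL2 (t1 n) (t2 n).
apply/eqP; rewrite eq_le; apply/andP; split.
  by apply: (nrm2_le_lim h2 u2 f2 t2 d2 (truncf_cvg u2)) => n; rewrite tn.
by apply: (nrm2_le_lim u2 h2 t2 f2 (truncf_cvg u2) d2) => n; rewrite tn.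
Qed.

End PlancherelL1L2.

(** * The Fourier transform of square-integrable functions *)

Section FourierL2.
Context {R : realType}.
Implicit Types (f g u v : R -> R[i]).

Lemma L2normsq_cvg0 (w : nat -> R -> R[i]) : (forall n, inL2 (w n)) ->
  (L2normsq (w n) @[n --> \oo] --> 0%E) <-> (nrm2 (w n) @[n --> \oo] --> (0 : R)).
Proof.
move=> w2; split => [/fine_cvgP[_ //]|h].
have -> : (fun n => L2normsq (w n)) = (fun n => (nrm2 (w n))%:E).
  by apply/funext => n; exact: L2normsqE.
by apply: cvg_EFin => //; exact: nearW.
Qed.

Lemma is_fourierP f g : is_fourier f g <-> [/\ inL2 f, inL2 g &
  exists u : nat -> R -> R[i], [/\ forall n, inL1 (u n), forall n, inL2 (u n),
    nrm2 (fun x => f x - u n x) @[n --> \oo] --> (0 : R) &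
    nrm2 (fun x => g x - fourierL1 (u n) x) @[n --> \oo] --> (0 : R)]].
Proof.
split => -[f2 g2 [u]].
  move=> [u12 uf ug]; split => //; exists u.
  have u1 n := (u12 n).1; have u2 n := (u12 n).2.
  split => //.
    under eq_fun do rewrite nrm2BC.
    by apply/L2normsq_cvg0 => // n; exact: inL2B.
  under eq_fun do rewrite nrm2BC.
  by apply/L2normsq_cvg0 => // n; apply: inL2B => //; exact: fourierL1_inL2.
move=> [u1 u2 uf ug]; split => //; exists u; split => //.
  apply/L2normsq_cvg0 => [n|]; first exact: inL2B.
  by under eq_fun do rewrite nrm2BC.
apply/L2normsq_cvg0 => [n|]; first by apply: inL2B => //; exact: fourierL1_inL2.
by under eq_fun do rewrite nrm2BC.
Qed.

Lemma is_fourier_nrm2 f g : is_fourier f g -> nrm2 f = nrm2 g.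
Proof.
move=> /is_fourierP[f2 g2 [u [u1 u2 uf ug]]].
have v2 n := fourierL1_inL2 (u1 n) (u2 n).
apply/eqP; rewrite eq_le; apply/andP; split.
  by apply: (nrm2_le_lim f2 g2 u2 v2 uf ug) => n; rewrite plancherel.
by apply: (nrm2_le_lim g2 f2 v2 u2 ug uf) => n; rewrite plancherel.
Qed.

Lemma squeeze0 (a_ b_ : nat -> R) : (forall n, 0 <= a_ n <= b_ n) ->
  b_ n @[n --> \oo] --> (0 : R) -> a_ n @[n --> \oo] --> (0 : R).
Proof.
move=> ab b0; apply: (@squeeze_cvgr _ _ _ _ (fun=> 0) b_) => //.
  by apply: nearW => n; exact: ab.
exact: cvg_cst.
Qed.

Lemma nrm2D_cvg0 (a_ b_ : nat -> R -> R[i]) : (forall n, inL2 (a_ n)) ->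
  (forall n, inL2 (b_ n)) -> nrm2 (a_ n) @[n --> \oo] --> (0 : R) ->
  nrm2 (b_ n) @[n --> \oo] --> (0 : R) ->
  nrm2 (fun x => a_ n x + b_ n x) @[n --> \oo] --> (0 : R).
Proof.
move=> a2 b2 a0 b0; apply: (@squeeze0 _ (fun n => 2 * nrm2 (a_ n) + 2 * nrm2 (b_ n))).
  by move=> n; rewrite nrm2_ge0 nrm2D_le.
have -> : (0 : R) = 2 * 0 + 2 * 0 by rewrite mulr0 addr0.
by apply: cvgD; apply: cvgM => //; exact: cvg_cst.
Qed.

Lemma nrm2Z_cvg0 c (a_ : nat -> R -> R[i]) : (forall n, inL2 (a_ n)) ->
  nrm2 (a_ n) @[n --> \oo] --> (0 : R) ->
  nrm2 (fun x => c * a_ n x) @[n --> \oo] --> (0 : R).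
Proof.
move=> a2 a0; under eq_fun do rewrite nrm2Z//.
by rewrite -(mulr0 (sqmod c)); apply: cvgM => //; exact: cvg_cst.
Qed.

Lemma is_fourierD f g f' g' : is_fourier f g -> is_fourier f' g' ->
  is_fourier (fun x => f x + f' x) (fun x => g x + g' x).
Proof.
move=> /is_fourierP[f2 g2 [u [u1 u2 uf ug]]] /is_fourierP[f2' g2' [u' [u1' u2' uf' ug']]].
have v2 n := fourierL1_inL2 (u1 n) (u2 n).
have v2' n := fourierL1_inL2 (u1' n) (u2' n).
apply/is_fourierP; split; [exact: inL2D|exact: inL2D|].
exists (fun n x => u n x + u' n x); split.
- by move=> n; exact: inL1D.
- by move=> n; exact: inL2D.
- have -> : (fun n => nrm2 (fun x => f x + f' x - (u n x + u' n x))) =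
    (fun n => nrm2 (fun x => (f x - u n x) + (f' x - u' n x))).
    by apply/funext => n; congr nrm2; apply/funext => x; ring.
  by apply: nrm2D_cvg0 => // n; exact: inL2B.
- have -> : (fun n => nrm2 (fun x => g x + g' x - fourierL1 (fun x => u n x + u' n x) x)) =
    (fun n => nrm2 (fun x => (g x - fourierL1 (u n) x) + (g' x - fourierL1 (u' n) x))).
    by apply/funext => n; congr nrm2; apply/funext => x; rewrite fourierL1D//; ring.
  by apply: nrm2D_cvg0 => // n; exact: inL2B.
Qed.

Lemma is_fourierZ c f g : is_fourier f g ->
  is_fourier (fun x => c * f x) (fun x => c * g x).
Proof.
move=> /is_fourierP[f2 g2 [u [u1 u2 uf ug]]].
have v2 n := fourierL1_inL2 (u1 n) (u2 n).
apply/is_fourierP; split; [exact: inL2Z|exact: inL2Z|].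
exists (fun n x => c * u n x); split.
- by move=> n; exact: inL1Z.
- by move=> n; exact: inL2Z.
- have -> : (fun n => nrm2 (fun x => c * f x - c * u n x)) =
    (fun n => nrm2 (fun x => c * (f x - u n x))).
    by apply/funext => n; congr nrm2; apply/funext => x; ring.
  by apply: nrm2Z_cvg0 => // n; exact: inL2B.
- have -> : (fun n => nrm2 (fun x => c * g x - fourierL1 (fun x => c * u n x) x)) =
    (fun n => nrm2 (fun x => c * (g x - fourierL1 (u n) x))).
    by apply/funext => n; congr nrm2; apply/funext => x; rewrite fourierL1Z//; ring.
  by apply: nrm2Z_cvg0 => // n; exact: inL2B.
Qed.

Lemma is_fourier_inL2l f g : is_fourier f g -> inL2 f. Proof. by case. Qed.
Lemma is_fourier_inL2r f g : is_fourier f g -> inL2 g. Proof. by case. Qed.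

Lemma is_fourierB f g f' g' : is_fourier f g -> is_fourier f' g' ->
  is_fourier (fun x => f x - f' x) (fun x => g x - g' x).
Proof.
move=> h h'; have := is_fourierD h (is_fourierZ (-1) h').
have e (k k' : R -> R[i]) : (fun x => k x + -1 * k' x) = (fun x => k x - k' x).
  by apply/funext => x; rewrite mulN1r.
by rewrite !e.
Qed.

Lemma is_fourier0 : is_fourier (fun=> 0 : R[i]) (fun=> 0 : R[i]).
Proof.
apply/is_fourierP; split; try exact: inL2_0.
exists (fun _ _ => 0); split.
- by move=> _; exact: inL1_0.
- by move=> _; exact: inL2_0.
- apply: cvg_near_cst; apply: nearW => n.
  by rewrite (_ : (fun x => _) = (fun=> 0)) ?/nrm2 ?L2normsq0//; apply/funext => x; rewrite subrr.
- apply: cvg_near_cst; apply: nearW => n.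
  rewrite (_ : (fun x => _) = (fun=> 0)) ?/nrm2 ?L2normsq0//; apply/funext => x.
  rewrite fourierL1E (_ : (fun t => _) = (fun=> 0)) ?cintegral0 ?mulr0 ?subr0//.
  by apply/funext => t; rewrite mul0r.
Qed.

Lemma is_fourier_sum (I : Type) (s : seq I) (F G : I -> R -> R[i]) :
  (forall i, is_fourier (F i) (G i)) ->
  is_fourier (fun x => \sum_(i <- s) F i x) (fun x => \sum_(i <- s) G i x).
Proof.
move=> h; elim: s => [|i s IH].
  by under eq_fun do rewrite big_nil; under [X in is_fourier _ X]eq_fun do rewrite big_nil;
    exact: is_fourier0.
under eq_fun do rewrite big_cons; under [X in is_fourier _ X]eq_fun do rewrite big_cons.
exact: is_fourierD.
Qed.

Lemma nrm2_0 : nrm2 (fun=> 0 : R[i]) = 0.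
Proof. by rewrite /nrm2 L2normsq0. Qed.

Lemma ae_eq_nrm2 f g : inL2 f -> inL2 g -> {ae leb, forall x, f x = g x} ->
  nrm2 (fun x => f x - g x) = 0.
Proof.
move=> f2 g2 fg; rewrite -nrm2_0 /nrm2; congr fine; apply: eq_L2normsq_ae.
- exact: inL2_meas (inL2B f2 g2).
- exact: cmeas_cst.
- by apply: aeS fg => x ->; rewrite subrr.
Qed.

Lemma nrm2_sub_ae f g : inL2 f -> inL2 g -> nrm2 (fun x => f x - g x) = 0 ->
  {ae leb, forall x, f x = g x}.
Proof.
move=> f2 g2 /(nrm2_eq0 (inL2B f2 g2)); apply: aeS => x.
by move/eqP; rewrite subr_eq0 => /eqP.
Qed.

(** By linearity [g - g'] is a transform of a null function, hence has norm 0. *)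
Lemma is_fourier_uniq f g g' : is_fourier f g -> is_fourier f g' ->
  {ae leb, forall x, g x = g' x}.
Proof.
move=> h h'; apply: nrm2_sub_ae; [by case: h|by case: h'|].
rewrite -(is_fourier_nrm2 (is_fourierB h h')).
by apply: ae_eq_nrm2; [by case: h|by case: h|exact: aeT].
Qed.

Lemma is_fourier_aer f g g' : is_fourier f g -> cmeasurable g' ->
  {ae leb, forall x, g x = g' x} -> is_fourier f g'.
Proof.
move=> /is_fourierP[f2 g2 [u [u1 u2 uf ug]]] mg' gg.
have g2' : inL2 g' by apply: (inL2_ae mg' _ g2); apply: aeS gg => x ->.
apply/is_fourierP; split => //; exists u; split => //.
have -> // : (fun n => nrm2 (fun x => g' x - fourierL1 (u n) x)) =
  (fun n => nrm2 (fun x => g x - fourierL1 (u n) x)).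
apply/funext => n; rewrite /nrm2; congr fine; apply: eq_L2normsq_ae.
- by apply: cmeasB => //; exact: cmeas_fourierL1.
- by apply: cmeasB; [exact: inL2_meas|exact: cmeas_fourierL1].
- by apply: aeS gg => x ->.
Qed.

(** Polarization: the norm of a sum gives the real parts, and replacing [f'] by ['i * f'] gives the
    imaginary ones. *)
Lemma is_fourier_inner f g f' g' : is_fourier f g -> is_fourier f' g' ->
  inner f f' = inner g g'.
Proof.
move=> h h'; have [f2 g2] := (is_fourier_inL2l h, is_fourier_inL2r h).
have [f2' g2'] := (is_fourier_inL2l h', is_fourier_inL2r h').
have re k k' : is_fourier k k' -> Re (inner f k) = Re (inner g k').
  move=> hk; have := is_fourier_nrm2 (is_fourierD h hk).
  rewrite !nrm2D//; try by [exact: is_fourier_inL2l hk|exact: is_fourier_inL2r hk].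
  rewrite (is_fourier_nrm2 h) (is_fourier_nrm2 hk) => /addrI.
  by apply: mulfI; rewrite pnatr_eq0.
apply: complexP; first exact: re.
have := re _ _ (is_fourierZ 'i h').
rewrite !innerZr// !ReM !Re_conj !Im_conj /= !mul0r !sub0r !mulN1r !opprK.
by [].
Qed.

Lemma nrm2_unimodular e f : (forall x, sqmod (e x) = 1) ->
  nrm2 (fun x => e x * f x) = nrm2 f.
Proof.
by move=> e1; rewrite /nrm2 /L2normsq; under eq_integral do rewrite sqmodM e1 mul1r.
Qed.

Lemma is_fourier_tau b f g : is_fourier f g ->
  is_fourier (tau b f) (fun xi => expi (b * xi) * g xi).
Proof.
move=> /is_fourierP[f2 g2 [u [u1 u2 uf ug]]].
have v2 n := fourierL1_inL2 (u1 n) (u2 n).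
have E2 k : inL2 k -> inL2 (fun xi => expi (b * xi) * k xi).
  move=> k2; apply: (inL2_bnd (M := 1)) => //; first exact: cmeas_expi_lin.
  by move=> x; rewrite sqmod_expi.
apply/is_fourierP; split; [exact: inL2_tau|exact: E2|].
exists (fun n => tau b (u n)); split.
- by move=> n; exact: inL1_tau.
- by move=> n; exact: inL2_tau.
- have -> // : (fun n => nrm2 (fun x => tau b f x - tau b (u n) x)) =
    (fun n => nrm2 (fun x => f x - u n x)).
  apply/funext => n; rewrite /nrm2; congr fine.
  exact: (L2normsq_tau b (inL2_meas (inL2B f2 (u2 n)))).
- have -> // : (fun n => nrm2 (fun x => expi (b * x) * g x - fourierL1 (tau b (u n)) x)) =
    (fun n => nrm2 (fun x => g x - fourierL1 (u n) x)).
  apply/funext => n.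
  rewrite -(@nrm2_unimodular (fun x => expi (b * x)) (fun x => g x - fourierL1 (u n) x)).
    by apply: congr1; apply/funext => x; rewrite fourierL1_tau// mulrBr.
  by move=> x; exact: sqmod_expi.
Qed.

End FourierL2.

(** * The multiplication formula and surjectivity *)

Section FourierSurjective.
Context {R : realType}.
Implicit Types (f g u v w : R -> R[i]).

Lemma Rintegral_fubini (G : R * R -> R) (p q : R -> R) :
  measurable_fun [set: measurableTypeR R * measurableTypeR R] G ->
  leb.-integrable [set: R] (EFin \o p) -> leb.-integrable [set: R] (EFin \o q) ->
  (forall t x, `|G (t, x)| <= p t * q x) -> (forall x, 0 <= p x) -> (forall x, 0 <= q x) ->
  \int[leb]_x (\int[leb]_t G (t, x)) = \int[leb]_t (\int[leb]_x G (t, x)).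
Proof.
move=> mG ip iq Gpq p0 q0.
have mGt t : measurable_fun [set: R] (fun x => G (t, x)) by exact: measurable_fun_pair2.
have mGx x : measurable_fun [set: R] (fun t => G (t, x)) by exact: measurable_fun_pair1.
have mp := measurable_int _ ip; have mq := measurable_int _ iq.
have iZp c : leb.-integrable [set: R] (fun t => (p t * c)%:E).
  by under eq_fun do rewrite mulrC EFinM; exact: integrableZl.
have iZq c : leb.-integrable [set: R] (fun t => (c * q t)%:E).
  by under eq_fun do rewrite EFinM; exact: integrableZl.
have iGt t : leb.-integrable [set: R] (fun x => (G (t, x))%:E).
  apply: (le_integrable _ _ _ (iZq (p t))) => //; first by apply/measurable_EFinP; exact: mGt.
  by move=> x _; rewrite /= lee_fin (le_trans (Gpq t x))// ler_norm.
have iGx x : leb.-integrable [set: R] (fun t => (G (t, x))%:E).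
  apply: (le_integrable _ _ _ (iZp (q x))) => //; first by apply/measurable_EFinP; exact: mGx.
  by move=> t _; rewrite /= lee_fin (le_trans (Gpq t x))// ler_norm.
have iG : (@lebesgue_measure R \x @lebesgue_measure R)%E.-integrable setT (EFin \o G).
  apply/integrable12ltyP; first by apply/measurable_EFinP.
  have qE : (\int[leb]_x (q x)%:E)%E = (\int[leb]_x q x)%:E.
    by rewrite /Rintegral fineK//; exact: integrable_fin_num.
  have qi0 : 0 <= \int[leb]_x q x by apply: Rintegral_ge0 => x _; exact: q0.
  apply: (@le_lt_trans _ _ (\int[leb]_t (p t * \int[leb]_x q x)%:E)%E); last first.
    have /integrableP[_] := iZp (\int[leb]_x q x); apply: le_lt_trans.
    rewrite le_eqVlt; apply/orP; left; apply/eqP; apply: eq_integral => t _.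
    by rewrite abse_EFin ger0_norm// mulr_ge0.
  have mabs : measurable_fun [set: measurableTypeR R * measurableTypeR R] (fun z => `|(G z)%:E|%E).
    by apply: measurableT_comp => //; exact/measurable_EFinP.
  apply: ge0_le_integral => //.
  - by move=> t _; apply: integral_ge0.
  - exact: (measurable_fun_fubini_tonelli_F (m2 := @lebesgue_measure R)
      (fun z => `|(G z)%:E|%E) mabs).
  - exact: measurable_int (iZp _).
  - move=> t _; rewrite EFinM -qE -ge0_integralZl_EFin//; last by move=> x _; rewrite lee_fin.
    apply: ge0_le_integral => //.
    + by apply: measurableT_comp => //; apply/measurable_EFinP; exact: mGt.
    + by apply: measurable_funeM.
    + by move=> x _; rewrite /= lee_fin; exact: Gpq.
have := Fubini iG => h.
rewrite /Rintegral; congr fine.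
transitivity (\int[leb]_x \int[leb]_t (G (t, x))%:E)%E.
  by apply: eq_integral => x _; rewrite fineK//; exact: integrable_fin_num.
transitivity (\int[leb]_t \int[leb]_x (G (t, x))%:E)%E; first exact/esym.
by apply: eq_integral => x _; rewrite fineK//; exact: integrable_fin_num.
Qed.

Definition norm1 (z : R[i]) : R := `|Re z| + `|Im z|.

Lemma norm1M (z z' : R[i]) : `|Re (z * z')| <= norm1 z * norm1 z' /\
  `|Im (z * z')| <= norm1 z * norm1 z'.
Proof.
rewrite ReM ImM /norm1; split.
  rewrite (le_trans (ler_normB _ _))// !normrM.
  have := mulr_ge0 (normr_ge0 (Re z)) (normr_ge0 (Im z')).
  have := mulr_ge0 (normr_ge0 (Im z)) (normr_ge0 (Re z')); lra.
rewrite (le_trans (ler_normD _ _))// !normrM.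
have := mulr_ge0 (normr_ge0 (Re z)) (normr_ge0 (Re z')).
have := mulr_ge0 (normr_ge0 (Im z)) (normr_ge0 (Im z')); lra.
Qed.

Lemma measurable_comp_fst (k : R -> R) : measurable_fun [set: R] k ->
  measurable_fun [set: measurableTypeR R * measurableTypeR R] (fun z => k z.1).
Proof. by move=> mk; apply: measurableT_comp mk _; exact: measurable_fst. Qed.

Lemma measurable_comp_snd (k : R -> R) : measurable_fun [set: R] k ->
  measurable_fun [set: measurableTypeR R * measurableTypeR R] (fun z => k z.2).
Proof. by move=> mk; apply: measurableT_comp mk _; exact: measurable_snd. Qed.

Lemma fourier_mult v w : inL1 v -> inL1 w ->
  cintegral (fun xi => fourierL1 v xi * w xi) = cintegral (fun t => v t * fourierL1 w t).
Proof.
move=> v1 w1.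
(* With the normalizing constant absorbed in [v], both sides are iterated integrals of the same
   kernel [K]. *)
pose vc t := fourier_cst * v t.
have vc1 : inL1 vc by exact: inL1Z.
have [mv1 mv2] := inL1_meas vc1; have [mw1 mw2] := inL1_meas w1.
pose K (t xi : R) : R[i] := vc t * w xi * expi (- (t * xi)).
have Kxi xi : inL1 (fun t => K t xi).
  have := inL1Z (w xi) (inL1_kernel xi vc1).
  by congr inL1; apply/funext => t; rewrite /K; ring.
have Kt t : inL1 (fun xi => K t xi).
  have := inL1Z (vc t) (inL1_kernel t w1).
  by congr inL1; apply/funext => xi; rewrite /K (mulrC t); ring.
have lE xi : fourierL1 v xi * w xi = cintegral (fun t => K t xi).
  rewrite mulrC fourierL1E -cintegralZ; last exact: inL1_kernel.
  rewrite -cintegralZ; last by apply: inL1Z; exact: inL1_kernel.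
  by congr cintegral; apply/funext => t; rewrite /K /vc; ring.
have rE t : v t * fourierL1 w t = cintegral (fun xi => K t xi).
  rewrite fourierL1E mulrA [v t * _]mulrC -cintegralZ; last exact: inL1_kernel.
  by congr cintegral; apply/funext => xi; rewrite /K /vc [xi * t]mulrC; ring.
have mfst (k : R -> R) := @measurable_comp_fst k.
have msnd (k : R -> R) := @measurable_comp_snd k.
have mprod : measurable_fun [set: measurableTypeR R * measurableTypeR R] (fun z => - (z.1 * z.2)).
  by apply: measurable_funN; apply: measurable_funM; [exact: measurable_fst|exact: measurable_snd].
have mcos : measurable_fun [set: measurableTypeR R * measurableTypeR R] (fun z => cos (- (z.1 * z.2))).
  by apply: (measurableT_comp _ mprod); apply: continuous_measurable_fun; exact: continuous_cos.
have msin : measurable_fun [set: measurableTypeR R * measurableTypeR R] (fun z => sin (- (z.1 * z.2))).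
  by apply: (measurableT_comp _ mprod); apply: continuous_measurable_fun; exact: continuous_sin.
have [mv1' mw1'] := (mfst _ mv1, msnd _ mw1).
have [mv2' mw2'] := (mfst _ mv2, msnd _ mw2).
have mP : measurable_fun [set: measurableTypeR R * measurableTypeR R] (fun z => Re (vc z.1 * w z.2)).
  under eq_fun do rewrite ReM.
  by apply: measurable_funB; apply: measurable_funM;
    [exact: mv1'|exact: mw1'|exact: mv2'|exact: mw2'].
have mQ : measurable_fun [set: measurableTypeR R * measurableTypeR R] (fun z => Im (vc z.1 * w z.2)).
  under eq_fun do rewrite ImM.
  by apply: measurable_funD; apply: measurable_funM;
    [exact: mv1'|exact: mw2'|exact: mv2'|exact: mw1'].
have mRe : measurable_fun [set: measurableTypeR R * measurableTypeR R] (fun z => Re (K z.1 z.2)).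
  under eq_fun do rewrite /K ReM.
  by apply: measurable_funB; apply: measurable_funM;
    [exact: mP|exact: mcos|exact: mQ|exact: msin].
have mIm : measurable_fun [set: measurableTypeR R * measurableTypeR R] (fun z => Im (K z.1 z.2)).
  under eq_fun do rewrite /K ImM.
  by apply: measurable_funD; apply: measurable_funM;
    [exact: mP|exact: msin|exact: mQ|exact: mcos].
have n0 z : 0 <= norm1 z by rewrite addr_ge0.
have inorm k : inL1 k -> leb.-integrable [set: R] (EFin \o (fun x => norm1 (k x))).
  by move=> k1; exact: inL1_int_sqrt.
have Kle t xi : `|Re (K t xi)| <= norm1 (vc t) * (2 * norm1 (w xi)) /\
                `|Im (K t xi)| <= norm1 (vc t) * (2 * norm1 (w xi)).
  have -> : K t xi = vc t * (w xi * expi (- (t * xi))) by rewrite /K mulrA.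
  have [h1 h2] := norm1M (vc t) (w xi * expi (- (t * xi))).
  (* [kernel_le] bounds the real and the imaginary part separately by [norm1 (w xi)], whence the
     factor 2. *)
  have sm : norm1 (w xi * expi (- (t * xi))) <= 2 * norm1 (w xi).
    rewrite [t * xi]mulrC; have [h3 h4] := kernel_le w t xi.
    by rewrite {1}/norm1 mulr_natl mulr2n lerD.
  have sm2 := ler_wpM2l (n0 (vc t)) sm.
  by split; [exact: le_trans h1 sm2|exact: le_trans h2 sm2].
have iq : leb.-integrable [set: R] (EFin \o (fun x => 2 * norm1 (w x))).
  have := inorm _ w1 => h; have := @integrableZl _ _ _ leb setT measurableT 2 _ h.
  by apply: eq_integrable.
have q0 x : 0 <= 2 * norm1 (w x) by rewrite mulr_ge0.
apply: complexP; rewrite /cintegral /=.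
  under eq_Rintegral do rewrite lE.
  under [RHS]eq_Rintegral do rewrite rE.
  exact: (Rintegral_fubini mRe (inorm _ vc1) iq (fun t x => (Kle t x).1)).
under eq_Rintegral do rewrite lE.
under [RHS]eq_Rintegral do rewrite rE.
exact: (Rintegral_fubini mIm (inorm _ vc1) iq (fun t x => (Kle t x).2)).
Qed.

(* [f] is the conjugate of the transform of [conj g]. For its truncations [f_n],
   the multiplication formula gives [<f_n^, g> = <f_n, f>], hence
   [|g - f_n^| = |f - f_n|]. *)
Lemma is_fourier_surj g : inL1 g -> inL2 g -> exists f, is_fourier f g.
Proof.
move=> g1 g2.
pose gc x := Num.conj (g x).
have gc1 : inL1 gc by exact: inL1_conj. have gc2 : inL2 gc by exact: inL2_conj.
have h2 := fourierL1_inL2 gc1 gc2.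
pose f t := Num.conj (fourierL1 gc t).
have f2 : inL2 f by exact: inL2_conj.
have conjN k : inL2 k -> nrm2 (fun x => Num.conj (k x)) = nrm2 k.
  by move=> k2; rewrite /nrm2 /L2normsq; under eq_integral do rewrite sqmod_conj.
have fg : nrm2 f = nrm2 g by rewrite conjN// plancherel// conjN.
have t2 n := inL2_truncf n f2; have t1 n := inL1_truncf n f2.
have F2 n := fourierL1_inL2 (t1 n) (t2 n).
exists f; apply/is_fourierP; split => //; exists (fun n => truncf n f); split => //.
  exact: truncf_cvg.
have innE n : inner (fourierL1 (truncf n f)) g = inner (truncf n f) f.
  rewrite /inner -/gc (fourier_mult (t1 n) gc1).
  by congr cintegral; apply/funext => t; rewrite /f conjCK.
have innf n : inner (truncf n f) f = inner (truncf n f) (truncf n f).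
  rewrite /inner; congr cintegral; apply/funext => t; rewrite /truncf indicE.
  by case: (_ \in _) => /=; rewrite ?mul1r ?mul0r.
have E n : nrm2 (fun x => g x - fourierL1 (truncf n f) x) =
    nrm2 (fun x => f x - truncf n f x).
  rewrite (nrm2B g2 (F2 n)) (nrm2B f2 (t2 n)) (plancherel (t1 n) (t2 n)) fg; congr (_ - _); congr (_ * _).
  by rewrite (innerC (F2 n) g2) (innerC (t2 n) f2) !Re_conj innE.
by under eq_fun do rewrite E; exact: truncf_cvg.
Qed.

End FourierSurjective.

Local Open Scope sesquilinear_scope.

(** * Cross products and Gram determinants *)

Section CrossProduct.
Context {R : realType}.

Lemma conj_real (x : R) : Num.conj x%:C = x%:C :> R[i].
Proof. by rewrite conjE oppr0. Qed.

(** Up to sign, the cross product of the rows of [A] other than [i0]. It is the vector that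
    represents the determinant as a linear form in row [i0]. *)
Definition cofrow (n : nat) (A : 'M[R[i]]_n.+1) (i0 : 'I_n.+1) : 'rV[R[i]]_n.+1 :=
  \row_j cofactor A i0 j.

Definition setrow (n m : nat) (A : 'M[R[i]]_(n, m)) (i0 : 'I_n) (r : 'rV[R[i]]_m) :
  'M[R[i]]_(n, m) := \matrix_(i, j) if i == i0 then r 0 j else A i j.

Lemma det_setrow n (A : 'M[R[i]]_n.+1) i0 (r : 'rV[R[i]]_n.+1) :
  \det (setrow A i0 r) = \sum_j r 0 j * cofrow A i0 0 j.
Proof.
rewrite (expand_det_row _ i0); apply: eq_bigr => j _; rewrite !mxE eqxx.
congr (_ * (_ * \det _)); apply/matrixP => i k; rewrite !mxE.
by rewrite eq_sym (negbTE (neq_lift _ _)).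
Qed.

(** The cross product has its variable row on top, while in [A] it stands at [i0]; moving it there
    costs the sign [(-1)^i0]. *)
Lemma cross_cofrow n (A : 'M[R[i]]_n.+1) (i0 : 'I_n.+1) (s : seq 'rV[R[i]]_n.+1) :
  (forall k : 'I_n, nth 0 s k = row (lift i0 k) A) ->
  cross s = (-1) ^+ i0 *: cofrow A i0.
Proof.
move=> hs; apply/rowP => j; rewrite !mxE.
rewrite (expand_det_row _ ord0) (bigD1 j)//= big1 ?addr0; last first.
  by move=> k kj; rewrite !mxE (negbTE kj) andbF mul0r.
rewrite !mxE !eqxx mul1r /cofactor add0n.
rewrite exprD mulrA mulrA -expr2 sqrr_sign mul1r; congr (_ * \det _).
by apply/matrixP => i k; rewrite !mxE /= hs !mxE.
Qed.

Lemma ct_mxE n m (A : 'M[R[i]]_(n, m)) i j : (A ^t*) i j = Num.conj (A j i).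
Proof. by rewrite !mxE. Qed.

Lemma ct_gramE n m (A : 'M[R[i]]_(n, m)) i k :
  (A *m A ^t*) i k = \sum_j A i j * Num.conj (A k j).
Proof. by rewrite mxE; apply: eq_bigr => j _; rewrite ct_mxE. Qed.

Lemma ct_mul n m p (A : 'M[R[i]]_(n, m)) (B : 'M[R[i]]_(m, p)) :
  (A *m B) ^t* = B ^t* *m A ^t*.
Proof. by rewrite trmx_mul map_mxM. Qed.

Lemma det_ct n (A : 'M[R[i]]_n) : \det (A ^t*) = Num.conj (\det A).
Proof. by rewrite det_map_mx det_tr. Qed.

Definition rnorm n m (A : 'M[R[i]]_(n, m)) : R := \sum_i \sum_j sqmod (A i j).

Lemma rnorm_ge0 n m (A : 'M[R[i]]_(n, m)) : 0 <= rnorm A.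
Proof. by apply: sumr_ge0 => i _; apply: sumr_ge0 => j _; exact: sqmod_ge0. Qed.

Lemma rnorm_row m (v : 'rV[R[i]]_m) : rnorm v = \sum_j sqmod (v 0 j).
Proof. by rewrite /rnorm big_ord1. Qed.

Lemma mul_conj_row m (v : 'rV[R[i]]_m) :
  \sum_j v 0 j * Num.conj (v 0 j) = (rnorm v)%:C.
Proof.
rewrite rnorm_row rmorph_sum; apply: eq_bigr => j _; exact: mul_conj.
Qed.

Lemma cofrow_orth n (A : 'M[R[i]]_n.+1) i0 i : i != i0 ->
  \sum_j A i j * cofrow A i0 0 j = 0.
Proof.
move=> ne; rewrite -[LHS]/(_) .
have := congr1 (fun M : 'M[R[i]]_n.+1 => M i i0) (mul_mx_adj A).
rewrite !mxE (negbTE ne) mulr0n => h; rewrite -[RHS]h.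
by apply: eq_bigr => j _; rewrite !mxE.
Qed.

Definition unit_proj n (i0 : 'I_n) : 'M[R[i]]_n := delta_mx i0 i0.

Lemma unit_proj_mul n (i0 : 'I_n.+1) (J : 'M[R[i]]_n.+1) : (forall j, J i0 j = 0) ->
  unit_proj i0 *m J = 0.
Proof.
move=> J0; apply/matrixP => i j; rewrite !mxE big1// => k _; rewrite !mxE.
by case: (k =P i0) => [->|_]; rewrite ?J0 ?mulr0// andbF mul0r.
Qed.

Lemma unit_proj_idem n (i0 : 'I_n) : unit_proj i0 *m unit_proj i0 = unit_proj i0.
Proof. by rewrite /unit_proj mul_delta_mx. Qed.

Lemma unit_proj_ct n (i0 : 'I_n) : (unit_proj i0) ^t* = unit_proj i0.
Proof.
apply/matrixP => i j; rewrite !mxE andbC.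
by case: (_ && _); rewrite ?rmorph1 ?rmorph0.
Qed.

(** Let [M] be [J] with the conjugate of its cofactor row [W] in the zero row. Then [det M = |W|^2],
    and [M M^t*] is the left-hand matrix with its row [i0] scaled by [|W|^2], because [W] is
    orthogonal to the other rows. Taking determinants, [|W|^2] times the left side is [|W|^4]. The
    disjunction sets apart [W = 0], where one cannot divide. *)
Lemma det_gram_proj n (i0 : 'I_n.+1) (J : 'M[R[i]]_n.+1) : (forall j, J i0 j = 0) ->
  \det (J *m J ^t* + unit_proj i0) = (rnorm (cofrow J i0))%:C \/ rnorm (cofrow J i0) = 0.
Proof.
move=> J0; have [->|w0] := eqVneq (rnorm (cofrow J i0)) 0; first by right.
left; set w := rnorm _ in w0 *; set W := cofrow J i0.
pose Wb := map_mx Num.conj W; pose M := setrow J i0 Wb.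
have WbE j : Wb 0 j = Num.conj (W 0 j) by rewrite mxE.
have detM : \det M = w%:C.
  rewrite det_setrow -/W -(mul_conj_row W); apply: eq_bigr => j _.
  by rewrite WbE mulrC.
have P2 := unit_proj_idem i0; have PJ := unit_proj_mul J0.
have MM : M *m M ^t* = J *m J ^t* + w%:C *: unit_proj i0.
  apply/matrixP => i k.
  rewrite [RHS]mxE !ct_gramE.
  have -> : (w%:C *: unit_proj i0) i k = w%:C * ((i == i0) && (k == i0))%:R by rewrite !mxE.
  have Mi0 j : M i0 j = Num.conj (W 0 j) by rewrite -WbE [LHS]mxE eqxx.
  have Mi i' j : i' != i0 -> M i' j = J i' j by move=> ne; rewrite /M mxE (negbTE ne).
  have [->|ii0] := eqVneq i i0; have [->|ki0] := eqVneq k i0 => /=.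
  - rewrite mulr1 [X in _ = X + _]big1 ?add0r => [|j _]; last by rewrite J0 mul0r.
    rewrite -(mul_conj_row W); apply: eq_bigr => j _.
    by rewrite Mi0 conjCK mulrC.
  - rewrite mulr0 addr0 [RHS]big1 => [|j _]; last by rewrite J0 mul0r.
    transitivity (Num.conj (\sum_j J k j * W 0 j)); last by rewrite cofrow_orth// rmorph0.
    rewrite rmorph_sum; apply: eq_bigr => j _.
    by rewrite Mi0 (Mi k)// rmorphM /= mulrC.
  - rewrite mulr0 addr0 [RHS]big1 => [|j _]; last by rewrite J0 rmorph0 mulr0.
    transitivity (\sum_j J i j * W 0 j); last exact: cofrow_orth.
    apply: eq_bigr => j _.
    by rewrite Mi0 (Mi i)// conjCK.
  - by rewrite mulr0 addr0; apply: eq_bigr => j _; rewrite !Mi.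
have KE : (1%:M + (w%:C - 1) *: unit_proj i0) *m (J *m J ^t* + unit_proj i0) =
    J *m J ^t* + w%:C *: unit_proj i0.
  rewrite mulmxDl mul1mx -scalemxAl mulmxDr mulmxA PJ mul0mx add0r P2.
  by rewrite -addrA; congr (_ + _); rewrite scalerBl scale1r addrC subrK.
have dD : \det (1%:M + (w%:C - 1) *: unit_proj i0) = w%:C.
  have -> : 1%:M + (w%:C - 1) *: unit_proj i0 =
     diag_mx (\row_j if j == i0 then w%:C else 1) :> 'M[R[i]]_n.+1.
    apply/matrixP => i j; rewrite !mxE; have [->|ij] := eqVneq i j.
      by case: eqP => _ /=; rewrite ?mulr1 ?mulr0 ?addr0 ?mulr1n// addrC subrK.
    rewrite !mulr0n add0r; case: (i =P i0) => [e|_]; rewrite ?andbF ?mulr0//=.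
    by case: (j =P i0) => [e2|_]; rewrite ?mulr0//; move/eqP: ij; rewrite e e2.
  rewrite det_diag (bigD1 i0)//= mxE eqxx big1 ?mulr1// => j ji.
  by rewrite mxE (negbTE ji).
have := congr1 determinant KE; rewrite -MM !det_mulmx dD det_ct detM.
rewrite conj_real; apply: mulfI.
by apply: contra_neq w0 => /complexI.
Qed.

End CrossProduct.

(** * Minors and uniform bounds on inverses *)

Section Minors.
Context {R : realType}.

Lemma increasing_id (n : nat) (g : 'I_n -> 'I_n) :
  (forall i j : 'I_n, (i < j)%N -> (g i < g j)%N) -> forall k, g k = k.
Proof.
move=> ginc.
have lo m (hm : (m < n)%N) : (m <= g (Ordinal hm))%N.
  elim: m hm => // m IH hm.
  apply: leq_ltn_trans (IH (ltnW hm)) _; exact: ginc.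
have hi d : forall k : 'I_n, (k + d).+1 = n -> (g k <= k)%N.
  elim: d => [|d IH] k hk; first by have := ltn_ord (g k); lia.
  have hk1 : (k.+1 < n)%N by lia.
  have := IH (Ordinal hk1); rewrite /= addSnnS => /(_ hk) h.
  by rewrite -ltnS; apply: leq_trans h; exact: ginc.
move=> k; apply/val_inj/eqP; rewrite eqn_leq; apply/andP; split.
  by apply: (hi (n - k.+1)%N); rewrite -addSn subnKC.
by case: k => m hm; exact: lo.
Qed.

(** Some [i] is missed by counting; factoring [f] through [lift i] leaves an increasing self-map,
    which is the identity. *)
Lemma increasing_lift (n : nat) (f : 'I_n -> 'I_n.+1) : increasing f ->
  exists i : 'I_n.+1, forall k, f k = lift i k.
Proof.
move=> /forallP finc.
have fi (i j : 'I_n) : (i < j)%N -> (f i < f j)%N.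
  by have /forallP/(_ j)/implyP := finc i.
have finj : injective f.
  move=> i j fij; apply/val_inj/eqP; rewrite eqn_leq leqNgt [X in _ && X]leqNgt.
  by apply/andP; split; apply/negP => /fi; rewrite fij ltnn.
have [i hi] : exists i, i \notin codom f.
  apply/existsP; rewrite -negb_forall; apply/negP => /forallP h.
  have : (#|'I_n.+1| <= #|codom f|)%N by apply: subset_leq_card; apply/fintype.subsetP => x _; exact: h.
  by rewrite card_ord (card_codom finj) card_ord ltnn.
exists i.
have ne k : i != f k by apply: contraNneq hi => ->; exact: codom_f.
pose g k := if unlift i (f k) is Some j then j else k.
have gE k : f k = lift i (g k).
  by rewrite /g; case: unliftP => [j //|e]; have := ne k; rewrite e eqxx.
move=> k; rewrite gE (@increasing_id _ g)// => a b /fi.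
by rewrite !gE !ltnNge /= leq_bump2.
Qed.

Lemma sqmod_cofactor n (A : 'M[R[i]]_n.+1) i j :
  sqmod (cofactor A i j) = sqmod (\det (mxsub (lift i) (lift j) A)).
Proof.
rewrite /cofactor sqmodM; have -> : sqmod ((-1) ^+ (i + j) : R[i]) = 1.
  by rewrite -signr_odd; case: odd; rewrite ?expr0 ?expr1 ?sqmodN sqmod1.
by rewrite mul1r; congr (sqmod (\det _)); apply/matrixP => a b; rewrite !mxE.
Qed.

(** A minor that involves the zero row vanishes; the others are, up to sign, the cofactors along
    that row. This direction of the comparison transports the lower bound [sigma] to the cofactor
    row. *)
Lemma sqminors_le_cofrow n (J : 'M[R[i]]_n.+1) (i0 : 'I_n.+1) :
  (forall j, J i0 j = 0) -> sqminors n J <= rnorm (cofrow J i0).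
Proof.
move=> J0.
pose lf (i : 'I_n.+1) : {ffun 'I_n -> 'I_n.+1} := [ffun k => lift i k].
(* The index missed by [f]; the default concerns only maps that are not of the form [lift i]. *)
pose mis (f : {ffun 'I_n -> 'I_n.+1}) : 'I_n.+1 :=
  odflt ord0 [pick i : 'I_n.+1 | [forall k : 'I_n, f k == lift i k]].
have misK (f : {ffun 'I_n -> 'I_n.+1}) : increasing f -> lf (mis f) = f.
  move=> /increasing_lift[i hi]; apply/ffunP => k; rewrite ffunE /mis.
  case: pickP => [i' /forallP/(_ k)/eqP <- //|/(_ i)/negP].
  by case; apply/forallP => k'; rewrite hi.
have le_lift (F : {ffun 'I_n -> 'I_n.+1} -> R) : (forall f, 0 <= F f) ->
    \sum_(f : {ffun 'I_n -> 'I_n.+1} | increasing f) F f <= \sum_i F (lf i).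
  move=> F0; rewrite (reindex_onto lf mis misK) /= big_mkcond ler_sum// => i _.
  by case: ifP.
have sq0 m (A : 'M[R[i]]_m) : 0 <= sqmod (\det A) by exact: sqmod_ge0.
apply: le_trans (le_lift _ _) _ => [f|]; first by apply: sumr_ge0.
rewrite (bigD1 i0)//= [X in _ + X]big1 ?addr0; last first.
  move=> i ii0; apply: big1 => g _.
  have [k hk] : exists k : 'I_n, lift i k = i0.
    have /unlift_some[k -> _] : i != i0 by [].
    by exists k.
  rewrite (expand_det_row _ k) big1 ?sqmod0// => j _.
  by rewrite mxE ffunE hk J0 mul0r.
apply: le_trans (le_lift _ _) _ => //.
rewrite rnorm_row; apply: ler_sum => j _.
rewrite mxE sqmod_cofactor le_eqVlt; apply/orP; left; apply/eqP.
by congr (sqmod (\det _)); apply/matrixP => a b; rewrite !mxE !ffunE.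
Qed.

Lemma sqmod_sum_fin (I : finType) (F : I -> R[i]) :
  sqmod (\sum_i F i) <= #|I|%:R * \sum_i sqmod (F i).
Proof.
rewrite !(@big_enum_val _ _ _ I predT) /=.
exact: sqmod_sum_le.
Qed.

Lemma sqmod_prod (I : Type) (s : seq I) (F : I -> R[i]) :
  sqmod (\prod_(i <- s) F i) = \prod_(i <- s) sqmod (F i).
Proof. by elim/big_rec2: _ => [|i a b _ <-]; rewrite ?sqmod1 ?sqmodM. Qed.

(** The constant is chosen before the matrix, because the bound must be uniform over the fibres. *)
Lemma sqmod_det_le n (M : R) : 0 <= M -> exists2 C, 0 <= C &
  forall A : 'M[R[i]]_n, (forall i j, sqmod (A i j) <= M) -> sqmod (\det A) <= C.
Proof.
move=> M0; exists (#|{: 'S_n}|%:R * \sum_(s : {perm 'I_n}) M ^+ n).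
  by rewrite mulr_ge0// sumr_ge0// => s _; rewrite exprn_ge0.
move=> A hA; apply: le_trans (sqmod_sum_fin _) _.
rewrite ler_wpM2l// ler_sum// => s _.
rewrite sqmodM; have -> : sqmod ((-1) ^+ s : R[i]) = 1.
  by case: (s : bool); rewrite ?expr0 ?expr1 ?sqmodN sqmod1.
rewrite mul1r sqmod_prod -[n in M ^+ n]card_ord -prodr_const.
by apply: ler_prod => i _; rewrite sqmod_ge0 hA.
Qed.

(** Cramer's rule, again with a constant uniform in the matrix: it yields both the lower frame bound
    and the square integrability of the dual generators. *)
Lemma sqmod_invmx_le n (M c : R) : 0 <= M -> 0 < c -> exists2 C, 0 <= C &
  forall A : 'M[R[i]]_n, (forall i j, sqmod (A i j) <= M) -> c <= sqmod (\det A) ->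
    forall i j, sqmod (invmx A i j) <= C.
Proof.
move=> M0 c0; have [C C0 hC] := @sqmod_det_le n.-1 M M0.
exists (c^-1 * C); first by rewrite mulr_ge0// invr_ge0 ltW.
move=> A hA dA i j.
have d0 : 0 < sqmod (\det A) by exact: lt_le_trans dA.
have uA : A \in unitmx.
  by rewrite unitmxE unitfE; apply: contraTneq d0 => ->; rewrite sqmod0 ltxx.
rewrite /invmx uA mxE sqmodM sqmodV; apply: ler_pM.
- by rewrite invr_ge0 sqmod_ge0.
- exact: sqmod_ge0.
- by rewrite lef_pV2.
rewrite mxE /cofactor sqmodM; have -> : sqmod ((-1) ^+ (j + i) : R[i]) = 1.
  by rewrite -signr_odd; case: odd; rewrite ?expr0 ?expr1 ?sqmodN sqmod1.
by rewrite mul1r; apply: hC => a b; rewrite !mxE.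
Qed.

Lemma rnorm_mul n m (v : 'rV[R[i]]_n) (A : 'M[R[i]]_(n, m)) (M : R) :
  (forall i j, sqmod (A i j) <= M) ->
  rnorm (v *m A) <= (n%:R * m%:R * M) * rnorm v.
Proof.
move=> hA; rewrite !rnorm_row.
apply: (@le_trans _ _ (\sum_(j < m) (n%:R * M * \sum_j sqmod (v 0 j)))).
  apply: ler_sum => j _; rewrite mxE; apply: le_trans (sqmod_sum_le _) _.
  rewrite -mulrA ler_wpM2l// mulr_sumr ler_sum// => i _.
  by rewrite sqmodM mulrC ler_wpM2r// sqmod_ge0.
rewrite sumr_const card_ord -mulr_natl.
by rewrite le_eqVlt; apply/orP; left; apply/eqP; ring.
Qed.

End Minors.

(** * Rows of the dual pre-Gramian as cross products *)

Section DualRows.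
Context {R : realType} (n : nat) (U Psi : 'M[R[i]]_n.+1) (h : R).
Hypothesis h_gt0 : 0 < h.
Let s : R[i] := (Num.sqrt h)%:C.
Let J : 'M[R[i]]_n.+1 := s *: U.
Let Q : 'M[R[i]]_n.+1 := s *: Psi.
Let Uc : 'M[R[i]]_n.+1 := map_mx Num.conj U.

Lemma sqrt_real_neq0 : s != 0.
Proof.
rewrite /s -(rmorph0 (real_complex R)) (inj_eq (@complexI R)).
by rewrite gt_eqF// sqrtr_gt0.
Qed.

Lemma sqrt_real_sqr : s * s = h%:C.
Proof. by rewrite -rmorphM -expr2 sqr_sqrtr// ltW. Qed.

Lemma cofrow_conj i : cofrow Uc i = map_mx Num.conj (cofrow U i).
Proof. by apply/rowP => j; rewrite !mxE cofactor_map_mx. Qed.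

(** Cancelling [J] in the equation makes [Q] the inverse of [J^t*], so Cramer's rule applies. The
    condition on [H] balances the scalings: a cofactor of [J] carries [s^n] and [Q] carries [s]. *)
Lemma dual_row_center (i : 'I_n.+1) (sl : seq 'rV[R[i]]_n.+1) (H : R[i]) :
  \det J != 0 -> J *m J ^t* *m Q = J -> s ^+ n = s * H ->
  (forall k : 'I_n, nth 0 sl k = row (lift i k) Uc) ->
  row i Psi = ((-1) ^+ i * (H * (\det (J ^t*))^-1)) *: cross sl.
Proof.
move=> dJ JQ sn hsl.
have uJ : J \in unitmx by rewrite unitmxE unitfE.
have djs : \det (J ^t*) != 0 by rewrite det_ct conjC_eq0.
have QE : (\det (J ^t*)) *: Q = \adj (J ^t*).
  have JQ1 : J ^t* *m Q = 1%:M.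
    by rewrite -[LHS](mulKmx uJ) [J *m (_ *m _)]mulmxA JQ mulVmx.
  have := congr1 (mulmx (\adj (J ^t*))) JQ1.
  by rewrite mulmxA mul_adj_mx mul_scalar_mx mulmx1.
rewrite (cross_cofrow hsl) cofrow_conj; apply/rowP => j.
have := congr1 (fun M : 'M[R[i]]_n.+1 => M i j) QE.
rewrite [LHS]mxE [Q i j]mxE [RHS]mxE cofactor_map_mx cofactor_tr cofactorZ /= => e.
have {}e : \det (J ^t*) * (s * Psi i j) = s * (H * Num.conj (cofactor U i j)).
  by rewrite [RHS]mulrA -sn e rmorphM /= rmorphXn /= [Num.conj s]conj_real.
have {}e : \det (J ^t*) * Psi i j = H * Num.conj (cofactor U i j).
  by apply: (mulfI sqrt_real_neq0); rewrite mulrCA.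
rewrite !mxE; apply: (mulfI djs); rewrite e.
have := sqrr_sign R[i] i; rewrite expr2 => s2.
move: s2 djs; move: ((-1) ^+ i) (\det (J ^t*)) (Num.conj _) => g D c s2 D0.
by rewrite -[LHS]mul1r -s2; field.
Qed.

Section ZeroRow.
Variable (i0 : 'I_n.+1).
Let P : 'M[R[i]]_n.+1 := unit_proj i0.
Let K := J *m J ^t* + P.
Let W : 'rV[R[i]]_n.+1 := (-1) ^+ i0 *: cofrow U i0.

Lemma rnorm_signed_cofrow : rnorm W = rnorm (cofrow U i0).
Proof.
rewrite !rnorm_row; apply: eq_bigr => j _; rewrite mxE sqmodM.
have -> : sqmod ((-1) ^+ i0 : R[i]) = 1.
  by rewrite -signr_odd; case: odd; rewrite ?expr0 ?expr1 ?sqmodN sqmod1.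
by rewrite mul1r.
Qed.

Lemma rnorm_cofrowZ : (rnorm (cofrow J i0))%:C = (h ^+ n)%:C * (rnorm (cofrow U i0))%:C.
Proof.
rewrite -!mul_conj_row mulr_sumr; apply: eq_bigr => j _.
rewrite ![cofrow _ _ _ _]mxE cofactorZ /= rmorphM rmorphXn /= [Num.conj s]conj_real.
have -> : (h ^+ n)%:C = s ^+ n * s ^+ n by rewrite -exprMn sqrt_real_sqr rmorphXn.
ring.
Qed.

(** The conjugates of the nonzero rows of [U] together with [W] are the rows of an invertible matrix
    [B]. It therefore suffices that [row i Psi + E C], with [C] the cross product, pairs to zero
    with each of them. *)
Lemma dual_row_side (i : 'I_n.+1) (sl : seq 'rV[R[i]]_n.+1) (E : R[i]) :
  i != i0 -> (forall j, U i0 j = 0) -> rnorm (cofrow J i0) != 0 -> K *m Q = J ->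
  (h ^+ n)%:C = h%:C * (E * \det K) ->
  (forall k : 'I_n, nth 0 sl k = if lift i0 k == i then W else row (lift i0 k) Uc) ->
  row i Psi = (- E) *: cross sl.
Proof.
move=> ii0 U0 wJ0 KQ hE hsl.
have J0 j : J i0 j = 0 by rewrite mxE U0 mulr0.
have [dKE|w0] := det_gram_proj J0; last by rewrite w0 eqxx in wJ0.
rewrite -/P -/K in dKE.
have dK : \det K != 0.
  by rewrite dKE -(rmorph0 (real_complex R)) (inj_eq (@complexI R)).
have uK : K \in unitmx by rewrite unitmxE unitfE.
have PJ : P *m J = 0 by exact: unit_proj_mul.
have JP : J ^t* *m P = 0.
  have := congr1 (fun M : 'M[R[i]]_n.+1 => M ^t*) PJ.
  by rewrite ct_mul unit_proj_ct => ->; rewrite trmx0 map_mx0.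
have KP : K *m P = P by rewrite mulmxDl -mulmxA JP mulmx0 add0r unit_proj_idem.
set w := rnorm (cofrow U i0).
have hC : h%:C != 0 :> R[i].
  by rewrite -(rmorph0 (real_complex R)) (inj_eq (@complexI R)) gt_eqF.
(* Since [det K = h^n w], the hypothesis on [E] amounts to this; it also shows that [w] is nonzero,
   hence [B] invertible. *)
have Ew : E * (h%:C * w%:C) = 1.
  have hn : (h ^+ n)%:C != 0 :> R[i] by rewrite rmorphXn expf_neq0.
  apply: (mulfI hn); rewrite mulr1 [RHS]hE dKE rnorm_cofrowZ -/w; ring.
have WW : \sum_j W 0 j * Num.conj (W 0 j) = w%:C.
  by rewrite mul_conj_row rnorm_signed_cofrow.
have WE j : W 0 j = (-1) ^+ i0 * cofrow U i0 0 j by rewrite mxE.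
have sgC : Num.conj ((-1) ^+ i0 : R[i]) = (-1) ^+ i0 by rewrite rmorph_sign.
have sg2 : (-1) ^+ i0 * (-1) ^+ i0 = 1 :> R[i] by rewrite -expr2 sqrr_sign.
pose B := setrow Uc i0 W.
have detB : \det B = (-1) ^+ i0 * w%:C.
  rewrite det_setrow cofrow_conj -WW mulr_sumr; apply: eq_bigr => j _.
  have -> : (map_mx Num.conj (cofrow U i0)) 0 j = Num.conj (cofrow U i0 0 j) by rewrite mxE.
  rewrite WE rmorphM /= sgC.
  move: sg2; move: ((-1) ^+ i0) (Num.conj _) => g c g2.
  by rewrite -[LHS]mul1r -g2; ring.
have UW m : \sum_j U m j * W 0 j = 0.
  have [->|mi0] := eqVneq m i0; first by rewrite big1// => j _; rewrite U0 mul0r.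
  transitivity ((-1) ^+ i0 * \sum_j U m j * cofrow U i0 0 j).
    by rewrite mulr_sumr; apply: eq_bigr => j _; rewrite WE mulrCA.
  by rewrite cofrow_orth// mulr0.
have PsiW m : \sum_j Psi m j * W 0 j = 0.
  have QW : Q *m W^T = 0.
    rewrite -[LHS](mulKmx uK) [K *m (_ *m _)]mulmxA KQ.
    rewrite (_ : J *m W^T = 0) ?mulmx0//; apply/colP => k; rewrite mxE.
    under eq_bigr do rewrite mxE [W^T _ _]mxE -mulrA.
    by rewrite -mulr_sumr UW mulr0 mxE.
  have := congr1 (fun M : 'cV[R[i]]_n.+1 => M m 0) QW.
  rewrite mxE [RHS]mxE; under eq_bigr do rewrite mxE [W^T _ _]mxE -mulrA.
  rewrite -mulr_sumr => /eqP; rewrite mulf_eq0 (negbTE sqrt_real_neq0) => /eqP.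
  exact.
(* Biorthogonality: [K P = P] gives [J J^t* = K (1 - P)], and cancelling [K] leaves
   [Q J^t* = 1 - P]. *)
have PsiU m : \sum_j Psi i j * Num.conj (U m j) * h%:C = (i == m)%:R.
  have QJ : Q *m J ^t* = 1%:M - P.
    rewrite -[LHS](mulKmx uK) [K *m (_ *m _)]mulmxA KQ.
    have -> : J *m J ^t* = K *m (1%:M - P).
      by rewrite mulmxBr mulmx1 KP /K addrK.
    by rewrite mulKmx.
  have := congr1 (fun M : 'M[R[i]]_n.+1 => M i m) QJ.
  rewrite mxE [RHS]mxE [X in _ = X + _]mxE [X in _ = _ + X]mxE [P i m]mxE.
  rewrite (negbTE ii0) oppr0 addr0 => <-; apply: eq_bigr => j _.
  rewrite ct_mxE !mxE rmorphM /= [Num.conj s]conj_real -sqrt_real_sqr; ring.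
pose A := setrow Uc i W.
have slA (k : 'I_n) : nth 0 sl k = row (lift i0 k) A.
  by rewrite hsl; apply/rowP => j; rewrite !mxE; case: eqP => _; rewrite !mxE.
set C := cross sl.
have CE (r : 'rV[R[i]]_n.+1) :
    \sum_j C 0 j * r 0 j = (-1) ^+ i0 * \det (setrow A i0 r).
  rewrite det_setrow mulr_sumr; apply: eq_bigr => j _.
  by rewrite /C (cross_cofrow slA) mxE; ring.
have CW : \sum_j C 0 j * W 0 j = 0.
  rewrite CE (@determinant_alternate _ _ _ i0 i) ?mulr0// 1?eq_sym// => j.
  by rewrite !mxE !eqxx (negbTE ii0).
have CU m : m != i0 -> \sum_j C 0 j * Num.conj (U m j) = - (i == m)%:R * w%:C.
  move=> mi0.
  have -> : \sum_j C 0 j * Num.conj (U m j) = \sum_j C 0 j * (row m Uc) 0 j.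
    by apply: eq_bigr => j _; rewrite !mxE.
  rewrite CE; have [<-|im] := eqVneq i m.
    (* [A] has [W] in row [i] whereas [B] has it in row [i0]. This transposition is the source of
       the minus sign in front of [E]. *)
    have -> : setrow A i0 (row i Uc) = xrow i0 i B.
      apply/matrixP => a b; rewrite [RHS]mxE.
      have [->|ai0] := eqVneq a i0.
        by rewrite tpermL [LHS]mxE eqxx mxE [RHS]mxE (negbTE ii0).
      have [->|ai] := eqVneq a i.
        by rewrite tpermR [LHS]mxE (negbTE ii0) mxE eqxx [RHS]mxE eqxx.
      by rewrite tpermD 1?eq_sym// !mxE (negbTE ai0) (negbTE ai).
    rewrite xrowE det_mulmx det_perm odd_tperm eq_sym ii0 expr1 detB.
    by rewrite mulN1r mulrN mulrA sg2 mul1r mulN1r.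
  rewrite (@determinant_alternate _ _ _ i0 m) ?mulr0 ?oppr0 ?mul0r// 1?eq_sym// => j.
  by rewrite !mxE eqxx (negbTE mi0) eq_sym (negbTE im).
pose d := row i Psi + E *: C.
have dE j : d 0 j = Psi i j + E * C 0 j by rewrite !mxE.
suff : d = 0 by move=> /eqP; rewrite addr_eq0 scaleNr => /eqP.
have dB : B *m d^T = 0.
  apply/colP => m; rewrite mxE [RHS]mxE.
  have [->|mi0] := eqVneq m i0.
    have -> : \sum_j B i0 j * d^T j 0 = \sum_j Psi i j * W 0 j + E * \sum_j C 0 j * W 0 j.
      rewrite mulr_sumr -big_split /=; apply: eq_bigr => j _.
      by rewrite mxE eqxx [d^T _ _]mxE dE; ring.
    by rewrite PsiW CW mulr0 addr0.
  apply: (mulfI hC); rewrite mulr0.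
  have -> : h%:C * \sum_j B m j * d^T j 0 = \sum_j Psi i j * Num.conj (U m j) * h%:C
       + E * h%:C * \sum_j C 0 j * Num.conj (U m j).
    rewrite !mulr_sumr -big_split /=; apply: eq_bigr => j _.
    by rewrite mxE (negbTE mi0) [d^T _ _]mxE dE mxE; ring.
  rewrite PsiU CU//.
  have -> : E * h%:C * (- (i == m)%:R * w%:C) = - (i == m)%:R * (E * (h%:C * w%:C)) by ring.
  by rewrite Ew mulr1 subrr.
have uB : B \in unitmx.
  rewrite unitmxE unitfE detB mulf_neq0 ?signr_eq0//.
  by apply: contra_eq_neq Ew => ->; rewrite !mulr0 eq_sym oner_neq0.
by apply: trmx_inj; rewrite trmx0 -[LHS](mulKmx uB) dB mulmx0.
Qed.

End ZeroRow.
End DualRows.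

(** * Fibrewise description of the frame *)

Section Windows.
Context {R : realType} (n l : nat) (h : R).
Hypothesis h_gt0 : 0 < h.
Hypothesis nl : n.+1 = (2 * l)%N.

Definition wshift (m : 'I_n.+1) : R := (m%:Z - l%:Z)%:~R * h.
Local Notation c := wshift.
Local Notation ind := (period_ind h).
Local Notation D := (`[- (l%:R * h), l%:R * h[%classic : set R).
Local Notation D0 := (`[0, h[%classic : set R).

Lemma wshiftE m : c m = (m%:R - l%:R) * h.
Proof. by rewrite /c rmorphB. Qed.

Lemma window_ex x : D x -> exists m, D0 (x - c m).
Proof.
rewrite /= in_itv/= => /andP[x1 x2].
have k0 : 0 <= Num.floor (x / h) + l%:Z.
  rewrite -lerBlDr sub0r floor_ge_int rmorphN /= ler_pdivlMr// mulNr.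
  exact: x1.
have k1 : (absz (Num.floor (x / h) + l%:Z)%R < n.+1)%N.
  have : Num.floor (x / h) < l%:Z by rewrite floor_lt_int ltr_pdivrMr.
  by rewrite nl; lia.
exists (Ordinal k1); rewrite /= in_itv/= wshiftE /=.
have -> : (absz (Num.floor (x / h) + l%:Z)%R)%:R - l%:R = (Num.floor (x / h))%:~R :> R.
  by rewrite natr_absz ger0_norm// rmorphD /= addrK.
have := floor_itv (x / h); rewrite ler_pdivlMr// ltr_pdivrMr// rmorphD /= mulrDl mul1r.
by move=> /andP[h1 h2]; lra.
Qed.

Lemma window_inj x m m' : D0 x -> D0 (x + c m - c m') -> m' = m.
Proof.
rewrite /= !in_itv/= !wshiftE => /andP[x0 x1] /andP[y0 y1].
have a1 : (m%:R - m'%:R) * h < h by lra.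
have a2 : - h < (m%:R - m'%:R) * h by lra.
have b1 : (m%:R - m'%:R : R) < 1 by rewrite -(ltr_pM2r h_gt0) mul1r.
have b2 : -1 < (m%:R - m'%:R : R) by rewrite -(ltr_pM2r h_gt0) mulN1r.
apply/val_inj => /=; apply/eqP; rewrite eqn_leq -(ltnS m' m) -(ltnS m m') -!(ltr_nat R) -!natr1.
by apply/andP; split; lra.
Qed.

Lemma window_sub x m : D0 x -> D (x + c m).
Proof.
rewrite /= !in_itv/= wshiftE => /andP[x0 x1].
have m1 : m%:R + 1 <= 2 * l%:R :> R.
  by rewrite natr1 -natrM ler_nat -nl ltn_ord.
have := ler0n R m; have := ler_wpM2r (ltW h_gt0) m1; have := mulr_ge0 (ler0n R m) (ltW h_gt0).
by move=> *; apply/andP; split; nra.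
Qed.

Lemma ind1 x : D0 x -> ind x = 1.
Proof. by move=> xD; rewrite /period_ind indicE mem_set. Qed.

Lemma ind0 x : ~ D0 x -> ind x = 0.
Proof. by move=> xD; rewrite /period_ind indicE memNset. Qed.

Lemma sum_ind x : D x -> \sum_m ind (x - c m) = 1.
Proof.
move=> /window_ex[m0 h0]; rewrite (bigD1 m0)//= ind1// big1 ?addr0// => m mm0.
apply: ind0 => hm; move/eqP: mm0; apply; apply: (window_inj h0).
by rewrite subrK.
Qed.

(** The counterpart of [periodize_integral] for a support covered by the [2l] windows: the
    periodization is a finite sum, so integrability is enough and no sign is required. *)
Lemma cintegral_window F : inL1 F -> (forall x, ~ D x -> F x = 0) ->
  cintegral F = cintegral (fun x => ind x * \sum_m F (x + c m)).
Proof.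
move=> F1 Fs.
have iF m : inL1 (fun x => ind (x - c m) * F x).
  apply: (inL1_bnd (M := 1)) => //.
    exact: (cmeas_tau (- c m) (cmeas_period_ind _)).
  by move=> x; rewrite expr1n; exact: sqmod_period_ind.
have tF m : tau (c m) (fun x => ind (x - c m) * F x) = (fun x => ind x * F (x + c m)).
  by apply/funext => x; rewrite /tau addrK.
transitivity (cintegral (fun x => \sum_m ind (x - c m) * F x)).
  congr cintegral; apply/funext => x; rewrite -mulr_suml.
  have [xD|xD] := pselect (D x); first by rewrite sum_ind// mul1r.
  by rewrite Fs// mulr0.
rewrite cintegral_sum//.
under eq_bigr => m _ do rewrite -(cintegral_tau (c m) (iF m)) tF.
rewrite -cintegral_sum => [|m]; last by rewrite -tF; exact: inL1_tau.
by congr cintegral; apply/funext => x; rewrite mulr_sumr.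
Qed.

Lemma L2normsq_window g : cmeasurable g -> (forall x, ~ D x -> g x = 0) ->
  L2normsq g = (\int[leb]_x (\sum_m sqmod (ind x * g (x + c m)))%:E)%E.
Proof.
move=> mg gs.
have mI m : cmeasurable (fun x => ind (x - c m) * g x).
  by apply: cmeasM => //; exact: (cmeas_tau (- c m) (cmeas_period_ind _)).
have mT m : cmeasurable (fun x => ind x * g (x + c m)).
  by apply: cmeasM; [exact: cmeas_period_ind|exact: (cmeas_tau (c m) mg)].
have ge0 k x : (0 <= (sqmod (k x : R[i]))%:E)%E by rewrite lee_fin sqmod_ge0.
under [RHS]eq_integral do rewrite -sumEFin.
rewrite ge0_integral_sum//; last first.
  by move=> m; exact: measurable_esqmod.
transitivity (\sum_m L2normsq (fun x => ind (x - c m) * g x)%R)%E.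
  rewrite /L2normsq -ge0_integral_sum//; last by move=> m; exact: measurable_esqmod.
  apply: eq_integral => x _; rewrite sumEFin; congr (_%:E).
  under eq_bigr do rewrite sqmodM.
  rewrite -mulr_suml; have [xD|xD] := pselect (D x); last by rewrite gs// sqmod0 mulr0.
  have -> : \sum_m sqmod (ind (x - c m)) = 1; last by rewrite mul1r.
  apply: complexI; rewrite rmorph_sum; transitivity (\sum_m ind (x - c m)); last exact: sum_ind.
  apply: eq_bigr => m _.
  have [dm|dm] := pselect (D0 (x - c m)); first by rewrite ind1// sqmod1.
  by rewrite ind0// sqmod0.
apply: eq_bigr => m _; rewrite -(L2normsq_tau (c m) (mI m)).
by apply: eq_integral => x _; rewrite /tau addrK.
Qed.

Lemma ae_window (Pr : R -> Prop) : (forall x, ~ D x -> Pr x) ->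
  {ae leb, forall x, D0 x -> forall m, Pr (x + c m)} -> {ae leb, forall x, Pr x}.
Proof.
move=> Ps hP.
have : {ae leb, forall x, forall m, D0 (x - c m) -> Pr x}.
  apply: ae_ffun => m; have := ae_shift (- c m) hP; apply: aeS => x hx hD.
  by have := hx hD m; rewrite subrK.
apply: aeS => x hx; have [/window_ex[m hm]|/Ps//] := pselect (D x).
exact: hx hm.
Qed.

Lemma ae_window_shift (Pr : R -> Prop) : {ae leb, forall x, Pr x} ->
  {ae leb, forall x, forall m, Pr (x + c m)}.
Proof. by move=> hP; apply: ae_ffun => m; exact: ae_shift. Qed.

Lemma modh_window x m : D0 x -> modh h (x + c m) = x.
Proof.
rewrite /= in_itv/= => /andP[x0 x1].
have fl : Num.floor ((x + c m) / h) = m%:Z - l%:Z.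
  have u0 : 0 <= x / h by rewrite divr_ge0 ?(ltW h_gt0).
  have u1 : x / h < 1 by rewrite ltr_pdivrMr ?mul1r.
  set k := m%:Z - l%:Z; apply/eqP; rewrite floor_eq /c -/k mulrDl mulfK ?gt_eqF// intrD.
  apply/andP; split; [by rewrite lerDr|by rewrite addrC ltrD2l].
by rewrite /modh fl addrK.
Qed.

End Windows.

(** * Functions assembled from the windows *)

Section Glue.
Context {R : realType} (n l : nat) (h : R).
Hypothesis h_gt0 : 0 < h.
Hypothesis nl : n.+1 = (2 * l)%N.
Local Notation c := (@wshift R n l h).
Local Notation D := (`[- (l%:R * h), l%:R * h[%classic : set R).
Local Notation D0 := (`[0, h[%classic : set R).
Local Notation ind := (period_ind h).

(* The function on the line which coincides on the window [[c m, c m + h)] with the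
   translate of [q m]. *)
Definition glue (q : 'I_n.+1 -> R -> R[i]) (x : R) : R[i] :=
  \sum_m ind (x - c m) * q m (x - c m).

Lemma glue_window q x k : D0 x -> glue q (x + c k) = q k x.
Proof.
move=> xD; rewrite /glue (bigD1 k)//= big1 ?addr0 ?addrK ?ind1 ?mul1r// => m mk.
rewrite ind0 ?mul0r// => hm; move/eqP: mk; apply.
exact: (window_inj h_gt0 xD hm).
Qed.

Lemma glue0 q x : ~ D x -> glue q x = 0.
Proof.
move=> xD; rewrite /glue big1// => m _; rewrite ind0 ?mul0r// => hm; apply: xD.
by have := window_sub h_gt0 nl m hm; rewrite subrK.
Qed.

Lemma inL2_glue q : (forall m, inL2 (q m)) -> inL2 (glue q).
Proof.
move=> q2; apply: inL2_sum => m.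
apply: (@inL2_bnd _ (fun x => ind (x - c m)) (fun x => q m (x - c m)) 1).
- exact: (cmeas_tau (- c m) (cmeas_period_ind h)).
- by move=> x; exact: sqmod_period_ind.
- exact: (inL2_tau (- c m) (q2 m)).
Qed.

End Glue.

(** * Slices of finite index sets *)

Section FsetSlices.
Context {K : choiceType} {I : finType}.

(** The frame series runs over finite sets of pairs generator-translation; its slices reduce
    unconditional convergence to that of one Fourier series per generator. *)
Definition fslice (F : {fset I * K}) (i : I) : {fset K} :=
  [fset p.2 | p in [fset p in F | p.1 == i]]%fset.

Lemma fslice_sum (V : zmodType) (F : {fset I * K}) (A : I -> K -> V) :
  \sum_(p <- F) A p.1 p.2 = \sum_i \sum_(k <- fslice F i) A i k.
Proof.
rewrite (partition_big fst xpredT)//=; apply: eq_bigr => i _.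
rewrite big_imfset/=; last first.
  move=> [a1 a2] [b1 b2]; rewrite !inE/= => /andP[_ /eqP->] /andP[_ /eqP->].
  by move=> ->.
rewrite [RHS]big_fset/=; apply: eq_bigr => p /eqP <-.
by [].
Qed.

Lemma fslice_cover (F0 : I -> {fset K}) : exists F1 : {fset I * K},
  forall F, (F1 `<=` F)%fset -> forall i, (F0 i `<=` fslice F i)%fset.
Proof.
exists [fset p in [seq (i, k) | i <- enum I, k <- (F0 i : seq K)]]%fset => F F1F i.
apply/fsubsetP => k kF; apply/imfsetP; exists (i, k) => //=.
rewrite !inE/= eqxx andbT; apply: (fsubsetP F1F).
by rewrite inE/=; apply/allpairsPdep; exists i, k; rewrite mem_enum.
Qed.

End FsetSlices.

(** * The frame operator on the Fourier side *)

Section FrameCoefficients.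
Context {R : realType} (n l N : nat) (h t0 gamma : R).
Hypothesis h_gt0 : 0 < h.
Hypothesis nl : n.+1 = (2 * l)%N.
Hypothesis gamma_ge0 : 0 <= gamma.
Hypothesis ht0 : h * t0 = 2 * pi.
Local Notation c := (@wshift R n l h).
Local Notation D := (`[- (l%:R * h), l%:R * h[%classic : set R).
Local Notation D0 := (`[0, h[%classic : set R).
Local Notation ind := (period_ind h).
Variables (phi G : 'I_N -> R -> R[i]).
Hypothesis phiG : forall i, is_fourier (phi i) (G i).
Hypothesis G_le : forall i x, sqmod (G i x) <= gamma.
Hypothesis G_supp : forall i x, ~ D x -> G i x = 0.

Let G2 i : inL2 (G i). Proof. by case: (phiG i). Qed.
Let mG i : cmeasurable (G i). Proof. by case: (G2 i). Qed.

Definition per (g : R -> R[i]) (i : 'I_N) (x : R) : R[i] :=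
  ind x * \sum_m g (x + c m) * Num.conj (G i (x + c m)).

Lemma inL2_per g i : inL2 g -> inL2 (per g i).
Proof.
move=> g2; apply: (inL2_bnd (M := 1)).
- exact: cmeas_period_ind.
- by move=> x; exact: sqmod_period_ind.
apply: inL2_sum => m; under eq_fun do rewrite mulrC.
apply: (@inL2_bnd _ (fun x => Num.conj (G i (x + c m))) (fun x => g (x + c m)) gamma).
- by apply: cmeas_conj; exact: (cmeas_tau (c m) (mG i)).
- by move=> x; rewrite sqmod_conj.
- exact: (inL2_tau (c m) g2).
Qed.

Lemma per_supp g i x : ~ D0 x -> per g i x = 0.
Proof. by move=> xD; rewrite /per ind0// mul0r. Qed.

(** The relation [h t0 = 2 pi] enters here: the exponentials coming from the translations are
    [h]-periodic, so they take one common value on all the points of a fibre. *)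
Lemma expi_wshift (k : int) x m :
  expi (k%:~R * t0 * (x + c m)) = expi (k%:~R * t0 * x).
Proof.
rewrite mulrDr expiD.
have -> : k%:~R * t0 * c m = (k * (m%:Z - l%:Z))%:~R * (2 * pi).
  by rewrite -ht0 /wshift intrM; ring.
by rewrite expi_2pi mulr1.
Qed.

Lemma expi_period (k : int) x : expi (k%:~R * (2 * pi / h * x)) = expi (k%:~R * t0 * x).
Proof. by congr expi; rewrite -ht0; field; rewrite gt_eqF. Qed.

Lemma inner_coef f g i k : is_fourier f g -> (forall x, ~ D x -> g x = 0) ->
  inner f (tau (k%:~R * t0) (phi i)) = coef h (per g i) k.
Proof.
move=> fg gs; rewrite (is_fourier_inner fg (is_fourier_tau (k%:~R * t0) (phiG i))).
have g2 := is_fourier_inL2r fg.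
rewrite /inner (cintegral_window h_gt0 nl); first last.
- by move=> x xD; rewrite gs// mul0r.
- apply: inL2MJ => //; apply: (inL2_bnd (M := 1)) => //.
    exact: cmeas_expi_lin.
  by move=> x; rewrite sqmod_expi.
rewrite /coef /inner /per; congr cintegral; apply/funext => x.
rewrite /ebas expi_period rmorphM/=.
rewrite -[in LHS](period_ind_idem h x).
have -> : Num.conj (ind x) = ind x by exact: conj_real.
rewrite [RHS]mulrACA; congr (_ * _).
rewrite mulr_suml; apply: eq_bigr => m _.
by rewrite expi_wshift rmorphM/=; ring.
Qed.

(** The limit of [synth_fin] below. The coefficients are not normalized, so their Fourier series
    sums to [h u i] on a period; periodicity repeats it on each window, where it multiplies
    [G i]. *)
Definition synth (u : 'I_N -> R -> R[i]) : R -> R[i] :=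
  @glue R n l h (fun m x => \sum_i h%:C * u i x * G i (x + c m)).

Definition synth_fin (u : 'I_N -> R -> R[i]) (F : {fset 'I_N * int}) (x : R) : R[i] :=
  \sum_(p <- F) coef h (u p.1) p.2 * (expi (p.2%:~R * t0 * x) * G p.1 x).

Lemma inL2_synth u : (forall i, inL2 (u i)) -> inL2 (synth u).
Proof.
move=> u2; apply: inL2_glue => m; apply: inL2_sum => i.
have -> : (fun x => h%:C * u i x * G i (x + c m)) =
    (fun x => h%:C * (G i (x + c m) * u i x)) by apply/funext => x; ring.
apply: inL2Z; apply: (@inL2_bnd _ (fun x => G i (x + c m)) (u i) gamma) => //.
exact: (cmeas_tau (c m) (mG i)).
Qed.

Lemma inL2_synth_fin u F : inL2 (synth_fin u F).
Proof.
apply: inL2_sum => p; apply: inL2Z; apply: (inL2_bnd (M := 1)) => //.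
  exact: cmeas_expi_lin.
by move=> x; rewrite sqmod_expi.
Qed.

Lemma synth_fin_window u F x m : D0 x ->
  synth_fin u F (x + c m) = \sum_i h%:C * fsum h (u i) (fslice F i) x * G i (x + c m).
Proof.
move=> xD; rewrite /synth_fin.
under eq_bigr do rewrite expi_wshift.
rewrite (fslice_sum F (fun i k => coef h (u i) k * (expi (k%:~R * t0 * x) * G i (x + c m)))).
apply: eq_bigr => i _; rewrite /fsum /lincomb mulr_sumr mulr_suml.
apply: eq_bigr => k _; rewrite /ebas expi_period ind1// mul1r.
have hC : h%:C * h^-1%:C = 1 :> R[i].
  by rewrite -[LHS]rmorphM/= mulfV ?gt_eqF.
by rewrite -[LHS]mul1r -hC; ring.
Qed.

(** The constant collects the [n.+1] windows, the Cauchy-Schwarz factor [N] for the sum over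
    generators, the scaling [h] squared and the bound on [G]. *)
Lemma nrm2_synth_le u F : (forall i, inL2 (u i)) ->
  nrm2 (fun x => synth u x - synth_fin u F x) <=
  n.+1%:R * N%:R * (h ^+ 2 * gamma) *
    \sum_i nrm2 (fun x => u i x - fsum h (u i) (fslice F i) x).
Proof.
move=> u2.
have v2 i : inL2 (fun x => u i x - fsum h (u i) (fslice F i) x).
  by apply: inL2B => //; exact: inL2_lincomb.
have d2 := inL2B (inL2_synth u2) (inL2_synth_fin u F).
have sub0 x : ~ D x -> synth u x - synth_fin u F x = 0.
  move=> xD; rewrite /synth (glue0 h_gt0 nl)// sub0r /synth_fin big1 ?oppr0// => p _.
  by rewrite G_supp// !mulr0.
rewrite -lee_fin -(L2normsqE d2) (L2normsq_window h_gt0 nl (proj1 d2) sub0).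
set C := n.+1%:R * _ * _.
have C0 : 0 <= C by do 2![apply: mulr_ge0; rewrite ?ler0n// ?sqr_ge0].
have gE : ((C * \sum_i nrm2 (fun x => u i x - fsum h (u i) (fslice F i) x))%:E =
    \int[leb]_x (C * \sum_i sqmod (u i x - fsum h (u i) (fslice F i) x))%:E)%E.
  rewrite mulr_sumr -sumEFin.
  under [RHS]eq_integral do rewrite mulr_sumr -sumEFin.
  rewrite ge0_integral_sum//; last 2 first.
  - move=> i; apply/measurable_EFinP; apply: measurable_funM; first exact: measurable_cst.
    by exact: (measurable_sqmod (proj1 (v2 i))).
  - by move=> i x _; rewrite lee_fin mulr_ge0// sqmod_ge0.
  apply: eq_bigr => i _; rewrite EFinM -(L2normsqE (v2 i)) /L2normsq.
  rewrite -ge0_integralZl_EFin//.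
  - by move=> x _; rewrite lee_fin sqmod_ge0.
  - exact: (measurable_esqmod (proj1 (v2 i))).
rewrite gE; apply: ge0_le_integral => //.
- by move=> x _; rewrite lee_fin; apply: sumr_ge0 => m _; exact: sqmod_ge0.
- apply/measurable_EFinP; apply: measurable_sum => m.
  apply: measurable_sqmod; apply: cmeasM; first exact: cmeas_period_ind.
  exact: (cmeas_tau (c m) (proj1 d2)).
- apply/measurable_EFinP; apply: measurable_funM; first exact: measurable_cst.
  by apply: measurable_sum => i; apply: measurable_sqmod; case: (v2 i).
move=> x _; rewrite lee_fin.
have S0 : 0 <= \sum_i sqmod (u i x - fsum h (u i) (fslice F i) x).
  by apply: sumr_ge0 => i _; exact: sqmod_ge0.
have [xD|xD] := pselect (D0 x); last first.
  rewrite big1; first exact: mulr_ge0.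
  by move=> m _; rewrite ind0// mul0r sqmod0.
set T := \sum_i _ in S0 *.
have -> : C * T = \sum_(m < n.+1) N%:R * (h ^+ 2 * gamma * T).
  by rewrite sumr_const card_ord -mulr_natl /C; ring.
apply: ler_sum => m _; rewrite ind1// mul1r /synth glue_window// synth_fin_window//.
rewrite -sumrB; apply: (le_trans (sqmod_sum_le _)); apply: ler_wpM2l => //; rewrite /T.
rewrite mulr_sumr; apply: ler_sum => i _.
rewrite -mulrBl -mulrBr !sqmodM sqmodR -[X in X <= _]mulrA -[X in _ <= X]mulrA.
by apply: ler_wpM2l; rewrite ?sqr_ge0// mulrC ler_wpM2r ?sqmod_ge0.
Qed.

Lemma synth_cvg u : (forall i, inL2 (u i)) -> (forall i x, ~ D0 x -> u i x = 0) ->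
  forall e, 0 < e -> exists F0 : {fset 'I_N * int}, forall F, (F0 `<=` F)%fset ->
  nrm2 (fun x => synth u x - synth_fin u F x) <= e.
Proof.
move=> u2 us e e0.
set C := n.+1%:R * N%:R * (h ^+ 2 * gamma).
have C0 : 0 <= C by do 2![apply: mulr_ge0; rewrite ?ler0n// ?sqr_ge0].
(* The added ones keep the denominator positive when [C] or [N] is 0. *)
pose d := e / ((C + 1) * (N%:R + 1)).
have d0 : 0 < d by rewrite divr_gt0// mulr_gt0// ltr_wpDl.
have hF i := fsum_cvg h_gt0 (u2 i) (us i) d0.
pose F0 i := sval (cid (hF i)).
have [F1 F1P] := fslice_cover F0; exists F1 => F F1F.
rewrite (le_trans (nrm2_synth_le _ _))// -/C.
have hs : \sum_i nrm2 (fun x => u i x - fsum h (u i) (fslice F i) x) <= N%:R * d.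
  rewrite mulr_natl -[X in _ <= _ *+ X](card_ord N) -sumr_const.
  apply: ler_sum => i _; rewrite /F0 in F1P.
  by move: (F1P F F1F i); case: (cid (hF i)) => /= F2; apply.
rewrite (le_trans (ler_wpM2l C0 hs))//.
have -> : e = (C + 1) * ((N%:R + 1) * d).
  by rewrite /d; field; rewrite !gt_eqF// ltr_wpDl.
have Nd0 : 0 <= N%:R * d by rewrite mulr_ge0// (ltW d0).
apply: (ler_pM C0 Nd0); first by rewrite lerDl.
by apply: ler_wpM2r; [exact: ltW|rewrite lerDl].
Qed.

(** The partial sums of the frame series have transforms [synth_fin], which converge to [synth].
    Since the transform is isometric, uniqueness of limits turns the definition by unconditional
    convergence into an identity of functions. *)
Lemma is_frame_opP psi p f g : is_fourier psi p -> (forall x, ~ D x -> p x = 0) ->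
  is_fourier f g ->
  is_frame_op t0 phi psi f <-> {ae leb, forall x, g x = synth (per p) x}.
Proof.
move=> psip ps fg.
have p2 := is_fourier_inL2r psip; have g2 := is_fourier_inL2r fg.
have u2 i : inL2 (per p i) by exact: inL2_per.
have s2 := inL2_synth u2.
have sE (F : {fset 'I_N * int}) : L2normsq (fun x => f x - \sum_(q <- F)
    inner psi (tau (q.2%:~R * t0) (phi q.1)) * tau (q.2%:~R * t0) (phi q.1) x)
    = (nrm2 (fun x => g x - synth_fin (per p) F x))%:E.
  have hF : is_fourier (fun x => f x - \sum_(q <- F)
    inner psi (tau (q.2%:~R * t0) (phi q.1)) * tau (q.2%:~R * t0) (phi q.1) x)
    (fun x => g x - synth_fin (per p) F x).
    apply: (is_fourierB fg); rewrite /synth_fin.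
    under [X in is_fourier _ X]eq_fun do under eq_bigr do rewrite -(inner_coef _ _ psip ps).
    by apply: is_fourier_sum => q; apply: is_fourierZ; exact: is_fourier_tau.
  by rewrite (L2normsqE (is_fourier_inL2l hF)) (is_fourier_nrm2 hF).
have us i x : ~ D0 x -> per p i x = 0 by exact: per_supp.
split => [hop|ae e e0].
  apply: nrm2_sub_ae => //.
  apply/eqP; rewrite eq_le nrm2_ge0 andbT; apply/ler_addgt0Pl => e e0; rewrite addr0.
  have e4 : 0 < e / 4 by rewrite divr_gt0.
  have [F1 h1] := hop _ e4; have [F2 h2] := synth_cvg u2 us e4.
  have := h1 _ (fsubsetUl F1 F2); have := h2 _ (fsubsetUr F1 F2).
  set F := (F1 `|` F2)%fset; rewrite sE lee_fin => k2 k1.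
  have sF2 := inL2_synth_fin (per p) F.
  have := nrm2D_le (inL2B g2 sF2) (inL2B sF2 s2).
  rewrite [X in _ + _ * X]nrm2BC.
  have -> : (fun x => g x - synth_fin (per p) F x + (synth_fin (per p) F x - synth (per p) x))
     = (fun x => g x - synth (per p) x) by apply/funext => x; ring.
  by lra.
have [F0 h0] := synth_cvg u2 us e0; exists F0 => F /h0; rewrite sE lee_fin.
apply: le_trans; rewrite le_eqVlt; apply/orP; left; apply/eqP.
rewrite /nrm2; congr fine; have sF2 := inL2_synth_fin (per p) F.
apply: eq_L2normsq_ae; [by case: (inL2B g2 sF2)|by case: (inL2B s2 sF2)|].
by move: ae; apply: aeS => x ->.
Qed.

End FrameCoefficients.

(** * The Gram matrix completed on its zero rows *)

Section CoordinateProjection.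
Context {R : realType} (n : nat).
Implicit Types (b : pred 'I_n.+1) (J Q : 'M[R[i]]_n.+1) (v : 'rV[R[i]]_n.+1).

(* [b] marks the rows of the pre-Gramian that vanish. *)
Definition dproj b : 'M[R[i]]_n.+1 := diag_mx (\row_i (b i)%:R).

Lemma dproj_mul0 m b (A : 'M[R[i]]_(n.+1, m)) :
  (forall i j, b i -> A i j = 0) -> dproj b *m A = 0.
Proof.
move=> bA; apply/matrixP => i j; rewrite mul_diag_mx !mxE.
by case: (boolP (b i)) => [/bA->|_]; rewrite ?mulr0 ?mul0r.
Qed.

Lemma mul_dproj0 b v : (forall i, b i -> v 0 i = 0) -> v *m dproj b = 0.
Proof.
move=> bA; apply/matrixP => i j; rewrite (ord1 i) mul_mx_diag !mxE.
by case: (boolP (b j)) => [/bA->|_]; rewrite ?mulr0 ?mul0r.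
Qed.

Lemma dproj_idem b : dproj b *m dproj b = dproj b.
Proof.
apply/matrixP => i j; rewrite mul_diag_mx !mxE.
by case: (b i); rewrite ?mul1r ?mul0r// mul0rn.
Qed.

Lemma dproj_conj b : map_mx Num.conj (dproj b) = dproj b.
Proof. by apply/matrixP => i j; rewrite !mxE rmorphMn rmorph_nat. Qed.

Lemma dproj_unit i0 : dproj (pred1 i0) = unit_proj i0.
Proof.
apply/matrixP => i j; rewrite !mxE /=.
by case: (eqVneq i i0) => [->|_]; [rewrite eq_sym|rewrite mul0rn].
Qed.

Lemma dproj_pred0 b : (forall i, ~~ b i) -> dproj b = 0.
Proof. by move=> b0; apply/matrixP => i j; rewrite !mxE (negbTE (b0 i)) mul0rn. Qed.

(** The marking [b] is arbitrary so that one matrix covers the centre, where nothing is marked, and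
    both side intervals. *)
Definition gramP b J := J *m J ^t* + dproj b.

Lemma sqmod_gramP_le b J (M : R) : (forall i j, sqmod (J i j) <= M) ->
  forall i j, sqmod (gramP b J i j) <= 2 * (n.+1%:R * (n.+1%:R * (M * M))) + 2.
Proof.
move=> JM i j; rewrite mxE ct_gramE; apply: (le_trans (sqmodD_le _ _)).
apply: lerD.
  apply: ler_wpM2l => //; apply: (le_trans (sqmod_sum_le _)).
  apply: ler_wpM2l => //; rewrite mulr_natl -[X in _ <= _ *+ X](card_ord n.+1) -sumr_const.
  by apply: ler_sum => k _; rewrite sqmodM sqmod_conj ler_pM ?sqmod_ge0.
rewrite -[X in _ <= X]mulr1; apply: ler_wpM2l => //.
rewrite !mxE; case: (b i); case: (i == j);
  by rewrite /= ?mulr1n ?mulr0n ?mul0rn ?sqmod1 ?sqmod0 ?ler01 ?lexx.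
Qed.

Lemma gramP_solve b J Q : (forall i j, b i -> J i j = 0) -> (forall i j, b i -> Q i j = 0) ->
  J *m J ^t* *m Q = J -> gramP b J *m Q = J.
Proof. by move=> bJ bQ JQ; rewrite mulmxDl JQ dproj_mul0 ?addr0. Qed.

Lemma dproj_gramP b J : (forall i j, b i -> J i j = 0) -> dproj b *m gramP b J = dproj b.
Proof.
by move=> bJ; rewrite mulmxDr mulmxA (dproj_mul0 bJ) mul0mx add0r dproj_idem.
Qed.

(** From [P K = P] follows [P K^-1 = P], hence [P K^-1 J = P J = 0]: the solution vanishes on the
    marked rows, and replacing [J J^t*] by [K] makes no difference on it. *)
Lemma gramP_inv b J : (forall i j, b i -> J i j = 0) -> \det (gramP b J) != 0 ->
  (forall i j, b i -> (invmx (gramP b J) *m J) i j = 0) /\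
  J *m J ^t* *m (invmx (gramP b J) *m J) = J.
Proof.
move=> bJ dK; have Ku : gramP b J \in unitmx by rewrite unitmxE unitfE.
have PK : dproj b *m invmx (gramP b J) = dproj b.
  by rewrite -{1}(dproj_gramP bJ) -mulmxA mulmxV// mulmx1.
have PQ : dproj b *m (invmx (gramP b J) *m J) = 0.
  by rewrite mulmxA PK dproj_mul0.
split => [i j bi|].
  have := congr1 (fun A : 'M[R[i]]_n.+1 => A i j) PQ.
  by rewrite mul_diag_mx !mxE bi mul1r => ->.
have -> : J *m J ^t* = gramP b J - dproj b by rewrite /gramP addrK.
by rewrite mulmxBl PQ subr0 mulKVmx.
Qed.

(** The lower frame inequality on a fibre. As [v] vanishes where [P] does not, [v] times the
    conjugate of [K] equals [v] times the conjugate of [J] times [J^T]; thus [v] is recovered from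
    the frame data by matrices with uniformly bounded entries. *)
Lemma rnorm_lower (M c0 : R) : 0 <= M -> 0 < c0 -> exists2 C, 0 <= C &
  forall b J v, (forall i j, sqmod (J i j) <= M) -> c0 <= sqmod (\det (gramP b J)) ->
    (forall i, b i -> v 0 i = 0) -> rnorm v <= C * rnorm (v *m map_mx Num.conj J).
Proof.
move=> M0 c00.
set M' : R := 2 * (n.+1%:R * (n.+1%:R * (M * M))) + 2.
have M'0 : 0 <= M' by rewrite addr_ge0// !mulr_ge0.
have [C C0 hC] := @sqmod_invmx_le R n.+1 M' c0 M'0 c00.
exists ((n.+1%:R * n.+1%:R * C) * (n.+1%:R * n.+1%:R * M)); first by rewrite !mulr_ge0.
move=> b J v JM dK bv; set K := gramP b J.
have dK0 : \det (map_mx Num.conj K) != 0.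
  rewrite det_map_mx fmorph_eq0; apply/eqP => d0.
  by move: dK; rewrite -/K d0 sqmod0 leNgt c00.
have Ku : map_mx Num.conj K \in unitmx by rewrite unitmxE unitfE.
have KE : map_mx Num.conj K = map_mx Num.conj J *m J^T + dproj b.
  rewrite /K /gramP map_mxD map_mxM dproj_conj; congr (_ *m _ + _).
  by apply/matrixP => i j; rewrite [LHS]mxE ct_mxE [LHS]conjCK [RHS]mxE.
have vE : v = (v *m map_mx Num.conj J) *m J^T *m invmx (map_mx Num.conj K).
  have -> : v *m map_mx Num.conj J *m J^T = v *m map_mx Num.conj K.
    by rewrite KE mulmxDr (mul_dproj0 bv) addr0 mulmxA.
  by rewrite mulmxK.
rewrite {1}vE -mulrA.
apply: le_trans (rnorm_mul _ (A := invmx (map_mx Num.conj K)) (M := C) _) _.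
  apply: hC => [i j|].
    by rewrite mxE sqmod_conj; exact: sqmod_gramP_le.
  by rewrite det_map_mx sqmod_conj.
apply: ler_wpM2l; first by rewrite !mulr_ge0.
by apply: rnorm_mul => i j; rewrite mxE.
Qed.

End CoordinateProjection.

(** * The frame inequalities *)

Section FrameBounds.
Context {R : realType} (n l : nat) (w h t0 gamma c0 : R).
Hypothesis h_gt0 : 0 < h.
Hypothesis nl : n.+1 = (2 * l)%N.
Hypothesis gamma_ge0 : 0 <= gamma.
Hypothesis ht0 : h * t0 = 2 * pi.
Hypothesis w_le : w <= l%:R * h.
Hypothesis c0_gt0 : 0 < c0.
Local Notation c := (@wshift R n l h).
Local Notation D := (`[- (l%:R * h), l%:R * h[%classic : set R).
Local Notation D0 := (`[0, h[%classic : set R).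
Local Notation ind := (period_ind h).
Local Notation s := ((Num.sqrt h)%:C : R[i]).
Variables (phi G : 'I_n.+1 -> R -> R[i]).

Definition outband (x : R) : pred 'I_n.+1 := fun m => x + c m \notin `]- w, w[.
Definition pgram (x : R) : 'M[R[i]]_n.+1 := \matrix_(m, i) (s * G i (x + c m)).

Hypothesis phiG : forall i, is_fourier (phi i) (G i).
Hypothesis G_le : forall i x, sqmod (G i x) <= gamma.
Hypothesis G_band : forall i x, x \notin `]- w, w[ -> G i x = 0.
Hypothesis det_lb :
  {ae leb, forall x, D0 x -> c0 <= sqmod (\det (gramP (outband x) (pgram x)))}.

Lemma band_supp (g : R -> R[i]) : (forall x, x \notin `]- w, w[ -> g x = 0) ->
  forall x, ~ D x -> g x = 0.
Proof.
move=> gb x xD; apply: gb; apply/negP; rewrite in_itv/= => /andP[x1 x2]; apply: xD.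
by rewrite /= in_itv/=; move: w_le => wl; apply/andP; split; lra.
Qed.

Let G_supp i := band_supp (@G_band i).
Let G2 i : inL2 (G i). Proof. by case: (phiG i). Qed.
Let mG i : cmeasurable (G i). Proof. by case: (G2 i). Qed.
Local Notation per := (@per R n l n.+1 h G).

Lemma sqmod_sqrt : sqmod s = h.
Proof. by rewrite sqmodR sqr_sqrtr// ltW. Qed.

Lemma pgram_le x i j : sqmod (pgram x i j) <= h * gamma.
Proof. by rewrite mxE sqmodM sqmod_sqrt ler_wpM2l// ltW. Qed.

Lemma pgram_out x i j : outband x i -> pgram x i j = 0.
Proof. by move=> xi; rewrite mxE G_band// mulr0. Qed.

Definition wrow (g : R -> R[i]) (x : R) : 'rV[R[i]]_n.+1 := \row_m (ind x * g (x + c m)).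

Lemma wrow_pgram g x i : (wrow g x *m map_mx Num.conj (pgram x)) 0 i = s * per g i x.
Proof.
rewrite !mxE /per mulr_sumr mulr_sumr; apply: eq_bigr => m _.
by rewrite !mxE rmorphM/= [Num.conj s]conj_real; ring.
Qed.

Lemma wrow_L2 g : inL2 g -> (forall x, x \notin `]- w, w[ -> g x = 0) ->
  (nrm2 g)%:E = (\int[leb]_x (rnorm (wrow g x))%:E)%E.
Proof.
move=> g2 gb; rewrite -(L2normsqE g2) (L2normsq_window h_gt0 nl (proj1 g2) (band_supp gb)).
by apply: eq_integral => x _; rewrite rnorm_row; congr (_%:E); apply: eq_bigr => m _; rewrite mxE.
Qed.

Lemma per_L2 g : inL2 g ->
  (\sum_i h * nrm2 (per g i))%:E =
  (\int[leb]_x (rnorm (wrow g x *m map_mx Num.conj (pgram x)))%:E)%E.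
Proof.
move=> g2; have u2 i : inL2 (per g i) by exact: (inL2_per n l h phiG G_le).
transitivity (\int[leb]_x (\sum_i (h * sqmod (per g i x))%:E))%E; last first.
  apply: eq_integral => x _; rewrite sumEFin rnorm_row; congr (_%:E).
  by apply: eq_bigr => i _; rewrite wrow_pgram sqmodM sqmod_sqrt.
rewrite ge0_integral_sum//; last 2 first.
- move=> i; apply/measurable_EFinP; apply: measurable_funM; first exact: measurable_cst.
  by exact: (measurable_sqmod (proj1 (u2 i))).
- by move=> i x _; rewrite lee_fin mulr_ge0 ?sqmod_ge0// ltW.
rewrite -sumEFin; apply: eq_bigr => i _; rewrite EFinM -(L2normsqE (u2 i)) /L2normsq.
rewrite -ge0_integralZl_EFin ?(ltW h_gt0)//.
- by move=> x _; rewrite lee_fin sqmod_ge0.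
- exact: (measurable_esqmod (proj1 (u2 i))).
Qed.

Lemma frame_sum f g : is_fourier f g -> (forall x, x \notin `]- w, w[ -> g x = 0) ->
  (\sum_(j < n.+1) \esum_(k in [set: int])
     (sqmod (inner f (tau (k%:~R * t0) (phi j))))%:E = (\sum_i h * nrm2 (per g i))%:E)%E.
Proof.
move=> fg gb; rewrite -sumEFin; apply: eq_bigr => i _.
have g2 := is_fourier_inL2r fg.
rewrite -(parseval h_gt0 (inL2_per n l h phiG G_le i g2)); last by move=> x; exact: per_supp.
by apply: eq_esum => k _; rewrite (inner_coef h_gt0 nl ht0 phiG i k fg (band_supp gb)).
Qed.

Lemma measurable_rnorm m (A : R -> 'rV[R[i]]_m) :
  (forall j, cmeasurable (fun x => A x 0 j)) ->
  measurable_fun [set: R] (fun x => (rnorm (A x))%:E).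
Proof.
move=> mA; apply/measurable_EFinP; under eq_fun do rewrite rnorm_row.
by apply: measurable_sum => j; exact: measurable_sqmod.
Qed.

Lemma frame_bounds : exists A B : R, [/\ 0 < A, A <= B & forall f g,
  is_fourier f g -> (forall x, x \notin `]- w, w[ -> g x = 0) ->
    let s := (\sum_(j < n.+1) \esum_(k in [set: int])
                (sqmod (inner f (tau (k%:~R * t0) (phi j))))%:E)%E in
    (A%:E * L2normsq f <= s)%E /\ (s <= B%:E * L2normsq f)%E].
Proof.
have hg0 : 0 <= h * gamma by rewrite mulr_ge0// ltW.
have [C C0 hC] := @rnorm_lower R n _ _ hg0 c0_gt0.
have C1 : 0 < C + 1 by rewrite ltr_wpDl.
set B : R := n.+1%:R * n.+1%:R * (h * gamma).
have B0 : 0 <= B by rewrite !mulr_ge0// ltW.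
(* [C] may be 0, so [C + 1] is inverted; adding the lower constant to [B] secures the order between
   the two bounds. *)
exists (C + 1)^-1, (B + (C + 1)^-1); split; [by rewrite invr_gt0|by rewrite lerDr|].
move=> f g fg gb /=; rewrite (frame_sum fg gb).
have g2 := is_fourier_inL2r fg.
have u2 i : inL2 (per g i) by exact: (inL2_per n l h phiG G_le).
rewrite (L2normsqE (is_fourier_inL2l fg)) (is_fourier_nrm2 fg) -!EFinM !lee_fin.
have mv : measurable_fun [set: R] (fun x => (rnorm (wrow g x))%:E).
  apply: measurable_rnorm => m; under eq_fun do rewrite mxE.
  apply: cmeasM; first exact: cmeas_period_ind.
  exact: (cmeas_tau (c m) (proj1 g2)).
have mw : measurable_fun [set: R]
    (fun x => (rnorm (wrow g x *m map_mx Num.conj (pgram x)))%:E).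
  apply: measurable_rnorm => i; under eq_fun do rewrite wrow_pgram.
  by apply: cmeasM; [exact: cmeas_cst|case: (u2 i)].
have sc (a : R) (F : R -> R) : 0 <= a -> (forall x, 0 <= F x) ->
    measurable_fun [set: R] (fun x => (F x)%:E) ->
    (\int[leb]_x (a * F x)%:E = a%:E * \int[leb]_x (F x)%:E)%E.
  move=> a0 F0 mF; rewrite -ge0_integralZl_EFin// => x _.
  by rewrite lee_fin.
split.
  rewrite mulrC ler_pdivrMr// mulrC -lee_fin EFinM per_L2// wrow_L2//.
  rewrite -(sc _ _ (ltW C1) (fun x => rnorm_ge0 _) mw).
  apply: ae_ge0_le_integral => //.
  - by move=> x _; rewrite lee_fin rnorm_ge0.
  - by move=> x _; rewrite lee_fin mulr_ge0 ?rnorm_ge0// ltW.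
  - by apply/measurable_EFinP; apply: measurable_funM; [exact: measurable_cst|exact/measurable_EFinP].
  move: det_lb; apply: aeS => x hx _; rewrite lee_fin.
  have [xD|xD] := pselect (D0 x); last first.
    rewrite [X in X <= _](_ : _ = 0) ?mulr_ge0 ?rnorm_ge0// ?(ltW C1)//.
    by rewrite rnorm_row big1// => m _; rewrite mxE ind0// mul0r sqmod0.
  apply: le_trans (hC (outband x) (pgram x) (wrow g x) (@pgram_le x) (hx xD) _) _.
    by move=> m hm; rewrite mxE gb// mulr0.
  by rewrite ler_wpM2r ?rnorm_ge0// lerDl.
apply: (@le_trans _ _ (B * nrm2 g)); last first.
  by rewrite ler_wpM2r ?nrm2_ge0// lerDl invr_ge0 ltW.
rewrite -lee_fin EFinM per_L2// wrow_L2// -(sc _ _ B0 (fun x => rnorm_ge0 _) mv).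
apply: ge0_le_integral => //.
- by move=> x _; rewrite lee_fin rnorm_ge0.
- by apply/measurable_EFinP; apply: measurable_funM; [exact: measurable_cst|exact/measurable_EFinP].
move=> x _; rewrite lee_fin; apply: rnorm_mul => i j.
by rewrite mxE sqmod_conj pgram_le.
Qed.

End FrameBounds.

(** * Measurability of determinants and adjugates *)

Section MeasurableMatrices.
Context {R : realType}.

Lemma cmeas_det m (A : R -> 'M[R[i]]_m) : (forall i j, cmeasurable (fun x => A x i j)) ->
  cmeasurable (fun x => \det (A x)).
Proof.
move=> mA; apply: cmeas_sum => sg; apply: cmeasM; first exact: cmeas_cst.
by apply: cmeas_prod => i; exact: mA.
Qed.

Lemma cmeas_adj m (A : R -> 'M[R[i]]_m) i j : (forall i j, cmeasurable (fun x => A x i j)) ->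
  cmeasurable (fun x => (\adj (A x)) i j).
Proof.
move=> mA; under eq_fun do rewrite mxE; apply: cmeasM; first exact: cmeas_cst.
by apply: cmeas_det => k k'; under eq_fun do rewrite !mxE; exact: mA.
Qed.

Lemma supp_inL1_sym (a : R) (g : R -> R[i]) : 0 < a -> inL2 g ->
  (forall x, ~ (`[- a, a[%classic : set R) x -> g x = 0) -> inL1 g.
Proof.
move=> a0 g2 gs; have -> : g = tau a (tau (- a) g).
  by apply/funext => x; rewrite /tau addrK.
apply: inL1_tau; apply: (@supp_inL1 _ (2 * a)); first by rewrite mulr_gt0.
  exact: inL2_tau.
move=> x xD; apply: gs => /=; rewrite in_itv/= => /andP[x1 x2]; apply: xD.
by rewrite /= in_itv/=; apply/andP; split; lra.
Qed.

End MeasurableMatrices.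

(** * Construction of the dual generators *)

Section DualGenerators.
Context {R : realType} (n l : nat) (w h t0 gamma c0 : R).
Hypothesis h_gt0 : 0 < h.
Hypothesis nl : n.+1 = (2 * l)%N.
Hypothesis gamma_ge0 : 0 <= gamma.
Hypothesis ht0 : h * t0 = 2 * pi.
Hypothesis w_le : w <= l%:R * h.
Hypothesis c0_gt0 : 0 < c0.
Local Notation c := (@wshift R n l h).
Local Notation D := (`[- (l%:R * h), l%:R * h[%classic : set R).
Local Notation D0 := (`[0, h[%classic : set R).
Local Notation ind := (period_ind h).
Local Notation s := ((Num.sqrt h)%:C : R[i]).
Local Notation outband := (@outband R n l w h).
Local Notation pgram := (@pgram R n l h).
Variables (phi G : 'I_n.+1 -> R -> R[i]).
Hypothesis phiG : forall i, is_fourier (phi i) (G i).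
Hypothesis G_le : forall i x, sqmod (G i x) <= gamma.
Hypothesis G_band : forall i x, x \notin `]- w, w[ -> G i x = 0.
Local Notation K x := (gramP (outband x) (pgram G x)).

Let G_supp i := band_supp w_le (@G_band i).
Let G2 i : inL2 (G i). Proof. by case: (phiG i). Qed.
Let mG i : cmeasurable (G i). Proof. by case: (G2 i). Qed.
Let J_out x i j : outband x i -> pgram G x i j = 0.
Proof. by apply: pgram_out. Qed.
Local Notation per := (@per R n l n.+1 h G).
Local Notation synth := (@synth R n l n.+1 h G).

Lemma synth_per_window p x m j : D0 x ->
  s * synth (per (p j)) (x + c m) = (pgram G x *m (pgram G x) ^t* *m pgram p x) m j.
Proof.
move=> xD; rewrite /synth glue_window// [RHS]mxE mulr_sumr.
under [RHS]eq_bigr do rewrite ct_gramE mulr_suml.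
rewrite exchange_big/=; apply: eq_bigr => i _.
rewrite /per ind1// mul1r mulr_sumr mulr_suml mulr_sumr; apply: eq_bigr => k _.
rewrite !mxE rmorphM/= [Num.conj s]conj_real -(sqrt_real_sqr h_gt0); ring.
Qed.

(** The entry [(m, j)] of the matrix identity is, up to the nonzero factor [s], the equation for the
    generator [j] on the window [m]. *)
Lemma frame_op_matrix psi p : (forall j, is_fourier (psi j) (p j)) ->
  (forall j x, x \notin `]- w, w[ -> p j x = 0) ->
  (forall j, is_frame_op t0 phi (psi j) (phi j)) <->
  {ae leb, forall x, D0 x ->
    pgram G x *m (pgram G x) ^t* *m pgram p x = pgram G x}.
Proof.
move=> psip pb.
have opE j : is_frame_op t0 phi (psi j) (phi j) <->
    {ae leb, forall x, G j x = synth (per (p j)) x}.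
  exact: (is_frame_opP h_gt0 nl gamma_ge0 ht0 phiG G_le G_supp (psip j)
    (band_supp w_le (@pb j)) (phiG j)).
split => [hop|hm j].
  have : {ae leb, forall x, forall m j, G j (x + c m) = synth (per (p j)) (x + c m)}.
    apply: (@ae_window_shift _ n l h (fun y => forall j, G j y = synth (per (p j)) y)).
    by apply: ae_ffun => j; apply/opE.
  apply: aeS => x hx xD; apply/matrixP => m j.
  by rewrite -synth_per_window// -hx mxE.
apply/opE; apply: (ae_window h_gt0 nl) => [x xD|].
  by rewrite G_supp// /synth (glue0 h_gt0 nl).
move: hm; apply: aeS => x hx xD m.
have := congr1 (fun A : 'M[R[i]]_n.+1 => A m j) (hx xD).
rewrite -synth_per_window// mxE => /(mulfI _) -> //.
exact: sqrt_real_neq0.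
Qed.

Lemma cmeas_pgram i j : cmeasurable (fun x => pgram G x i j).
Proof.
under eq_fun do rewrite mxE; apply: cmeasM; first exact: cmeas_cst.
exact: (cmeas_tau (c i) (mG j)).
Qed.

Lemma cmeas_gramP i j : cmeasurable (fun x => K x i j).
Proof.
under eq_fun do rewrite mxE ct_gramE; apply: cmeasD.
  apply: cmeas_sum => k; apply: cmeasM; first exact: cmeas_pgram.
  by apply: cmeas_conj; exact: cmeas_pgram.
under eq_fun do rewrite !mxE -mulrnA.
have -> : (fun x => (outband x i * (i == j))%N%:R : R[i]) =
    (fun x => (i == j)%:R * (1 - (\1_[set` `]- w - c i, w - c i[] x)%:C)).
  apply/funext => x; rewrite indicE mulrnA /outband.
  have -> : (x \in [set` `]- w - c i, w - c i[]) = (x + c i \in `]- w, w[).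
    by rewrite mem_setE !in_itv/= ltrBlDr ltrBrDr.
  by case: (_ \in _); case: (i == j); rewrite /= ?rmorph1 ?rmorph0 ?subrr ?subr0 ?mulr0 ?mul0r ?mul1r.
apply: cmeasM; first exact: cmeas_cst.
apply: cmeasB; first exact: cmeas_cst.
by apply: cmeas_indic; exact: measurable_itv.
Qed.

(** The solution [K^-1 J] is formed on each fibre, its rows are glued along the windows, and the
    resulting functions are pulled back by surjectivity of the transform. *)
Lemma dual_exists :
  {ae leb, forall x, D0 x -> c0 <= sqmod (\det (K x))} ->
  exists psi p, [/\ forall j, is_fourier (psi j) (p j),
    forall j x, x \notin `]- w, w[ -> p j x = 0 &
    forall j, is_frame_op t0 phi (psi j) (phi j)].
Proof.
move=> det_lb.
(* The determinant bound holds only almost everywhere. Setting the inverse to 0 off this measurable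
   set makes its entries bounded everywhere, and writing it with the adjugate makes them visibly
   measurable. *)
pose ok : set R := [set x | c0 <= sqmod (\det (K x))].
have mok : measurable ok.
  have := @measurable_sqmod _ _ (cmeas_det cmeas_gramP).
  move=> /(_ measurableT [set` `[c0, +oo[] (measurable_itv _)); rewrite setTI.
  by congr measurable; apply/seteqP; split => x /=; rewrite in_itv/= andbT.
pose e m k x : R[i] := (\1_ok x)%:C * ((\det (K x))^-1 * (\adj (K x)) m k).
have det_ok x : ok x -> \det (K x) != 0.
  by move=> hx; apply/eqP => d0; move: hx; rewrite /ok/= d0 sqmod0 leNgt c0_gt0.
have e_ok x m k : ok x -> e m k x = invmx (K x) m k.
  move=> hx; rewrite /e indicE mem_set// rmorph1 mul1r /invmx unitmxE unitfE det_ok//.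
  by rewrite [RHS]mxE.
have e_nok x m k : ~ ok x -> e m k x = 0.
  by move=> hx; rewrite /e indicE memNset// rmorph0 mul0r.
have me m k : cmeasurable (e m k).
  apply: cmeasM; first exact: cmeas_indic.
  apply: cmeasM; first by apply: cmeas_inv; apply: cmeas_det; exact: cmeas_gramP.
  by apply: cmeas_adj; exact: cmeas_gramP.
have hg0 : 0 <= h * gamma by rewrite mulr_ge0// ltW.
set M' : R := 2 * (n.+1%:R * (n.+1%:R * (h * gamma * (h * gamma)))) + 2.
have M'0 : 0 <= M' by rewrite addr_ge0// !mulr_ge0// ltW.
have [C C0 hC] := @sqmod_invmx_le R n.+1 M' c0 M'0 c0_gt0.
have e_le m k x : sqmod (e m k x) <= C.
  have [hx|hx] := pselect (ok x); last by rewrite e_nok// sqmod0.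
  rewrite e_ok//; apply: hC => // i j.
  by apply: sqmod_gramP_le => a b; apply: pgram_le.
pose q j m x : R[i] := s^-1 * \sum_k e m k x * pgram G x k j.
have q_ok j m x : ok x -> q j m x = s^-1 * (invmx (K x) *m pgram G x) m j.
  by move=> hx; congr (_ * _); rewrite mxE; apply: eq_bigr => k _; rewrite e_ok.
have q2 j m : inL2 (q j m).
  apply: inL2Z; apply: inL2_sum => k; apply: (inL2_bnd (M := C)) => //.
  under eq_fun do rewrite mxE; apply: inL2Z; exact: (inL2_tau (c k) (G2 j)).
pose p j := @glue R n l h (q j).
have p2 j : inL2 (p j) by exact: inL2_glue.
(* A point outside the band lies on a marked row of its fibre, and there [K^-1 J] vanishes. *)
have pb j x : x \notin `]- w, w[ -> p j x = 0.
  move=> xw; have [xD|xD] := pselect (D x); last by rewrite /p (glue0 h_gt0 nl).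
  have [m hm] := window_ex h_gt0 nl xD.
  have -> : p j x = q j m (x - c m) by rewrite -{1}(subrK (c m) x) /p glue_window.
  have [hx|hx] := pselect (ok (x - c m)); last first.
    by rewrite /q big1 ?mulr0// => k _; rewrite e_nok// mul0r.
  have [h1 _] := gramP_inv (@J_out (x - c m)) (det_ok _ hx).
  by rewrite q_ok// h1 ?mulr0// /outband subrK.
have l0 : 0 < l%:R * h.
  rewrite mulr_gt0// ltr0n lt0n; apply/eqP => l0; by move: nl; rewrite l0 muln0.
have p1 j : inL1 (p j).
  by apply: (supp_inL1_sym l0) => //; exact: (band_supp w_le (@pb j)).
have [psi psiP] := boolp.choice (fun j => is_fourier_surj (p1 j) (p2 j)).
exists psi, p; split => //; apply/(frame_op_matrix psiP pb).
move: det_lb; apply: aeS => x hx xD; have {}hx : ok x by exact: hx.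
have -> : pgram p x = invmx (K x) *m pgram G x.
  apply/matrixP => m j; rewrite mxE /p glue_window// q_ok// mulrA mulfV ?mul1r//.
  exact: sqrt_real_neq0.
by have [] := gramP_inv (@J_out x) (det_ok _ hx).
Qed.

End DualGenerators.

(** * The dual generators *)

Section IntegerRanges.

Lemma zrangeE (a b : int) (q : nat) : b = a + q%:Z - 1 -> zrange a b = [seq a + m%:Z | m <- iota 0 q].
Proof.
move=> ->; rewrite /zrange; case: q => [|q]; first by rewrite ifF//; lia.
rewrite ifT; last by lia.
by congr (map _ (iota 0 _)); lia.
Qed.

Lemma nth_zrange (T : Type) (x0 : T) (F : int -> T) (a b : int) (q k : nat) :
  b = a + q%:Z - 1 -> (k < q)%N -> nth x0 [seq F j | j <- zrange a b] k = F (a + k%:Z).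
Proof.
move=> /zrangeE -> kq; rewrite -map_comp (nth_map 0%N) ?size_iota//=.
by rewrite nth_iota.
Qed.

(** It matches the omission of [j = 0] in the formula on the centre with the omission of a row by
    [lift]. *)
Lemma filter_iota_neq (n i : nat) : (i <= n)%N ->
  [seq m <- iota 0 n.+1 | m != i] = [seq bump i k | k <- iota 0 n].
Proof.
move=> le_in.
have -> : iota 0 n.+1 = iota 0 i ++ i :: iota i.+1 (n - i).
  by rewrite -[in LHS](subnKC le_in) -addnS iotaD.
have -> : iota 0 n = iota 0 i ++ iota i (n - i) by rewrite -[in LHS](subnKC le_in) iotaD.
rewrite filter_cat map_cat /= eqxx/= -[iota i.+1 _]/(iota (1 + i) _) iotaDl.
congr (_ ++ _).
  rewrite (eq_in_filter (a2 := xpredT)) ?filter_predT; last first.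
    by move=> m; rewrite mem_iota add0n => /andP[_ mi]; rewrite ltn_eqF.
  rewrite -[LHS]map_id; apply/eq_in_map => m; rewrite mem_iota add0n => /andP[_ mi].
  by rewrite /bump leqNgt mi.
rewrite (eq_in_filter (a2 := xpredT)) ?filter_predT; last first.
  move=> m /mapP[k]; rewrite mem_iota => /andP[ik _] ->.
  by rewrite add1n gtn_eqF// ltnS.
by apply/eq_in_map => m; rewrite mem_iota => /andP[im _]; rewrite /bump im.
Qed.

Lemma index_ex (n l : nat) (k : int) : n.+1 = (2 * l)%N -> - l%:Z <= k <= l%:Z - 1 ->
  exists i : 'I_n.+1, k = i%:Z - l%:Z.
Proof.
move=> nl /andP[k1 k2]; have kn : (absz (l%:Z + k)%R < n.+1)%N by rewrite nl; lia.
by exists (Ordinal kn) => /=; lia.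
Qed.

End IntegerRanges.

(** * The three formulas on a fibre *)

Section DualFormula.
Context {R : realType} (n l : nat) (h : R).
Hypothesis h_gt0 : 0 < h.
Hypothesis nl : n.+1 = (2 * l)%N.
Local Notation c := (@wshift R n l h).
Local Notation s := ((Num.sqrt h)%:C : R[i]).
Implicit Types Phi Phis : R -> 'rV[R[i]]_n.+1.

Definition umat Phi (x : R) : 'M[R[i]]_n.+1 := \matrix_(m < n.+1) Phi (x + c m).

Lemma tau_wshift Phi (x : R) (i m : 'I_n.+1) (j : int) : j = m%:Z - i%:Z ->
  tau (j%:~R * h) Phi (x + c i) = row m (umat Phi x).
Proof.
move=> ->; rewrite rowK /tau; congr Phi.
by rewrite /wshift !rmorphB /=; ring.
Qed.

Lemma formula_center Phi Phis x (i : 'I_n.+1) (k : int) :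
  k = i%:Z - l%:Z ->
  let J := s *: umat Phi x in
  \det J != 0 -> J *m J ^t* *m (s *: umat Phis x) = J ->
  Phis (x + c i) = ((-1) ^ (l%:Z + k) * ((h ^+ (l - 1))%:C * (\det (J ^t*))^-1)) *:
    cross [seq map_mx Num.conj (tau (j%:~R * h) Phi (x + c i))
          | j <- zrange (- l%:Z - k) (l%:Z - k - 1) & j != 0].
Proof.
move=> -> J dJ JQ.
have -> : Phis (x + c i) = row i (umat Phis x) by rewrite rowK.
have -> : l%:Z + (i%:Z - l%:Z) = i by ring.
apply: (dual_row_center h_gt0 dJ JQ).
  have -> : n = ((l - 1) + (l - 1)).+1 by move: nl; lia.
  by rewrite exprS exprD -exprMn (sqrt_real_sqr h_gt0) rmorphXn.
move=> q; have -> : - l%:Z - (i%:Z - l%:Z) = - i%:Z by ring.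
rewrite (zrangeE (q := n.+1)); last by move: nl; lia.
rewrite filter_map -map_comp (eq_filter (a2 := fun m : nat => m != i :> nat)); last first.
  by move=> m /=; lia.
rewrite filter_iota_neq -1?ltnS// -map_comp (nth_map 0%N) ?size_iota// nth_iota//=.
rewrite -map_row; congr map_mx; apply: tau_wshift; rewrite add0n /=; lia.
Qed.

(** Row [i0] of the matrix on the right is a basis vector, so the Laplace expansion along it leaves
    the Gram determinant of the other rows. This identifies the determinant in [Efun] with
    [det K]. *)
Lemma det_gram_rowsub (J : 'M[R[i]]_n.+1) (i0 : 'I_n.+1) (f : 'I_n -> 'I_n.+1) :
  (forall k, f k = lift i0 k) -> (forall j, J i0 j = 0) ->
  \det (rowsub f J *m (rowsub f J) ^t*) = \det (J *m J ^t* + unit_proj i0).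
Proof.
move=> fE J0; rewrite [RHS](expand_det_row _ i0) (bigD1 i0)//= big1 ?addr0; last first.
  move=> j ji; rewrite !mxE eqxx (negbTE ji)/= big1 ?addr0 ?mul0r// => k _.
  by rewrite J0 mul0r.
rewrite [X in X * _]mxE ct_gramE big1 ?add0r; last by move=> k _; rewrite J0 mul0r.
rewrite mxE eqxx mul1r /cofactor -signr_odd addnn odd_double expr0 mul1r.
congr (\det _); apply/matrixP => a b; rewrite ct_gramE !mxE.
rewrite [(lift i0 a == i0)]eq_sym (negbTE (neq_lift _ _)) addr0.
by apply: eq_bigr => k _; rewrite !mxE !fE.
Qed.

(** Common form of the two side formulas: [i0] is the zero row, [f] selects the others, and [a] is
    the position of the first selected row relative to the row [i] of the point considered. *)
Lemma formula_side Phi Phis x (i0 i : 'I_n.+1) (k : int) (W : R -> 'rV[R[i]]_n.+1)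
    (f : 'I_n -> 'I_n.+1) (a b : int) :
  k = i%:Z - l%:Z -> i != i0 ->
  (forall m, f m = lift i0 m) ->
  (forall m : 'I_n, (f m)%:Z - i%:Z = a + m%:Z) -> b = a + n%:Z - 1 ->
  W x = (-1) ^+ i0 *: cofrow (umat Phi x) i0 ->
  let J := s *: umat Phi x in
  (forall j, umat Phi x i0 j = 0) -> rnorm (cofrow J i0) != 0 ->
  (J *m J ^t* + unit_proj i0) *m (s *: umat Phis x) = J ->
  Phis (x + c i) =
  (- ((h ^+ (2 * l - 2))%:C * (\det (rowsub f J *m (rowsub f J) ^t*))^-1)) *:
  cross [seq (if j == 0 then tau (- (k%:~R * h)) W (x + c i)
              else map_mx Num.conj (tau (j%:~R * h) Phi (x + c i)))
        | j <- zrange a b].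
Proof.
move=> kE ii0 fE fa bE Wx J U0 rJ KQ.
have J0 j : J i0 j = 0 by rewrite mxE U0 mulr0.
have -> : Phis (x + c i) = row i (umat Phis x) by rewrite rowK.
apply: (dual_row_side h_gt0 ii0 U0 rJ KQ).
  rewrite (det_gram_rowsub fE J0) divfK; last first.
    have [-> | h0] := det_gram_proj J0; last by move: rJ; rewrite h0 eqxx.
    by rewrite -(rmorph0 (real_complex R)) (inj_eq (@complexI R)).
  have -> : n = (2 * l - 2).+1 by move: nl; lia.
  by rewrite exprS rmorphM.
move=> m; rewrite (nth_zrange _ _ bE (ltn_ord m)) -fa -fE.
have -> : ((f m)%:Z - i%:Z == 0) = (f m == i) by rewrite subr_eq0.
case: eqP => _.
  by rewrite /tau kE -Wx /wshift addrK.
by rewrite -map_row; congr map_mx; exact: tau_wshift.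
Qed.

Lemma cross_W Phi x (i0 : 'I_n.+1) (a b : int) :
  (forall m : 'I_n, (lift i0 m)%:Z - l%:Z = a + m%:Z) -> b = a + n%:Z - 1 ->
  cross [seq tau (j%:~R * h) Phi x | j <- zrange a b] =
  (-1) ^+ i0 *: cofrow (umat Phi x) i0.
Proof.
move=> fa bE; apply: cross_cofrow => m.
by rewrite (nth_zrange _ _ bE (ltn_ord m)) -fa rowK.
Qed.

Lemma formula_minus Phi Phis x (i : 'I_n.+1) (k : int) :
  k = i%:Z - l%:Z -> - (l%:Z - 1) <= k ->
  let J := s *: umat Phi x in
  let R0 := rowsub (@ord_tail n.+1) J in
  (forall j, umat Phi x ord0 j = 0) -> rnorm (cofrow J ord0) != 0 ->
  (J *m J ^t* + unit_proj ord0) *m (s *: umat Phis x) = J ->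
  Phis (x + c i) =
  (- ((h ^+ (2 * l - 2))%:C * (\det (R0 *m R0 ^t*))^-1)) *:
  cross [seq (if j == 0 then tau (- (k%:~R * h)) (fun y =>
                cross [seq tau (j%:~R * h) Phi y | j <- zrange (- l%:Z + 1) (l%:Z - 1)]) (x + c i)
              else map_mx Num.conj (tau (j%:~R * h) Phi (x + c i)))
        | j <- zrange (- l%:Z - k + 1) (l%:Z - k - 1)].
Proof.
move=> kE k1 J R0; apply: formula_side => //.
- by apply/eqP => i0; move: k1; rewrite kE i0 /=; lia.
- by move=> m; exact/val_inj.
- by move=> m; rewrite kE /=; lia.
- by move: nl; lia.
by apply: cross_W => [m|]; [rewrite /= /bump/=; lia|move: nl; lia].
Qed.

Lemma formula_plus Phi Phis x (i : 'I_n.+1) (k : int) :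
  k = i%:Z - l%:Z -> k <= l%:Z - 2 ->
  let J := s *: umat Phi x in
  let R0 := rowsub (widen_ord (leq_pred n.+1)) J in
  (forall j, umat Phi x ord_max j = 0) -> rnorm (cofrow J ord_max) != 0 ->
  (J *m J ^t* + unit_proj ord_max) *m (s *: umat Phis x) = J ->
  Phis (x + c i) =
  (- ((h ^+ (2 * l - 2))%:C * (\det (R0 *m R0 ^t*))^-1)) *:
  cross [seq (if j == 0 then tau (- (k%:~R * h)) (fun y =>
                cross [seq tau (j%:~R * h) Phi y | j <- zrange (- l%:Z) (l%:Z - 2)]) (x + c i)
              else map_mx Num.conj (tau (j%:~R * h) Phi (x + c i)))
        | j <- zrange (- l%:Z - k) (l%:Z - k - 2)].
Proof.
move=> kE k1 J R0; apply: formula_side => //.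
- by apply/eqP => i0; move: k1; rewrite kE i0 /=; move: nl; lia.
- by move=> m; apply/val_inj; rewrite /= /bump leqNgt ltn_ord.
- by move=> m; rewrite kE /=; lia.
- by move: nl; lia.
by apply: cross_W => [m|]; [rewrite lift_max; lia|move: nl; lia].
Qed.

End DualFormula.

(** * Representatives of band-limited transforms *)

Section BandLimited.
Context {R : realType}.

Lemma ae_neq (a : R) : {ae leb, forall x : R, x != a}.
Proof.
exists [set a]; split => //; first exact: lebesgue_measure_set1.
by move=> x /= /negP; rewrite negbK => /eqP.
Qed.

Lemma le_norm_sqmod (eta : R) (z : R[i]) : 0 <= eta -> eta%:C <= `|z| -> eta ^+ 2 <= sqmod z.
Proof.
move=> e0 hz; rewrite -lecR -mul_conj -normCK rmorphXn /=.
by apply: lerXn2r => //; rewrite nnegrE ?normr_ge0// (lecR 0).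
Qed.

(** Passing from the closed band to the open one costs only the two endpoints, a null set. *)
Lemma bandlimited_fourier w (f : R -> R[i]) : bandlimited w f ->
  is_fourier f (fourier f) /\
  {ae leb, forall x : R, x \notin `]- w, w[ -> fourier f x = 0}.
Proof.
move=> [g fg gw]; have ff : is_fourier f (fourier f).
  by rewrite /fourier; case: xgetP => [h -> //|/(_ g)].
split => //.
have h1 := aeI (is_fourier_uniq ff fg) gw; have h2 := aeI (ae_neq w) (ae_neq (- w)).
apply: aeS (aeI h1 h2) => x [[-> hg] [xw xNw]] xI; apply: hg.
move: xI; rewrite !in_itv/= !negb_and -!leNgt -!ltNge => /orP[] h.
  by apply/orP; left; rewrite lt_neqAle xNw.
by apply/orP; right; rewrite lt_neqAle eq_sym xw.
Qed.

Lemma is_fourier_cut (f g : R -> R[i]) (A : set R) : is_fourier f g -> measurable A ->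
  {ae leb, forall x, ~ A x -> g x = 0} ->
  is_fourier f (fun x => (\1_A x)%:C * g x) /\
  {ae leb, forall x, g x = (\1_A x)%:C * g x}.
Proof.
move=> fg mA gA.
have ae : {ae leb, forall x, g x = (\1_A x)%:C * g x}.
  apply: aeS gA => x hx; rewrite indicE.
  by have [xA|xA] := pselect (A x); [rewrite mem_set// rmorph1 mul1r|rewrite hx// mulr0].
split => //; apply: (is_fourier_aer fg) => //.
by apply: cmeasM; [exact: cmeas_indic|case: (is_fourier_inL2r fg)].
Qed.

Lemma bandlimited_cut w (f : R -> R[i]) : bandlimited w f -> exists g,
  [/\ is_fourier f g, forall x, x \notin `]- w, w[ -> g x = 0 &
      {ae leb, forall x, fourier f x = g x}].
Proof.
move=> /bandlimited_fourier[ff fw].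
have [h1 h2] := is_fourier_cut (A := [set` `]- w, w[]) ff (measurable_itv _)
  (aeS (fun x h xA => h (introN idP xA)) fw).
exists (fun x => (\1_([set` `]- w, w[]) x)%:C * fourier f x); split => // x xw.
by rewrite indicE memNset ?rmorph0 ?mul0r//; exact/negP.
Qed.

(** The bound on the sum bounds each term almost everywhere in the band; cutting each transform off
    where its bound fails keeps it a transform and makes the bound valid at every point. *)
Lemma bandlimited_bounded_cut N w gamma (phi : 'I_N -> R -> R[i]) : 0 <= gamma ->
  (forall j, bandlimited w (phi j)) ->
  {ae leb, forall x : R, x \in `]- w, w[ ->
    \sum_(j < N) sqmod (fourier (phi j) x) <= gamma} ->
  exists G : 'I_N -> R -> R[i], [/\ forall j, is_fourier (phi j) (G j),
    forall j x, sqmod (G j x) <= gamma,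
    forall j x, x \notin `]- w, w[ -> G j x = 0 &
    {ae leb, forall x, forall j, fourier (phi j) x = G j x}].
Proof.
move=> g0 band sb.
pose A j : set R := [set` `]- w, w[] `&` [set x | sqmod (fourier (phi j) x) <= gamma].
have mA j : measurable (A j).
  apply: measurableI; first exact: measurable_itv.
  have [ff _] := bandlimited_fourier (band j).
  have := measurable_sqmod (proj1 (is_fourier_inL2r ff)).
  move=> /(_ measurableT [set` `]-oo, gamma]] (measurable_itv _)); rewrite setTI.
  by congr measurable; apply/seteqP; split => x /=; rewrite in_itv.
have h j : is_fourier (phi j) (fun x => (\1_(A j) x)%:C * fourier (phi j) x) /\
    {ae leb, forall x, fourier (phi j) x = (\1_(A j) x)%:C * fourier (phi j) x}.
  have [ff fw] := bandlimited_fourier (band j).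
  apply: is_fourier_cut => //; apply: aeS (aeI fw sb) => x [hx hs] xA.
  apply: hx; apply/negP => xw; apply: xA; split => //=.
  apply: le_trans (hs xw); rewrite (bigD1 j)//= lerDl sumr_ge0// => i _.
  exact: sqmod_ge0.
exists (fun j x => (\1_(A j) x)%:C * fourier (phi j) x); split.
- by move=> j; case: (h j).
- move=> j x; rewrite indicE; have [xA|xA] := pselect (A j x).
    by rewrite mem_set// rmorph1 mul1r; case: xA.
  by rewrite memNset// rmorph0 mul0r sqmod0.
- move=> j x xw; rewrite indicE memNset ?rmorph0 ?mul0r// => -[xA _].
  by move/negP: xw.
- by apply: ae_ffun => j; case: (h j).
Qed.

End BandLimited.

(** * The zero rows over the three intervals *)

Section Intervals.
Context {R : realType} (n l : nat) (w h : R).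
Hypothesis h_gt0 : 0 < h.
Hypothesis nl : n.+1 = (2 * l)%N.
Hypothesis w_le : w <= l%:R * h.
Hypothesis w_gt : (2 * l%:R - 1) * h < 2 * w.
Local Notation outband := (@outband R n l w h).
Local Notation D0 := (`[0, h[%classic : set R).

Let l_ge1 : h <= l%:R * h.
Proof. by rewrite ler_peMl ?(ltW h_gt0)// ler1n; move: nl; lia. Qed.

Let ord_le (m : 'I_n.+1) : m%:R * h <= (2 * l%:R - 1) * h.
Proof.
rewrite ler_wpM2r ?(ltW h_gt0)// lerBrDr natr1 -natrM ler_nat -nl.
exact: ltn_ord.
Qed.

Let ord_ge0 (m : 'I_n.+1) : 0 <= m%:R * h.
Proof. by rewrite mulr_ge0// ltW. Qed.

(** The first shift falls at or below [-w]. The others exceed [-w] because they are at least [h]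
    further, and the last stays below [w] because [w_gt] puts [Iminus] to the left of [Iplus]. *)
Lemma outband_minus x : x \in Iminus l w h -> outband x = pred1 ord0.
Proof.
rewrite in_itv/= => /andP[x0 x1]; apply/funext => m /=.
rewrite /outband in_itv/= wshiftE; apply/idP/idP.
  apply: contraR => m0; have m1 : h <= m%:R * h.
    by rewrite ler_peMl ?(ltW h_gt0)// ler1n lt0n; exact: m0.
  by move: (ord_le m) h_gt0 w_gt w_le => *; apply/andP; split; lra.
move=> /eqP ->; apply/negP => /andP[]; rewrite /= sub0r mulNr; lra.
Qed.

Lemma outband_plus x : x \in Iplus l w h -> outband x = pred1 ord_max.
Proof.
rewrite in_itv/= => /andP[x0 x1]; apply/funext => m /=.
rewrite /outband in_itv/= wshiftE; apply/idP/idP.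
  apply: contraR => m0; have m1 : m%:R * h <= (2 * l%:R - 2) * h.
    rewrite ler_wpM2r ?(ltW h_gt0)// lerBrDr -natrD -natrM ler_nat -nl addn2 !ltnS.
    by have := ltn_ord m; rewrite ltnS leq_eqVlt => /orP[/eqP me|//]; case/eqP: m0; exact/val_inj.
  by move: (ord_ge0 m) h_gt0 w_gt w_le => *; apply/andP; split; lra.
move=> /eqP ->; apply/negP => /andP[] _; have -> : (ord_max : 'I_n.+1)%:R = 2 * l%:R - 1 :> R.
  by rewrite /= -natrM -nl -natr1 addrK.
nra.
Qed.

Lemma outband_center x m : x \in Icenter l w h -> ~~ outband x m.
Proof.
rewrite in_itv/= => /andP[x0 x1]; rewrite /outband negbK in_itv/= wshiftE.
by move: (ord_le m) (ord_ge0 m) => *; apply/andP; split; lra.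
Qed.

Lemma intervals_cover x : D0 x -> x != 0 -> x != - w + l%:R * h ->
  x != w - (l%:R - 1) * h ->
  [\/ x \in Iminus l w h, x \in Icenter l w h | x \in Iplus l w h].
Proof.
rewrite /= in_itv/= => /andP[x0 xh] n0 n1 n2.
have [x1|x1] := ltP x (- w + l%:R * h).
  by constructor 1; rewrite in_itv/= x1 lt_neqAle eq_sym n0 x0.
have {}x1 : - w + l%:R * h < x by rewrite lt_neqAle eq_sym n1.
have [x2|x2] := ltP x (w - (l%:R - 1) * h); first by constructor 2; rewrite in_itv/= x1.
by constructor 3; rewrite in_itv/= xh andbT lt_neqAle eq_sym n2.
Qed.

Lemma intervals_sub x :
  [\/ x \in Iminus l w h, x \in Icenter l w h | x \in Iplus l w h] -> D0 x.
Proof.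
rewrite !in_itv/=; move: h_gt0 w_gt w_le => h0 w1 w2 -[] /andP[x1 x2];
  rewrite in_itv/=; apply/andP; split; lra.
Qed.

Lemma Iplus_notin_Iminus x : x \in Iplus l w h -> x \notin Iminus l w h.
Proof.
rewrite !in_itv/= => /andP[x1 x2]; rewrite negb_and -!leNgt; apply/orP; right.
by move: w_gt => w1; lra.
Qed.

End Intervals.

(** * From the hypotheses to the fibres *)

Section Main.
Context {R : realType} (n l : nat) (w t0 h gamma sigma eta : R).
Variable phi : 'I_n.+1 -> R -> R[i].
Hypothesis nl : n.+1 = (2 * l)%N.
Hypothesis h_gt0 : 0 < h.
Hypothesis ht0 : h * t0 = 2 * pi.
Hypothesis w_le : w <= l%:R * h.
Hypothesis w_gt : (2 * l%:R - 1) * h < 2 * w.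
Hypothesis gamma_ge0 : 0 <= gamma.
Hypothesis sigma_gt0 : 0 < sigma.
Hypothesis eta_gt0 : 0 < eta.
Hypothesis phi_band : forall j, bandlimited w (phi j).
Local Notation c := (@wshift R n l h).
Local Notation s := ((Num.sqrt h)%:C : R[i]).
Local Notation D0 := (`[0, h[%classic : set R).
Local Notation outband := (@outband R n l w h).
Local Notation J x := (s *: @umat R n l h (fourierv phi) x).
Hypothesis sum_bound : {ae leb, forall x : R, x \in `]- w, w[ ->
  \sum_(j < n.+1) sqmod (fourier (phi j) x) <= gamma}.
Hypothesis side_bound : {ae leb, forall x : R,
  (x \in Iminus l w h) || (x \in Iplus l w h) -> sigma <= sqminors n (J (modh h x))}.
Hypothesis center_bound : {ae leb, forall x : R,
  x \in Icenter l w h -> eta%:C <= `|\det (J (modh h x))|}.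

Lemma modh_id x : D0 x -> modh h x = x.
Proof.
rewrite /= in_itv/= => /andP[x0 x1].
suff fl : Num.floor (x / h) = 0 by rewrite /modh fl mul0r subr0.
by apply/eqP; rewrite floor_eq add0r divr_ge0 ?(ltW h_gt0)//= ltr_pdivrMr ?mul1r.
Qed.

Lemma umat_pgram (f : 'I_n.+1 -> R -> R[i]) G :
  {ae leb, forall x, forall j, fourier (f j) x = G j x} ->
  {ae leb, forall x, s *: @umat R n l h (fourierv f) x = @pgram R n l h G x}.
Proof.
move=> fG; have := @ae_window_shift _ n l h (fun y => forall j, fourier (f j) y = G j y) fG.
by apply: aeS => x hx; apply/matrixP => m j; rewrite !mxE hx.
Qed.

Lemma side_neq0 x i0 : D0 x -> outband x = pred1 i0 ->
  (forall j, J x i0 j = 0) -> sigma <= sqminors n (J (modh h x)) ->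
  sigma <= rnorm (cofrow (J x) i0).
Proof.
move=> xD xo J0; rewrite modh_id// => hx; exact: le_trans hx (sqminors_le_cofrow J0).
Qed.

(** The constant bounds the squared modulus of [det K]. On the sides [det K] is the squared norm of
    the cofactor row, at least [sigma]; on the centre it is [|det J|^2], at least [eta^2]. Squaring
    gives [sigma^2] and [eta^4]. *)
Lemma prepared : exists G, [/\ forall j, is_fourier (phi j) (G j),
  forall j x, sqmod (G j x) <= gamma,
  forall j x, x \notin `]- w, w[ -> G j x = 0 &
  {ae leb, forall x, D0 x -> [/\ J x = @pgram R n l h G x,
    Num.min (sigma ^+ 2) (eta ^+ 2 * eta ^+ 2) <= sqmod (\det (gramP (outband x) (J x))),
    forall i0, outband x = pred1 i0 ->
      (x \in Iminus l w h) || (x \in Iplus l w h) -> rnorm (cofrow (J x) i0) != 0 &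
    x \in Icenter l w h -> \det (J x) != 0]}].
Proof.
have [G [phiG G_le G_band phi_G]] := bandlimited_bounded_cut gamma_ge0 phi_band sum_bound.
exists G; split => //.
have ae3 := aeI (ae_neq 0) (aeI (ae_neq (- w + l%:R * h)) (ae_neq (w - (l%:R - 1) * h))).
apply: aeS (aeI ae3 (aeI (umat_pgram phi_G) (aeI side_bound center_bound))).
move=> x [[x0 [x1 x2]] [JG [hs hc]]] xD.
have J0 i j : outband x i -> J x i j = 0 by move=> xi; rewrite JG; exact: (pgram_out G_band).
have sideE i0 : outband x = pred1 i0 ->
    (x \in Iminus l w h) || (x \in Iplus l w h) -> sigma <= rnorm (cofrow (J x) i0).
  by move=> xo /hs; apply: side_neq0 => // j; apply: J0; rewrite xo /= eqxx.
have centerE : x \in Icenter l w h -> eta ^+ 2 <= sqmod (\det (J x)).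
  by move=> /hc; rewrite modh_id//; apply: le_norm_sqmod; exact: ltW.
have side_det i0 : outband x = pred1 i0 ->
    (x \in Iminus l w h) || (x \in Iplus l w h) ->
    sigma ^+ 2 <= sqmod (\det (gramP (outband x) (J x))).
  move=> xo /(sideE _ xo) hx; rewrite /gramP xo dproj_unit.
  have [|->|h0] := @det_gram_proj R n i0 (J x).
  - by move=> j; apply: J0; rewrite xo /= eqxx.
  - by rewrite sqmodR; apply: lerXn2r => //; rewrite nnegrE ?rnorm_ge0// ltW.
  - by move: hx; rewrite h0 leNgt sigma_gt0.
split => //.
- rewrite ge_min; have [xm|xc|xp] := intervals_cover xD x0 x1 x2.
  + by rewrite (side_det ord0) ?xm//; exact: outband_minus.
  + apply/orP; right; rewrite /gramP dproj_pred0 ?addr0; last first.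
      by move=> i; exact: outband_center.
    rewrite det_mulmx det_ct sqmodM sqmod_conj.
    by have hx := centerE xc; apply: ler_pM; rewrite ?sqr_ge0.
  + by rewrite (side_det ord_max) ?xp ?orbT//; exact: outband_plus.
- move=> i0 xo /(sideE _ xo) hx; apply/eqP => h0.
  by move: hx; rewrite h0 leNgt sigma_gt0.
- move=> /centerE hx; apply/eqP => h0.
  by move: hx; rewrite h0 sqmod0 leNgt exprn_gt0.
Qed.

Let c0_gt0 : 0 < Num.min (sigma ^+ 2) (eta ^+ 2 * eta ^+ 2).
Proof.
by rewrite lt_min; apply/andP; split; [exact: exprn_gt0|apply: mulr_gt0; exact: exprn_gt0].
Qed.

Lemma main_frame : is_frame w t0 phi.
Proof.
have [G [phiG G_le G_band hG]] := prepared.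
have det_lb : {ae leb, forall x, D0 x -> Num.min (sigma ^+ 2) (eta ^+ 2 * eta ^+ 2) <=
    sqmod (\det (gramP (outband x) (@pgram R n l h G x)))}.
  by apply: aeS hG => x hx xD; have [<-] := hx xD.
have [A [B [A0 AB hAB]]] :=
  frame_bounds h_gt0 nl gamma_ge0 ht0 w_le c0_gt0 phiG G_le det_lb.
exists A, B; split => // f /bandlimited_cut[g [fg gb _]].
exact: hAB fg gb.
Qed.

Lemma main_exists : exists phis, dual_generators w t0 phi phis.
Proof.
have [G [phiG G_le G_band hG]] := prepared.
have det_lb : {ae leb, forall x, D0 x -> Num.min (sigma ^+ 2) (eta ^+ 2 * eta ^+ 2) <=
    sqmod (\det (gramP (outband x) (@pgram R n l h G x)))}.
  by apply: aeS hG => x hx xD; have [<-] := hx xD.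
have [psi [p [psip pb hop]]] :=
  dual_exists h_gt0 nl gamma_ge0 ht0 w_le c0_gt0 phiG G_le G_band det_lb.
exists psi => j; split => //; exists (p j) => //; apply: aeT => x xw; apply: pb.
apply: contra xw; rewrite !in_itv/= => /andP[x1 x2].
by rewrite !ltW.
Qed.

(** Any dual generators satisfy the matrix equation by [frame_op_matrix]; being band-limited, they
    also give [Q] the zero rows of [J], which turns that equation into [K Q = J]. *)
Lemma main_dual phis : dual_generators w t0 phi phis ->
  {ae leb, forall x, D0 x ->
    let Q := s *: @umat R n l h (fourierv phis) x in
    [/\ J x *m (J x) ^t* *m Q = J x, gramP (outband x) (J x) *m Q = J x,
      forall i0, outband x i0 -> forall j, umat l h (fourierv phi) x i0 j = 0,
      forall i0, outband x = pred1 i0 ->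
      (x \in Iminus l w h) || (x \in Iplus l w h) -> rnorm (cofrow (J x) i0) != 0 &
    x \in Icenter l w h -> \det (J x) != 0]}.
Proof.
move=> hphis; have [G [phiG G_le G_band hG]] := prepared.
have [p hp] := boolp.choice (fun j => bandlimited_cut (proj1 (hphis j))).
have phisp j : is_fourier (phis j) (p j) by case: (hp j).
have pb j x : x \notin `]- w, w[ -> p j x = 0 by case: (hp j) => _ h1 _; exact: h1.
have phis_p : {ae leb, forall x, forall j, fourier (phis j) x = p j x}.
  by apply: ae_ffun => j; case: (hp j).
have hop := (frame_op_matrix h_gt0 nl gamma_ge0 ht0 w_le phiG G_le G_band phisp pb).1
  (fun j => proj2 (hphis j)).
apply: aeS (aeI hG (aeI (umat_pgram phis_p) hop)) => x [hx [QE hJ]] xD.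
have [JG _ rJ dJ] := hx xD.
have J0 i j : outband x i -> J x i j = 0 by move=> xi; rewrite JG; exact: (pgram_out G_band).
have JQ : J x *m (J x) ^t* *m (s *: umat l h (fourierv phis) x) = J x.
  by rewrite JG QE; exact: hJ.
have Q0 i j : outband x i -> (s *: umat l h (fourierv phis) x) i j = 0.
  by move=> xi; rewrite QE; exact: (pgram_out pb).
split => //.
- exact: gramP_solve J0 Q0 JQ.
- move=> i0 xi j; have := J0 _ j xi; rewrite mxE => /eqP.
  by rewrite mulf_eq0 (negbTE (sqrt_real_neq0 h_gt0)) => /eqP.
Qed.

End Main.


Theorem theorem4p7 (R : realType) (l : nat) (w t0 h : R)
    (phi : 'I_(2 * l) -> R -> R[i]) (delta gamma sigma eta : R)
    (l_ge1 : (1 <= l)%N) (w_gt0 : 0 < w) (t0_gt0 : 0 < t0)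
    (h_def : h = 2 * pi / t0)
    (h_ge : w / l%:R <= h) (h_lt : h < w / (l%:R - 2^-1))
    (phi_band : forall j, bandlimited w (phi j))
    (delta_gt0 : 0 < delta) (gamma_gt0 : 0 < gamma)
    (sigma_gt0 : 0 < sigma) (eta_gt0 : 0 < eta)
    (sum_bounds : {ae leb, forall x : R, x \in `]- w, w[ ->
       delta <= \sum_(j < 2 * l) sqmod (fourier (phi j) x) <= gamma})
    (minors_bound : {ae leb, forall x : R,
       (x \in Iminus l w h) || (x \in Iplus l w h) ->
       sigma <= sqminors (2 * l - 1) (preGram h (fourierv phi) x)})
    (det_bound : {ae leb, forall x : R, x \in Icenter l w h ->
       eta%:C <= `|\det (preGram h (fourierv phi) x)|}) :
  [/\ is_frame w t0 phi,
      exists phis, dual_generators w t0 phi phis &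
      forall phis, dual_generators w t0 phi phis ->
      [/\ forall k : int, - (l%:Z - 1) <= k <= l%:Z - 1 ->
            {ae leb, forall x : R, x - k%:~R * h \in Iminus l w h ->
              fourierv phis x = dual_minus w h (fourierv phi) k x},
          forall k : int, - l%:Z <= k <= l%:Z - 1 ->
            {ae leb, forall x : R, x - k%:~R * h \in Icenter l w h ->
              fourierv phis x = dual_center h (fourierv phi) k x} &
          forall k : int, - l%:Z <= k <= l%:Z - 2 ->
            {ae leb, forall x : R, x - k%:~R * h \in Iplus l w h ->
              fourierv phis x = dual_plus w h (fourierv phi) k x}]].
Proof.
have h_gt0 : 0 < h by rewrite h_def divr_gt0// mulr_gt0// pi_gt0.
have ht0 : h * t0 = 2 * pi by rewrite h_def divfK// gt_eqF.
have lR : 1 <= l%:R :> R by rewrite ler1n.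
have w_le : w <= l%:R * h.
  by move: h_ge; rewrite ler_pdivrMr 1?mulrC// (lt_le_trans ltr01).
have w_gt : (2 * l%:R - 1) * h < 2 * w.
  have l2 : 0 < l%:R - 2^-1 :> R by rewrite subr_gt0 (lt_le_trans _ lR)// invf_lt1// ltr1n.
  move: h_lt; rewrite ltr_pdivlMr// => h1.
  have -> : (2 * l%:R - 1) * h = 2 * (h * (l%:R - 2^-1)) by field.
  by rewrite ltr_pM2l.
(* Once [l] is a successor, so is [2 * l] by computation, and matrices of that size are matrices of
   size [n.+1] without any cast. *)
case: l l_ge1 phi phi_band lR w_le w_gt h_ge h_lt sum_bounds minors_bound det_bound =>
  // l' _ phi phi_band lR w_le w_gt _ _ sum_bounds minors_bound det_bound.
pose n := (2 * l'.+1).-1; have nl : n.+1 = (2 * l'.+1)%N by [].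
have sum_bound : {ae leb, forall x : R, x \in `]- w, w[ ->
    \sum_(j < n.+1) sqmod (fourier (phi j) x) <= gamma}.
  by apply: aeS sum_bounds => x hx /hx/andP[].
rewrite subn1 in minors_bound.
have pE (Phi : R -> 'rV[R[i]]_(2 * l'.+1)) x :
    preGram h Phi x = (Num.sqrt h)%:C *: @umat R n l'.+1 h Phi (modh h x).
  by apply/row_matrixP => i; rewrite [LHS]rowK [RHS]linearZ/= rowK.
have side_bound : {ae leb, forall x : R,
    (x \in Iminus l'.+1 w h) || (x \in Iplus l'.+1 w h) ->
    sigma <= sqminors n ((Num.sqrt h)%:C *: @umat R n l'.+1 h (fourierv phi) (modh h x))}.
  by apply: aeS minors_bound => x hx /hx; rewrite pE.
have center_bound : {ae leb, forall x : R, x \in Icenter l'.+1 w h ->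
    eta%:C <= `|\det ((Num.sqrt h)%:C *: @umat R n l'.+1 h (fourierv phi) (modh h x))|}.
  by apply: aeS det_bound => x hx /hx; rewrite pE.
have ge0 := ltW gamma_gt0.
split.
- exact: (@main_frame R n l'.+1 w t0 h gamma sigma eta phi nl h_gt0 ht0 w_le w_gt
    ge0 sigma_gt0 eta_gt0 phi_band sum_bound side_bound center_bound).
- exact: (@main_exists R n l'.+1 w t0 h gamma sigma eta phi nl h_gt0 ht0 w_le w_gt
    ge0 sigma_gt0 eta_gt0 phi_band sum_bound side_bound center_bound).
move=> phis hphis.
have hm := @main_dual R n l'.+1 w t0 h gamma sigma eta phi nl h_gt0 ht0 w_le w_gt
    ge0 sigma_gt0 eta_gt0 phi_band sum_bound side_bound center_bound phis hphis.
have fl (i : 'I_n.+1) (x : R) : `[0, h[%classic (x - @wshift R n l'.+1 h i) ->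
    modh h x = x - @wshift R n l'.+1 h i.
  by move=> xD; rewrite -{1}(subrK (@wshift R n l'.+1 h i) x); exact: modh_window.
have lk (k : int) : k <= l'.+1%:Z - 2 -> k <= l'.+1%:Z - 1.
  by move/le_trans; apply; rewrite lerD2l.
have kl (k : int) : - (l'.+1%:Z - 1) <= k -> - l'.+1%:Z <= k.
  by apply: le_trans; rewrite lerN2 gerBl.
split => k /andP[k1 k2].
- have [i kE] := index_ex nl (introT andP (conj (kl _ k1) k2)).
  have cE : k%:~R * h = @wshift R n l'.+1 h i by rewrite kE.
  (* The statement on the fibre over [x - k h] is transported to its point [x], which lies on the
     row [i = k + l]. *)
  apply: aeS (ae_shift (- @wshift R n l'.+1 h i) hm) => x hx xI.
  rewrite cE in xI; have xD := intervals_sub h_gt0 w_le w_gt (Or31 _ _ xI).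
  have xo := outband_minus h_gt0 nl w_le w_gt xI.
  have [_ KQ U0 rJ _] := hx xD; rewrite /gramP xo dproj_unit in KQ.
  have U00 := U0 ord0; rewrite xo /= eqxx in U00.
  have := formula_minus h_gt0 nl kE k1 (U00 isT) (rJ _ xo (introT orP (or_introl xI))) KQ.
  rewrite subrK => ->.
  by rewrite /dual_minus /Efun /preGramR pE (fl i x xD) xI.
- have [i kE] := index_ex nl (introT andP (conj k1 k2)).
  have cE : k%:~R * h = @wshift R n l'.+1 h i by rewrite kE.
  apply: aeS (ae_shift (- @wshift R n l'.+1 h i) hm) => x hx xI.
  rewrite cE in xI; have xD := intervals_sub h_gt0 w_le w_gt (Or32 _ _ xI).
  have [JQ _ _ _ dJ] := hx xD.
  have := formula_center h_gt0 nl kE (dJ xI) JQ; rewrite subrK => ->.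
  by rewrite /dual_center /Dfun pE (fl i x xD).
- have [i kE] := index_ex nl (introT andP (conj k1 (lk _ k2))).
  have cE : k%:~R * h = @wshift R n l'.+1 h i by rewrite kE.
  apply: aeS (ae_shift (- @wshift R n l'.+1 h i) hm) => x hx xI.
  rewrite cE in xI; have xD := intervals_sub h_gt0 w_le w_gt (Or33 _ _ xI).
  have xo := outband_plus h_gt0 nl w_le w_gt xI.
  have [_ KQ U0 rJ _] := hx xD; rewrite /gramP xo dproj_unit in KQ.
  have U00 := U0 ord_max; rewrite xo /= eqxx in U00.
  have := formula_plus h_gt0 nl kE k2 (U00 isT) (rJ _ xo (introT orP (or_intror xI))) KQ.
  rewrite subrK => ->.
  (* [preGramR] tests membership in [Iminus] only; disjointness of the intervals selects the branch
     without the last row. *)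
  by rewrite /dual_plus /Efun /preGramR pE (fl i x xD) (negbTE (Iplus_notin_Iminus w_gt xI)).
Qed.
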